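(* For every integer $n\ge 2$ we have $\varphi^{(n)}(-1)>0$, while $\varphi'(-1)=0$.
   Context: $\xi(s)=s(s-1)\pi^{-s/2}\Gamma(s/2)\zeta(s)$, where $\zeta$ is the Riemann zeta function; $\xi$ is entire. Define $\varphi(z)=\xi\!\left(\frac{1}{1-z}\right)$, analytic on $\mathbb{C}\setminus\{1\}$. *)

(* Defs.v *)
From HB Require Import structures.
From mathcomp Require Import all_boot all_order all_algebra.
From mathcomp Require Import complex.
From mathcomp Require Import all_classical all_reals all_analysis.
Set Implicit Arguments.
Unset Strict Implicit.
Unset Printing Implicit Defensive.
Import Order.TTheory GRing.Theory Num.Theory.
Import numFieldNormedType.Exports.
Local Open Scope classical_set_scope.
Local Open Scope ring_scope.
Local Open Scope complex_scope.

(* local expansion as a convergent power series *)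
Definition analytic_at (K : numFieldType) (f : K -> K) (s : K) : Prop :=
  exists a : nat -> K,
    \forall z \near s, series (fun n => a n * (z - s) ^+ n) @ \oo --> f z.

(* R[i] is a module over itself, with the topology of its norm (as the library
   does for an abstract numClosedFieldType). *)
Section ComplexNormedModule.
Variable R : realType.
#[non_forgetful_inheritance]
HB.instance Definition _ := PseudoPointedMetric.copy R[i] R[i]^o.
#[non_forgetful_inheritance]
HB.instance Definition _ := GRing.ComAlgebra.copy R[i] R[i]^o.
#[non_forgetful_inheritance]
HB.instance Definition _ := Vector.copy R[i] R[i]^o.
#[non_forgetful_inheritance]
HB.instance Definition _ := NormedModule.copy R[i] R[i]^o.
#[non_forgetful_inheritance]
HB.instance Definition _ := Num.ClosedField.on R[i].
End ComplexNormedModule.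

Section Xi.
Variable R : realType.
Local Notation C := R[i].
Local Notation Re := complex.Re.
Local Notation Im := complex.Im.
Implicit Types s z w : C.

Definition cexp z : C :=
  (expR (Re z))%:C * (cos (Im z) +i* sin (Im z)).

(* x ^ s = exp (s log x), meaningful for x > 0 *)
Definition cpow (x : R) s : C := cexp (s * (ln x)%:C).

Definition cintegral (D : set R) (f : R -> C) : C :=
  (\int[lebesgue_measure]_(t in D) Re (f t))%R +i*
  (\int[lebesgue_measure]_(t in D) Im (f t))%R.

Definition Gamma_euler s : C :=
  cintegral `]0, +oo[ (fun t => cpow t (s - 1) * (expR (- t))%:C).

(* Outside the half-plane Re s > 0, Gamma is continued by its recurrence:
   Gamma s = Gamma (s + n) / (s (s + 1) ... (s + n - 1)), where n is the
   least integer such that Re s + n > 0.  The poles receive the value 0. *)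
Definition Gamma s : C :=
  if 0 < Re s then Gamma_euler s
  else let n := (Num.truncn (- Re s)).+1 in
       Gamma_euler (s + n%:R) / \prod_(k < n) (s + k%:R).

(* The analytic continuation to the complement of 1 of the Dirichlet series
   \sum_(n >= 1) n ^ (- s), Re s > 1.  It is unique away from 1. *)
Definition is_zeta (f : C -> C) : Prop :=
  (forall s, 1 < Re s ->
     series (fun n => cpow n.+1%:R (- s)) @ \oo --> f s) /\
  (forall s, s != 1 -> analytic_at f s).

Definition zeta : C -> C := get is_zeta.

Definition xi_formula s : C :=
  s * (s - 1) * cpow pi (- s / 2%:R) * Gamma (s / 2%:R) * zeta s.

(* The limit fills in the removable singularities of the formula at 1 (pole
   of zeta) and at 0, -2, -4, ... (poles of Gamma (s / 2)); at every other
   point the formula is continuous and the limit is its value. *)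
Definition xi s : C := lim (xi_formula w @[w --> s^']).

(* only meaningful for z != 1 *)
Definition phi z : C := xi (1 / (1 - z)).

End Xi.

(* Main.v *)
Require Import Defs.
From HB Require Import structures.
From mathcomp Require Import all_boot all_order all_algebra.
From mathcomp Require Import complex.
From mathcomp Require Import all_classical all_reals all_analysis.
Import Order.TTheory GRing.Theory Num.Theory.
Import numFieldNormedType.Exports.
From mathcomp Require Import measurable_realfun zify ring lra.
Set Implicit Arguments.
Unset Strict Implicit.
Unset Printing Implicit Defensive.
Local Open Scope classical_set_scope.
Local Open Scope ring_scope.
Local Open Scope complex_scope.
Import ComplexField.Normc.

(* Write psi(t) = \sum_(n >= 1) e^(-pi n^2 t).  Riemann's second proof of the
   functional equation gives, near s = 1/2,
     xi(s) = Xi(s) = 1 + s (s - 1) \int_1^oo (t^(s/2) + t^((1-s)/2)) psi(t) dt / t,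
   so with M_n = \int_1^oo t^(-3/4) (ln t / 2)^n psi(t) dt the expansion of Xi at
   1/2 has vanishing odd coefficients and, for even n >= 2, the coefficients
   2 M_(n-2) / (n-2)! - M_n / (2 n!).  They are nonnegative, and positive for
   n = 2, because e^(-pi t) <= psi(t) <= 2 e^(-pi t) for t >= 1 and an integration
   by parts yield M_n <= n (n-1) / 2 * M_(n-2).  In the variable u = 1 / (1 - z) - 1/2,
   which vanishes at z = -1, the derivation d/dz is (1/2 + u)^2 d/du, and it
   preserves nonnegativity of coefficients.  Hence phi'(-1) is a quarter of the
   coefficient of u in Xi, that is 0; from the first derivative on the coefficient
   of u is positive, so all later derivatives are.

   The continuation of zeta is Xi(s) pi^(s/2) / (2 (s - 1) Gamma(s/2 + 1)).  The
   nonvanishing of Gamma is only needed far to the right, since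
   1 / Gamma(s) = s (s + 1) ... (s + n - 1) / Gamma(s + n).  The functional
   equation of psi is obtained following Polya: the average of cos^(2m) over
   the points pi k / l equals a sum of binomial coefficients 'C(2m, m + j l),
   and with l proportional to sqrt m both sides tend to theta series. *)

(** * Power series over the complex numbers *)

(** The point [-1] corresponds to [s = 1 / 2], so only the germ of [xi] there matters. But [zeta] is
    picked by [get] from a specification: a continuation has to be constructed before anything is
    known about [zeta], and the two are then compared near [1 / 2] by the identity theorem, along a
    path that avoids the pole. Since analyticity means a local power series, closure properties and
    derivatives all rest on bounds [|a n| r^n <= M]. With [u = s - 1/2] one has
    [s (s - 1) = u^2 - 1/4], while the sum of the two integrals is even in [u]; hence the difference
    of two moments in each even coefficient. Its nonnegativity asks for [M_n <= 4 n (n-1) M_(n-2)]: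
    the bound obtained has a margin of a factor 8, even after losing a factor 2 between [psi] and
    its first term. The constant coefficient [1 - M_0 / 2] escapes this argument, but the first
    derivative removes it; this is why the induction on nonnegative coefficients starts after one
    differentiation. *)

Section ComplexBasics.
Variable R : realType.
Local Notation C := R[i].
Implicit Types (z w s l : C) (r M x : R).

Lemma normcE z : `|z| = (normc z)%:C. Proof. by []. Qed.

Lemma normc_ge0 z : 0 <= normc z.
Proof. by rewrite -lecR -normcE normr_ge0. Qed.

Lemma normcB z w : normc (z - w) = normc (w - z).
Proof. by rewrite -normcN opprB. Qed.

Lemma normcR x : normc x%:C = `|x|.
Proof. by rewrite /= expr0n addr0 sqrtr_sqr. Qed.

Lemma normcX z n : normc (z ^+ n) = normc z ^+ n.
Proof. by elim: n => [|n IH]; rewrite ?expr0 ?normc1 // !exprS normcM IH. Qed.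

Lemma normc_triB z w s : normc (z - s) <= normc (z - w) + normc (w - s).
Proof. by apply: le_trans (le_normcD _ _); rewrite addrA subrK. Qed.

Lemma normc_sum (I : Type) (s : seq I) (P : pred I) (F : I -> C) :
  normc (\sum_(i <- s | P i) F i) <= \sum_(i <- s | P i) normc (F i).
Proof.
elim/big_rec2: _ => [|i x y _ xy]; first by rewrite normc0.
by apply: le_trans (le_normcD _ _) _; rewrite lerD2l.
Qed.

Lemma normc_eq0 z : (normc z == 0) = (z == 0).
Proof. by apply/eqP/eqP => [/eq0_normc //|->]; rewrite normc0. Qed.

Lemma normc_gt0 z : (0 < normc z) = (z != 0).
Proof. by rewrite lt_def normc_eq0 normc_ge0 andbT. Qed.

Lemma ReD z w : complex.Re (z + w) = complex.Re z + complex.Re w.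
Proof. by case: z; case: w. Qed.

Lemma ImD z w : complex.Im (z + w) = complex.Im z + complex.Im w.
Proof. by case: z; case: w. Qed.

Lemma ReN z : complex.Re (- z) = - complex.Re z. Proof. by case: z. Qed.

Lemma ImN z : complex.Im (- z) = - complex.Im z. Proof. by case: z. Qed.

Lemma ler_Re z : `|complex.Re z| <= normc z.
Proof.
by case: z => a b /=; rewrite -sqrtr_sqr ler_wsqrtr // lerDl sqr_ge0.
Qed.

Lemma ler_Im z : `|complex.Im z| <= normc z.
Proof.
by case: z => a b /=; rewrite -sqrtr_sqr ler_wsqrtr // lerDr sqr_ge0.
Qed.

Lemma normc_le_ReIm z : normc z <= `|complex.Re z| + `|complex.Im z|.
Proof.
case: z => a b; have -> : a +i* b = a%:C + 'i * b%:C by simpc.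
rewrite (le_trans (le_normcD _ _)) // normcM !normcR.
have -> : normc 'i = 1 :> R by rewrite /= expr0n expr1n add0r sqrtr1.
by rewrite mul1r; simpc.
Qed.

Lemma gt0C (e : C) : 0 < e -> exists2 d : R, 0 < d & e = d%:C.
Proof. by case: e => a b; rewrite ltcE /= => /andP[/eqP-> a0]; exists a. Qed.

Lemma cvgCP (T : Type) (F : set_system T) {FF : Filter F} (u : T -> C) l :
  u x @[x --> F] --> l <-> normc (u x - l) @[x --> F] --> (0 : R).
Proof.
split.
  move=> /cvgrPdist_lt ul; apply/cvgrPdist_lt => e e0.
  have : 0 < e%:C by rewrite ltcR.
  move=> /ul; apply: filterS => t.
  by rewrite normcE ltcR sub0r normrN ger0_norm ?normc_ge0 // normcB.
move=> /cvgrPdist_lt ul; apply/cvgrPdist_lt => _ /gt0C[e e0 ->].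
have := ul _ e0; apply: filterS => t.
by rewrite normcE ltcR sub0r normrN ger0_norm ?normc_ge0 // normcB.
Qed.

Lemma nbhsCP s (P : set C) :
  nbhs s P <-> exists2 r, 0 < r & forall z, normc (z - s) < r -> P z.
Proof.
split.
  move=> /nbhs_ballP[_ /gt0C[r r0 ->] rP]; exists r => // z zs.
  by apply: rP; rewrite /ball /= normcE ltcR normcB.
move=> [r r0 rP]; apply/nbhs_ballP; exists r%:C; first by rewrite /= ltcR.
by move=> z; rewrite /ball /= normcE ltcR normcB; exact: rP.
Qed.

Lemma cvgcD (T : Type) (F : set_system T) {FF : Filter F} (u v : T -> C) l l' :
  u x @[x --> F] --> l -> v x @[x --> F] --> l' ->
  u x + v x @[x --> F] --> l + l'.
Proof. by move=> ul vl; have h := @cvgD C C T F FF u v l l' ul vl; apply h. Qed.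

Lemma cvgcM (T : Type) (F : set_system T) {FF : Filter F} (u v : T -> C) l l' :
  u x @[x --> F] --> l -> v x @[x --> F] --> l' ->
  u x * v x @[x --> F] --> l * l'.
Proof. by move=> ul vl; have h := @cvgM C T F FF u v l l' ul vl; apply h. Qed.

Lemma cvgcV (T : Type) (F : set_system T) {FF : Filter F} (u : T -> C) l :
  l != 0 -> u x @[x --> F] --> l -> (u x)^-1 @[x --> F] --> l^-1.
Proof. by move=> l0 ul; have h := @cvgV C T F FF u l l0 ul; apply h. Qed.

Lemma cvg_nbhsCP (f : C -> C) s l : f z @[z --> s] --> l <->
  forall e, 0 < e -> exists2 d, 0 < d &
    forall z, normc (z - s) < d -> normc (f z - l) < e.
Proof.
split=> [/(@cvgCP _ _ (nbhs_filter s)) /cvgrPdist_lt h e /h /nbhsCP[d d0 dP]|h].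
  exists d => // z /dP.
  by rewrite sub0r normrN ger0_norm ?normc_ge0.
apply/(@cvgCP _ _ (nbhs_filter s))/cvgrPdist_lt => e /h[d d0 dP].
apply/nbhsCP; exists d => // z /dP.
by rewrite sub0r normrN ger0_norm ?normc_ge0.
Qed.

(** Passage to the limit in estimates: the distances from partial sums to their limits are gathered
    in [u], and disappear. *)
Lemma le_add_cvg0 (u : nat -> R) (A B : R) (n : nat) :
  u @ \oo --> (0 : R) -> (forall N, (n <= N)%N -> A <= u N + B) -> A <= B.
Proof.
move=> u0 H; rewrite -[B]add0r.
have h : (fun N => u N + B) @ \oo --> 0 + B by apply: cvgD => //; exact: cvg_cst.
rewrite -(cvg_lim (@Rhausdorff R) h); apply: limr_ge.
  by apply/cvg_ex; exists (0 + B).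
by exists n => // N /= nN; exact: H.
Qed.

End ComplexBasics.

Section PowerSeries.
Variable R : realType.
Local Notation C := R[i].
Implicit Types (z w s l : C) (r M x : R) (a b : nat -> C) (f g : C -> C).

Variant psum a w l : Prop :=
  Psum of series (fun n => a n * w ^+ n) @ \oo --> l.

(** A Cauchy estimate: the quantitative form of a radius of convergence at least [r], propagated
    through every operation on series below. *)
Definition pbnd a r M : Prop := forall n, normc (a n) * r ^+ n <= M.

Lemma psumP a w l : psum a w l <->
  (fun n => normc (\sum_(k < n) a k * w ^+ k - l)) @ \oo --> (0 : R).
Proof.
have -> : psum a w l <-> series (fun n => a n * w ^+ n) @ \oo --> l.
  by split=> [[]|/Psum].
rewrite (cvgCP _ l).
suff -> : (fun n => normc (\sum_(k < n) a k * w ^+ k - l)) =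
  (fun n => normc (series (fun n => a n * w ^+ n) n - l)) by [].
by apply/funext => n; rewrite /series /= big_mkord.
Qed.

Lemma psum_eq a b w l : a =1 b -> psum a w l -> psum b w l.
Proof. by move=> /funext ->. Qed.

Lemma psum_unique a w l l' : psum a w l -> psum a w l' -> l = l'.
Proof.
move=> /psumP h /psumP h'; apply/eqP; rewrite -subr_eq0 -normc_eq0.
rewrite eq_le normc_ge0 andbT.
pose S n := \sum_(k < n) a k * w ^+ k.
have h2 : (fun n => normc (S n - l) + normc (S n - l')) @ \oo --> (0 : R).
  by rewrite -[0]addr0; apply: cvgD.
apply: (le_add_cvg0 (n := 0%N) h2) => N _; rewrite addr0.
apply: le_trans (normc_triB _ (S N) _) _.
by rewrite normcB.
Qed.

(** Each term is a difference of two consecutive partial sums, and a convergent sequence is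
    bounded. *)
Lemma psum_bound a w l : psum a w l ->
  exists2 M, 0 <= M & pbnd a (normc w) M.
Proof.
move=> /psumP h.
have /cvg_seq_bounded : cvgn (fun n => normc (\sum_(k < n) a k * w ^+ k - l)).
  by apply/cvg_ex; exists 0.
move=> [B [_ /(_ (`|B| + 1))]].
have -> : B < `|B| + 1 by rewrite (le_lt_trans (ler_norm _)) // ltrDl.
move=> /(_ isT) hB; exists ((`|B| + 1) + (`|B| + 1)).
  by rewrite !addr_ge0.
move=> n; rewrite -normcX -normcM.
have -> : a n * w ^+ n = (\sum_(k < n.+1) a k * w ^+ k - l) -
  (\sum_(k < n) a k * w ^+ k - l) by rewrite big_ord_recr /=; ring.
rewrite (le_trans (le_normcD _ _)) // normcN.
have h1 := hB n.+1 I; have h0 := hB n I.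
by rewrite lerD //; [move: h1 | move: h0]; rewrite /= ger0_norm ?normc_ge0.
Qed.

Lemma pbnd_le a r r' M : 0 <= r' <= r -> pbnd a r M -> pbnd a r' M.
Proof.
move=> /andP[r0 rr] h n; apply: le_trans (h n).
by rewrite ler_wpM2l ?normc_ge0 // lerXn2r // nnegrE (le_trans r0).
Qed.

Lemma pbnd_ge0 a r M : 0 <= r -> pbnd a r M -> 0 <= M.
Proof. by move=> r0 /(_ 0%N); rewrite expr0 mulr1 => /(le_trans (normc_ge0 _)). Qed.

(** Halving the radius is what yields the coefficient bound: the series converges at the real point
    [r / 2], so its terms are bounded there. *)
Lemma analyticP f s : analytic_at f s <-> exists a r M,
  [/\ 0 < r, pbnd a r M & forall w, normc w < r -> psum a w (f (s + w))].
Proof.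
split=> [[a /nbhsCP[r r0 H]]|[a [r [M [r0 _ H]]]]]; last first.
  exists a; apply/nbhsCP; exists r => // z zs.
  by have [] := H _ zs; rewrite subrKC.
have H' w : normc w < r -> psum a w (f (s + w)).
  by move=> wr; constructor; have := H (s + w); rewrite [s + w]addrC addrK; exact.
have nr2 : normc (r / 2)%:C = r / 2 by rewrite normcR gtr0_norm // divr_gt0.
have [|M M0 Mb] := psum_bound (H' (r / 2)%:C _); first by rewrite nr2; lra.
exists a, (r / 2), M; split; first by rewrite divr_gt0.
  by rewrite nr2 in Mb.
by move=> w wr; apply: H'; lra.
Qed.

Lemma analytic_shrink f s (e : R) : 0 < e -> analytic_at f s -> exists a r M,
  [/\ 0 < r, r <= e, pbnd a r M & forall w, normc w < r -> psum a w (f (s + w))].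
Proof.
move=> e0 /analyticP[a [r [M [r0 Mb H]]]]; exists a, (Num.min r e), M.
have m0 : 0 < Num.min r e by rewrite lt_min r0.
split => //; first by rewrite ge_min lexx orbT.
  by apply: pbnd_le Mb; rewrite ltW // ge_min lexx.
by move=> w; rewrite lt_min => /andP[/H].
Qed.

Lemma analytic_near f s : analytic_at f s -> forall g,
  (\forall z \near s, f z = g z) -> analytic_at g s.
Proof.
move=> [a H] g fg; exists a; near=> z.
have <- : f z = g z by near: z.
by near: z.
Unshelve. all: by end_near. Qed.

Lemma sum_pow_half x n : 0 <= x <= 2^-1 -> \sum_(k < n) x ^+ k <= 2.
Proof.
move=> /andP[x0 x2]; elim: n => [|n IH]; first by rewrite big_ord0.
rewrite big_ord_recl expr0.
have -> : \sum_(i < n) x ^+ lift ord0 i = x * \sum_(i < n) x ^+ i.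
  by rewrite mulr_sumr; apply: eq_bigr => i _; rewrite -exprS.
have : x * \sum_(i < n) x ^+ i <= 2^-1 * 2.
  by rewrite ler_pM // sumr_ge0 // => i _; rewrite exprn_ge0.
lra.
Qed.

(** The tail is dominated by a geometric series of ratio [|w| / r <= 1 / 2], whence the factor 2. *)
Lemma psum_tail a w l r M n : psum a w l -> 0 < r -> pbnd a r M ->
  normc w <= r / 2 ->
  normc (l - \sum_(k < n) a k * w ^+ k) <= 2 * M * (normc w / r) ^+ n.
Proof.
move=> /psumP h r0 Mb wr.
have M0 := pbnd_ge0 (ltW r0) Mb.
set x := normc w / r.
have x0 : 0 <= x by rewrite divr_ge0 ?normc_ge0 ?ltW.
have x2 : x <= 2^-1 by rewrite ler_pdivrMr // mulrC.
apply: (le_add_cvg0 (n := n) h) => N nN.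
set S := fun m => \sum_(k < m) a k * w ^+ k.
rewrite -/(S N) -/(S n) normcB [normc (S N - l)]normcB.
apply: le_trans (normc_triB _ (S N) _) _; rewrite normcB.
rewrite [normc (S N - l)]normcB addrC lerD2l.
have -> : S N - S n = \sum_(n <= k < N) a k * w ^+ k.
  rewrite /S -!(big_mkord xpredT (fun k => a k * w ^+ k)).
  by rewrite [X in X - _](big_cat_nat (n := n)) //= addrC addrK.
apply: le_trans (normc_sum _ _ _) _.
have -> : \sum_(n <= k < N) normc (a k * w ^+ k) =
    \sum_(k < N - n) normc (a (k + n)%N * w ^+ (k + n)).
  by rewrite -{1}[n]add0n big_addn big_mkord.
have -> : 2 * M * x ^+ n = (M * x ^+ n) * 2 by ring.
have e k : normc (a (k + n)%N * w ^+ (k + n)) <= M * x ^+ n * x ^+ k.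
  rewrite normcM normcX -mulrA -exprD addnC.
  have -> : normc w = r * x by rewrite /x mulrC divfK ?gt_eqF.
  rewrite exprMn mulrA ler_wpM2r ?exprn_ge0 //; exact: Mb.
apply: (@le_trans _ _ (\sum_(k < N - n) M * x ^+ n * x ^+ k)).
  by apply: ler_sum => k _; exact: e.
rewrite -mulr_sumr ler_wpM2l ?mulr_ge0 ?exprn_ge0 // sum_pow_half //.
by rewrite x0.
Qed.

Lemma psum0 a : psum a 0 (a 0%N).
Proof.
apply/psumP; apply: cvg_near_cst; exists 1%N => // -[//|n] _.
rewrite big_ord_recl big1 ?addr0 ?expr0 ?mulr1 ?subrr ?normc0 // => i _.
by rewrite expr0n mulr0.
Qed.

Lemma analytic_continuous f s : analytic_at f s -> f z @[z --> s] --> f s.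
Proof.
move=> /analyticP[a [r [M [r0 Mb H]]]].
have fs : f s = a 0%N.
  apply/esym/(psum_unique (psum0 a)).
  by have := H 0; rewrite addr0 normc0; apply.
have M0 := pbnd_ge0 (ltW r0) Mb.
apply/cvg_nbhsCP => e e0.
exists (Num.min (r / 2) (e * r / (2 * M + 1))).
  by rewrite lt_min !divr_gt0 ?mulr_gt0 // ltr_wpDl ?mulr_ge0.
move=> z; rewrite lt_min => /andP[z1 z2].
have zr : normc (z - s) < r by lra.
have /psum_tail := H _ zr.
move=> /(_ r M 1%N r0 Mb (ltW z1)).
rewrite big_ord1 expr0 mulr1 -fs subrKC expr1 => zs; apply: le_lt_trans zs _.
rewrite mulrA ltr_pdivrMr //.
rewrite ltr_pdivlMr ?ltr_wpDl ?mulr_ge0 // in z2.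
have := normc_ge0 (z - s); lra.
Qed.

End PowerSeries.

(** * Cauchy products *)

Section PowerSeriesOps.
Variable R : realType.
Local Notation C := R[i].
Implicit Types (z w s l c d : C) (r M x q : R) (a b : nat -> C) (f g : C -> C).

(** The right side is [1 - x] times a sum of [n] powers of [x], each at least [x ^ n]. *)
Lemma mulrn_geo_le1 x n : 0 <= x <= 1 -> n%:R * x ^+ n * (1 - x) <= 1 - x ^+ n.
Proof.
move=> /andP[x0 x1]; elim: n => [|n IH]; first by rewrite !mul0r expr0 subrr.
rewrite -natr1 !exprS.
have p0 : 0 <= x ^+ n by rewrite exprn_ge0.
have p1 : x ^+ n <= 1 by rewrite exprn_ile1.
have h1 : 0 <= x * (1 - x ^+ n - n%:R * x ^+ n * (1 - x)).
  by rewrite mulr_ge0 // subr_ge0.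
have h2 : 0 <= (1 - x) * (1 - x * x ^+ n).
  by rewrite mulr_ge0 ?subr_ge0 // mulr_ile1.
rewrite -subr_ge0; apply: le_trans (addr_ge0 h1 h2) _.
by rewrite le_eqVlt; apply/orP; left; apply/eqP; ring.
Qed.

(** A factor [n] is absorbed by enlarging the ratio from [q] to the midpoint [p] of [q] and 1. *)
Lemma mulrn_geo q : 0 <= q < 1 ->
  exists K p, [/\ 0 <= K, 0 <= p < 1 & forall n, n%:R * q ^+ n <= K * p ^+ n].
Proof.
move=> /andP[q0 q1]; pose p := (1 + q) / 2.
have p0 : 0 < p by rewrite /p; lra.
have p1 : p < 1 by rewrite /p; lra.
have qp : q < p by rewrite /p; lra.
pose u := q / p.
have u0 : 0 <= u by rewrite divr_ge0 // ltW.
have u1 : u < 1 by rewrite ltr_pdivrMr // mul1r.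
exists (1 - u)^-1, p; split; first by rewrite invr_ge0; lra.
  by rewrite ltW.
move=> n; have -> : q = u * p by rewrite divfK // gt_eqF.
rewrite exprMn mulrA ler_wpM2r ?exprn_ge0 ?(ltW p0) //.
rewrite -[(1 - u)^-1]mul1r ler_pdivlMr; last by lra.
apply: le_trans (mulrn_geo_le1 _ _) _; first by rewrite u0 ltW.
by rewrite gerBl exprn_ge0.
Qed.

Lemma cvg0_geo (u : nat -> R) K q : 0 <= q < 1 ->
  (forall n, 0 <= u n <= K * q ^+ n) -> u @ \oo --> (0 : R).
Proof.
move=> /andP[q0 q1] H.
apply: (@squeeze_cvgr _ _ _ _ (fun=> 0) (fun n => K * q ^+ n)).
- by near=> n.
- exact: cvg_cst.
- rewrite -(mulr0 K); apply: cvgMr.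
  by have := @cvg_geometric R 1 q; rewrite ger0_norm // => /(_ q1);
    rewrite (_ : geometric 1 q = (fun n => q ^+ n)) //;
    apply/funext => n; rewrite /geometric /= mul1r.
Unshelve. all: by end_near. Qed.

(** Coefficients of the Cauchy product. *)
Definition pconv a b n : C := \sum_(k < n.+1) a k * b (n - k)%N.

Lemma sum_pconv (A B : nat -> C) n : \sum_(m < n) pconv A B m =
  \sum_(k < n) A k * \sum_(j < n - k) B j.
Proof.
elim: n => [|n IH]; first by rewrite !big_ord0.
rewrite big_ord_recr /= IH /pconv !big_ord_recr /= subSnn subnn big_ord1.
rewrite addrA -big_split /=; congr (_ + _); apply: eq_bigr => k _.
by rewrite -mulrDr subSn ?(ltnW (ltn_ord k)) // big_ord_recr.
Qed.

Lemma pconvX a b w n :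
  pconv a b n * w ^+ n = pconv (fun k => a k * w ^+ k) (fun k => b k * w ^+ k) n.
Proof.
rewrite /pconv mulr_suml; apply: eq_bigr => k _.
have -> : w ^+ n = w ^+ k * w ^+ (n - k).
  by rewrite -exprD subnKC // -ltnS ltn_ord.
by ring.
Qed.

Lemma pbnd_pow a r M w n : 0 < r -> pbnd a r M ->
  normc (a n * w ^+ n) <= M * (normc w / r) ^+ n.
Proof.
move=> r0 Mb; rewrite normcM normcX.
have -> : normc w = r * (normc w / r) by rewrite mulrC divfK ?gt_eqF.
rewrite exprMn mulrA ![_ * (normc w / r)]mulrC mulfK ?gt_eqF // ler_wpM2r //.
by rewrite exprn_ge0 // divr_ge0 ?normc_ge0 // ltW.
Qed.

(* The error is [\sum_k A_k (S_n - S_(n-k))], with [S] the partial sums of [B]. *)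
Lemma pconv_error a b w r M M' : 0 < r -> pbnd a r M -> pbnd b r M' ->
  normc w < r ->
  (fun n => normc (\sum_(k < n) pconv a b k * w ^+ k -
    (\sum_(k < n) a k * w ^+ k) * (\sum_(k < n) b k * w ^+ k)))
  @ \oo --> (0 : R).
Proof.
move=> r0 Ma Mb wr; pose q := normc w / r.
have q0 : 0 <= q by rewrite divr_ge0 ?normc_ge0 ?ltW.
have q1 : q < 1 by rewrite ltr_pdivrMr // mul1r.
have M0 := pbnd_ge0 (ltW r0) Ma; have M'0 := pbnd_ge0 (ltW r0) Mb.
have [|K [p [K0 p01 Kp]]] := @mulrn_geo q; first by rewrite q0.
have [|K' [p' [K'0 p'01 Kp']]] := @mulrn_geo p; first by [].
apply: (@cvg0_geo _ (M * M' * K * K') p') => // n; rewrite normc_ge0 /=.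
under eq_bigr do rewrite pconvX.
rewrite sum_pconv mulr_suml -sumrB.
apply: (@le_trans _ _ (\sum_(k < n) M * M' * n%:R * q ^+ n)); last first.
  rewrite sumr_const card_ord -[X in X <= _]mulr_natl.
  have -> : n%:R * (M * M' * n%:R * q ^+ n) = M * M' * (n%:R * (n%:R * q ^+ n))
    by ring.
  rewrite -!mulrA ler_wpM2l // ler_wpM2l //.
  apply: (@le_trans _ _ (n%:R * (K * p ^+ n))); first by rewrite ler_wpM2l.
  by rewrite mulrCA ler_wpM2l.
apply: le_trans (normc_sum _ _ _) _; apply: ler_sum => k _.
rewrite -mulrBr normcM.
have -> : \sum_(j < n - k) b j * w ^+ j - \sum_(j < n) b j * w ^+ j =
    - \sum_(n - k <= j < n) b j * w ^+ j.
  rewrite -!(big_mkord xpredT (fun j => b j * w ^+ j)).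
  rewrite [X in _ - X](big_cat_nat (n := (n - k)%N)) ?leq_subr //=.
  by rewrite opprD addrA subrr add0r.
rewrite normcN.
have -> : M * M' * n%:R * q ^+ n = M * q ^+ k * (M' * q ^+ (n - k) * n%:R).
  rewrite -[X in q ^+ X](@subnKC k n) ?(ltnW (ltn_ord k)) // exprD; ring.
apply: ler_pM; rewrite ?normc_ge0 //; first exact: pbnd_pow.
apply: le_trans (normc_sum _ _ _) _.
apply: (@le_trans _ _ (\sum_(n - k <= j < n) M' * q ^+ (n - k))).
  rewrite !big_nat; apply: ler_sum => j /andP[jk _].
  apply: le_trans (pbnd_pow _ _ r0 Mb) _; rewrite ler_wpM2l //.
  by rewrite ler_wiXn2l // ltW.
rewrite sumr_const_nat subKn ?(ltnW (ltn_ord k)) // -[X in X <= _]mulr_natr.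
by rewrite ler_wpM2l ?mulr_ge0 ?exprn_ge0 // ler_nat ltnW.
Qed.

Lemma psumM a b w l l' r M M' : 0 < r -> pbnd a r M -> pbnd b r M' ->
  normc w < r -> psum a w l -> psum b w l' -> psum (pconv a b) w (l * l').
Proof.
move=> r0 Ma Mb wr /psumP al /psumP bl; apply/psumP.
have al' : (\sum_(k < n) a k * w ^+ k) @[n --> \oo] --> l by exact/cvgCP.
have bl' : (\sum_(k < n) b k * w ^+ k) @[n --> \oo] --> l' by exact/cvgCP.
have FF := @filter_filter _ _ eventually_filter.
have /(@cvgCP _ _ _ FF) m := @cvgcM _ _ _ FF _ _ _ _ al' bl'.
pose S a n := \sum_(k < n) a k * w ^+ k.
have h : (fun n => normc (S (pconv a b) n - S a n * S b n) +
    normc (S a n * S b n - l * l')) @ \oo --> (0 : R).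
  by rewrite -[0]addr0; apply: cvgD => //; exact: pconv_error Ma Mb wr.
apply: (@squeeze_cvgr _ _ _ R (fun=> 0) _ _ _ 0 _ h); last exact: cvg_cst.
by near=> n; rewrite normc_ge0 /=; exact: normc_triB.
Unshelve. all: by end_near. Qed.

End PowerSeriesOps.

(** * Sums, products and reciprocals of analytic functions *)

Section AnalyticOps.
Variable R : realType.
Local Notation C := R[i].
Implicit Types (z w s l c d : C) (r M x q : R) (a b : nat -> C) (f g : C -> C).

Lemma psum_finite a w N : (forall n, (N <= n)%N -> a n = 0) ->
  psum a w (\sum_(k < N) a k * w ^+ k).
Proof.
move=> a0; apply/psumP; apply: cvg_near_cst; exists N => // n /= Nn.
rewrite -!(big_mkord xpredT (fun k => a k * w ^+ k)).
rewrite [X in X - _](big_cat_nat (n := N)) //= [X in _ + X - _]big1_seq.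
  by rewrite addr0 subrr normc0.
by move=> i; rewrite mem_index_iota => /and3P[_ /a0 -> _]; rewrite mul0r.
Qed.

Lemma analytic_affine c d s : analytic_at (fun z => c * z + d) s.
Proof.
exists (fun n => if n is 0%N then c * s + d else if n is 1%N then c else 0).
apply/nbhsCP; exists 1 => // z _.
have [] := @psum_finite (fun n => if n is 0%N then c * s + d
  else if n is 1%N then c else 0) (z - s) 2 _; first by case=> [|[]].
by rewrite !big_ord_recl big_ord0 /= expr0 expr1 mulr1 addr0;
  rewrite (_ : c * s + d + c * (z - s) = c * z + d) //; ring.
Qed.

Lemma analytic_cst d s : analytic_at (fun=> d) s.
Proof.
by have := analytic_affine 0 d s; under eq_fun do rewrite mul0r add0r.
Qed.

Lemma analyticD f g s : analytic_at f s -> analytic_at g s ->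
  analytic_at (fun z => f z + g z) s.
Proof.
move=> [a fa] [b gb]; exists (fun n => a n + b n).
have FF := @filter_filter _ _ eventually_filter.
have := @filterI _ _ (nbhs_filter s) _ _ fa gb.
apply: (@filterS _ _ (nbhs_filter s)) => z [fz gz].
have h := @cvgcD _ _ _ FF _ _ _ _ fz gz.
suff -> : series (fun n => (a n + b n) * (z - s) ^+ n) =
  (fun n => series (fun n => a n * (z - s) ^+ n) n +
            series (fun n => b n * (z - s) ^+ n) n) by apply h.
apply/funext => n; rewrite /series /= -big_split /=.
by apply: eq_bigr => i _; rewrite mulrDl.
Qed.

Lemma analyticM f g s : analytic_at f s -> analytic_at g s ->
  analytic_at (fun z => f z * g z) s.
Proof.
move=> /analyticP[a [r [M [r0 Ma fa]]]].
move=> /(analytic_shrink r0)[b [r' [M' [r'0 rr Mb gb]]]].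
have Ma' : pbnd a r' M by apply: pbnd_le Ma; rewrite ltW.
exists (pconv a b); apply/nbhsCP; exists r' => // z zs.
have [] := psumM r'0 Ma' Mb zs (fa _ (lt_le_trans zs rr)) (gb _ zs).
by rewrite subrKC.
Qed.

Lemma analytic_comp_affine f c d s : analytic_at f (c * s + d) ->
  analytic_at (fun z => f (c * z + d)) s.
Proof.
move=> [a /nbhsCP[r r0 fa]]; exists (fun n => a n * c ^+ n); apply/nbhsCP.
have c1 : 0 < normc c + 1 by rewrite ltr_wpDl ?normc_ge0.
exists (r / (normc c + 1)); first by rewrite divr_gt0.
move=> z; rewrite ltr_pdivlMr // => zs.
have e : c * z + d - (c * s + d) = c * (z - s) by ring.
have := fa (c * z + d); rewrite e normcM.
under eq_fun do rewrite exprMn mulrA.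
apply; apply: le_lt_trans zs; rewrite mulrC ler_wpM2l ?normc_ge0 //.
by rewrite lerDl.
Qed.

(** The coefficients of the reciprocal series obey a course-of-values recursion, so the list of all
    of them up to index [n] is carried along. *)
Fixpoint pinv_seq a n : seq C :=
  if n is m.+1 then
    rcons (pinv_seq a m)
      (- (a 0%N)^-1 * \sum_(k < m.+1) a k.+1 * (pinv_seq a m)`_(m - k))
  else [:: (a 0%N)^-1].

Definition pinv a n : C := (pinv_seq a n)`_n.

Lemma size_pinv_seq a n : size (pinv_seq a n) = n.+1.
Proof. by elim: n => //= n IH; rewrite size_rcons IH. Qed.

Lemma nth_pinv_seq a n k : (k <= n)%N -> (pinv_seq a n)`_k = pinv a k.
Proof.
elim: n k => [|n IH] k; first by rewrite leqn0 => /eqP->.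
rewrite leq_eqVlt => /orP[/eqP->//|kn].
by rewrite /= nth_rcons size_pinv_seq kn IH.
Qed.

Lemma pinvS a n :
  pinv a n.+1 = - (a 0%N)^-1 * \sum_(k < n.+1) a k.+1 * pinv a (n - k).
Proof.
rewrite {1}/pinv /= nth_rcons size_pinv_seq ltnn eqxx; congr (_ * _).
by apply: eq_bigr => k _; rewrite nth_pinv_seq ?leq_subr.
Qed.

Lemma pconv_pinv a n : a 0%N != 0 -> pconv a (pinv a) n = (n == 0%N)%:R.
Proof.
move=> a0; rewrite /pconv; case: n => [|n].
  by rewrite big_ord1 /= divff.
rewrite big_ord_recl /= subn0 pinvS.
under eq_bigr do rewrite /bump /= add1n subSS.
by rewrite mulNr mulrN mulVKf // addNr.
Qed.

(** On the radius [r x], the recursion and the induction hypothesis bound the sum defining the next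
    coefficient by [M x (1 + x + ...) / |a 0|]. This is at most 1 because [x <= 1 / 2] and
    [2 M x <= |a 0|], the two conditions built into the choice of [x]. *)
Lemma pbnd_pinv a r M : 0 < r -> a 0%N != 0 -> pbnd a r M ->
  exists r', [/\ 0 < r', r' <= r & pbnd (pinv a) r' (normc (a 0%N))^-1].
Proof.
move=> r0 a0 Ma; have M0 := pbnd_ge0 (ltW r0) Ma.
set A := normc (a 0%N); have A0 : 0 < A by rewrite normc_gt0.
pose x := Num.min 2^-1 (A / (2 * M + 1)).
have M21 : 0 < 2 * M + 1 by rewrite ltr_wpDl // mulr_ge0.
have x0 : 0 < x by rewrite lt_min invr_gt0 ltr0n divr_gt0.
have x2 : x <= 2^-1 by rewrite ge_min lexx.
have xA : x * (2 * M) <= A.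
  have : x <= A / (2 * M + 1) by rewrite ge_min lexx orbT.
  by rewrite ler_pdivlMr // => h; lra.
have rx : r * x <= r by rewrite ger_pMr //; lra.
exists (r * x); split=> //; first by rewrite mulr_gt0.
elim/ltn_ind => -[_|n IH]; first by rewrite expr0 mulr1 /pinv /= normcV.
rewrite pinvS normcM normcN normcV -/A -mulrA.
rewrite ler_piMr ?invr_ge0 ?(ltW A0) //.
apply: (@le_trans _ _ (\sum_(k < n.+1) A^-1 * M * x * x ^+ k)).
  have p0 : 0 <= (r * x) ^+ n.+1 by rewrite exprn_ge0 // ltW // mulr_gt0.
  apply: le_trans (ler_wpM2r p0 (normc_sum _ _ _)) _.
  rewrite mulr_suml; apply: ler_sum => k _; rewrite normcM.
  have kn : (k <= n)%N by rewrite -ltnS.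
  have -> : (r * x) ^+ n.+1 = (r ^+ k.+1 * x ^+ k.+1) * (r * x) ^+ (n - k).
    by rewrite -exprMn -exprD; congr (_ ^+ _); rewrite addSn subnKC.
  have h1 := Ma k.+1.
  have h2 := IH (n - k)%N; rewrite ltnS leq_subr in h2; have {}h2 := h2 isT.
  have -> : A^-1 * M * x * x ^+ k = (M * x ^+ k.+1) * A^-1 by rewrite exprS; ring.
  rewrite [leLHS](_ : _ = (normc (a k.+1) * r ^+ k.+1 * x ^+ k.+1) *
    (normc (pinv a (n - k)) * (r * x) ^+ (n - k))); last by ring.
  have xk : 0 <= x ^+ k.+1 by rewrite exprn_ge0 // ltW.
  apply: ler_pM => //.
  - by rewrite !mulr_ge0 ?normc_ge0 ?exprn_ge0 ?(ltW r0) ?(ltW x0).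
  - by rewrite mulr_ge0 ?normc_ge0 ?exprn_ge0 ?mulr_ge0 ?(ltW r0) ?(ltW x0).
  - by rewrite ler_wpM2r.
rewrite -mulr_sumr.
apply: (@le_trans _ _ (A^-1 * M * x * 2)).
  rewrite ler_wpM2l ?mulr_ge0 ?invr_ge0 ?(ltW A0) ?(ltW x0) //.
  by rewrite sum_pow_half // (ltW x0).
rewrite (_ : _ * 2 = x * (2 * M) / A); last by ring.
by rewrite ler_pdivrMr // mul1r.
Qed.

Lemma analyticV f s : analytic_at f s -> f s != 0 ->
  analytic_at (fun z => (f z)^-1) s.
Proof.
move=> fan fs0; have := fan => /analyticP[a [r [M [r0 Ma fa]]]].
have a0 : a 0%N != 0.
  have := fa 0; rewrite addr0 normc0 => /(_ r0) h.
  by rewrite (psum_unique (psum0 a) h).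
have [r' [r'0 rr' Mb]] := pbnd_pinv r0 a0 Ma.
have Ma' : pbnd a r' M by apply: pbnd_le Ma; rewrite ltW.
have /cvg_nbhsCP/(_ (normc (f s))) := analytic_continuous fan.
rewrite normc_gt0 => /(_ fs0)[e e0 fe].
exists (pinv a); apply/nbhsCP; exists (Num.min r' e); first by rewrite lt_min r'0.
move=> z; rewrite lt_min => /andP[zr ze].
have fz0 : f z != 0.
  by apply: contraTneq (fe z ze) => ->; rewrite sub0r normcN ltxx.
pose S b n := \sum_(k < n) b k * (z - s) ^+ k.
have /psumP fz := fa _ (lt_le_trans zr rr'); rewrite subrKC in fz.
have FF := @filter_filter _ _ eventually_filter.
have {}fz : S a n @[n --> \oo] --> f z by exact/cvgCP.
(* Up to a vanishing error, the product of the partial sums is the partial sum of the product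
   series, which is the constant 1. Dividing by [S a n], which tends to [f z != 0], sums the
   reciprocal series. *)
have h1 : S a n * S (pinv a) n @[n --> \oo] --> (1 : C).
  apply/cvgCP; have h := pconv_error r'0 Ma' Mb zr.
  apply: cvg_trans h; apply: near_eq_cvg; exists 1%N => // -[//|n] _ /=.
  rewrite normcB; congr (normc (_ - _)).
  rewrite big_ord_recl pconv_pinv // expr0 mulr1 big1 ?addr0 // => i _.
  by rewrite pconv_pinv // mul0r.
have h2 := @cvgcV _ _ _ FF _ _ fz0 fz.
have h3 := @cvgcM _ _ _ FF _ _ _ _ h2 h1; rewrite mulr1 in h3.
apply: cvg_trans h3; apply: near_eq_cvg.
have : \forall n \near \oo, normc (S a n - f z) < normc (f z).
  move/cvgCP: fz => /cvgrPdist_lt/(_ (normc (f z))).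
  rewrite normc_gt0 => /(_ fz0); apply: filterS => n.
  by rewrite sub0r normrN ger0_norm ?normc_ge0.
apply: filterS => n hn; rewrite /series /= big_mkord mulKf //.
by apply: contraTneq hn => ->; rewrite sub0r normcN ltxx.
Qed.

End AnalyticOps.

(** * The exponential series *)

Section ComplexExp.
Variable R : realType.
Local Notation C := R[i].
Local Notation Re := complex.Re.
Local Notation Im := complex.Im.
Implicit Types (z w s l c d : C) (r M x y q : R) (a b : nat -> C) (f g : C -> C).

Lemma Re_sum (I : Type) (s : seq I) (P : pred I) (F : I -> C) :
  Re (\sum_(i <- s | P i) F i) = \sum_(i <- s | P i) Re (F i).
Proof. by elim/big_rec2: _ => // i x y _ <-; rewrite ReD. Qed.

Lemma Im_sum (I : Type) (s : seq I) (P : pred I) (F : I -> C) :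
  Im (\sum_(i <- s | P i) F i) = \sum_(i <- s | P i) Im (F i).
Proof. by elim/big_rec2: _ => // i x y _ <-; rewrite ImD. Qed.

Lemma cvgC_ReIm (u : nat -> C) l : Re (u n) @[n --> \oo] --> Re l ->
  Im (u n) @[n --> \oo] --> Im l -> u n @[n --> \oo] --> l.
Proof.
move=> /cvgrPdist_lt rl /cvgrPdist_lt il; apply/cvgCP/cvgrPdist_lt => e e0.
have e2 : 0 < e / 2 by rewrite divr_gt0.
near=> n; rewrite sub0r normrN ger0_norm ?normc_ge0 //.
apply: le_lt_trans (normc_le_ReIm _) _.
rewrite ReD ImD ReN ImN [ltRHS](splitr e) ltrD // distrC; near: n.
  exact: rl.
exact: il.
Unshelve. all: by end_near. Qed.

Lemma psum_ReIm a w l : series (fun n => Re (a n * w ^+ n)) @ \oo --> Re l ->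
  series (fun n => Im (a n * w ^+ n)) @ \oo --> Im l -> psum a w l.
Proof.
move=> hr hi; constructor; apply: cvgC_ReIm.
- have -> : (fun n => Re (series (fun n => a n * w ^+ n) n)) =
    series (fun n => Re (a n * w ^+ n)).
    by apply/funext => n; rewrite /series /= Re_sum.
  exact: hr.
- have -> : (fun n => Im (series (fun n => a n * w ^+ n) n)) =
    series (fun n => Im (a n * w ^+ n)).
    by apply/funext => n; rewrite /series /= Im_sum.
  exact: hi.
Qed.

Lemma cvg_series_geo (u : nat -> R) M q : 0 <= q < 1 ->
  (forall n, `|u n| <= M * q ^+ n) -> cvgn (series u).
Proof.
move=> /andP[q0 q1] H; apply: (@normed_cvg _ R).
have M0 : 0 <= M by have := H 0%N; rewrite expr0 mulr1; apply: le_trans.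
apply: (@series_le_cvg _ _ (geometric M q)) => [n|n|n|].
- exact: normr_ge0.
- by rewrite /geometric /= mulr_ge0 // exprn_ge0.
- exact: H.
by apply: is_cvg_geometric_series; rewrite ger0_norm.
Qed.

Lemma psum_exists a w r M : 0 < r -> pbnd a r M -> normc w < r ->
  exists l, psum a w l.
Proof.
move=> r0 Ma wr.
have q0 : 0 <= normc w / r < 1.
  by rewrite divr_ge0 ?normc_ge0 ?(ltW r0) //= ltr_pdivrMr // mul1r.
have hr : cvgn (series (fun n => Re (a n * w ^+ n))).
  apply: (cvg_series_geo (M := M) q0) => n.
  by apply: le_trans (ler_Re _) _; exact: pbnd_pow.
have hi : cvgn (series (fun n => Im (a n * w ^+ n))).
  apply: (cvg_series_geo (M := M) q0) => n.
  by apply: le_trans (ler_Im _) _; exact: pbnd_pow.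
move/cvg_ex: hr => [x hx]; move/cvg_ex: hi => [y hy].
by exists (x +i* y); apply: psum_ReIm.
Qed.

Definition cexp_coeff n : C := (n`!%:R)^-1.

Lemma Re_real_mul x z : Re (x%:C * z) = x * Re z.
Proof. by case: z => a b /=; rewrite mul0r subr0. Qed.

Lemma Im_real_mul x z : Im (x%:C * z) = x * Im z.
Proof. by case: z => a b /=; rewrite mul0r addr0. Qed.

Lemma natC n : n%:R = (n%:R : R)%:C :> C.
Proof. by rewrite rmorph_nat. Qed.

Lemma realCX x n : (x ^+ n)%:C = x%:C ^+ n :> C.
Proof. exact: rmorphXn. Qed.

Lemma realCM x y : (x * y)%:C = x%:C * y%:C :> C.
Proof. exact: rmorphM. Qed.

Lemma realCV x : (x^-1)%:C = (x%:C)^-1 :> C.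
Proof. exact: fmorphV. Qed.

Lemma cexp_coeffE n : cexp_coeff n = (n`!%:R^-1 : R)%:C.
Proof. by rewrite /cexp_coeff natC realCV. Qed.

Lemma psum_expR x : psum cexp_coeff x%:C (expR x)%:C.
Proof.
have e n : cexp_coeff n * x%:C ^+ n = (exp_coeff x n)%:C.
  by rewrite cexp_coeffE -realCX -realCM mulrC.
apply: psum_ReIm.
  under eq_fun do rewrite e /=; exact: is_cvg_series_exp_coeff.
under eq_fun do rewrite e /=.
by rewrite (_ : series _ = fun=> 0); [exact: cvg_cst|];
  apply/funext => n; rewrite /series /= big1.
Qed.

Lemma iX_even n : ('i : C) ^+ n.*2 = ((-1) ^+ n)%:C.
Proof.
by rewrite -mul2n exprM sqr_i realCX; congr (_ ^+ _); rewrite rmorphN1.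
Qed.

Lemma psum_cis y : psum cexp_coeff ('i * y%:C) (cos y +i* sin y).
Proof.
have e n : cexp_coeff n * ('i * y%:C) ^+ n = cos_coeff y n +i* sin_coeff y n.
  rewrite exprMn -realCX cexp_coeffE.
  rewrite /cos_coeff /sin_coeff /= -exprnP.
  have [on|en] := boolP (odd n).
    have -> : ('i : C) ^+ n = 'i * ((-1) ^+ n./2)%:C.
      by rewrite -[in LHS](odd_double_half n) on add1n exprS iX_even.
    have -> : n.-1./2 = n./2.
      by rewrite -[in LHS](odd_double_half n) on add1n /= doubleK.
    by simpc; congr (_ +i* _); ring.
  have -> : ('i : C) ^+ n = ((-1) ^+ n./2)%:C.
    by rewrite -[in LHS](odd_double_half n) (negbTE en) add0n iX_even.
  by simpc; congr (_ +i* _); ring.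
apply: psum_ReIm.
  under eq_fun do rewrite e /=.
  by rewrite cos.unlock; exact: is_cvg_series_cos_coeff.
under eq_fun do rewrite e /=.
by rewrite sin.unlock; exact: is_cvg_series_sin_coeff.
Qed.

Lemma cexp_coeff_pbnd r : 0 <= r -> exists M, pbnd cexp_coeff r M.
Proof.
move=> r0; have [M _] := psum_bound (psum_expR r).
by rewrite normcR ger0_norm //; exists M.
Qed.

Lemma psum_scale a c w l : psum (fun n => a n * c ^+ n) w l <-> psum a (c * w) l.
Proof.
have e : series (fun n => a n * c ^+ n * w ^+ n) =
    series (fun n => a n * (c * w) ^+ n).
  by congr series; apply/funext => n; rewrite exprMn mulrA.
by split=> -[]; [rewrite e|rewrite -e] => h; constructor.
Qed.

Lemma pbnd_scale a c r M : pbnd a (normc c * r) M ->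
  pbnd (fun n => a n * c ^+ n) r M.
Proof. by move=> h n; rewrite normcM normcX -mulrA -exprMn; exact: h. Qed.

Lemma pconv_exp z w n :
  pconv (fun n => cexp_coeff n * z ^+ n) (fun n => cexp_coeff n * w ^+ n) n =
  cexp_coeff n * (z + w) ^+ n.
Proof.
rewrite /pconv addrC exprDn mulr_sumr; apply: eq_bigr => k _.
have kn : (k <= n)%N by rewrite -ltnS.
have f0 m : (m`!%:R : C) != 0 by rewrite pnatr_eq0 -lt0n fact_gt0.
rewrite /cexp_coeff -[in RHS]mulr_natr -(bin_fact kn) !natrM !invfM.
have b0 : ('C(n, k)%:R : C) != 0 by rewrite pnatr_eq0 -lt0n bin_gt0.
by field; rewrite ?b0 ?f0.
Qed.

(** [cexp] is a product by definition, so its series is the Cauchy product of those at [x] and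
    [i y]. The arguments are moved into the coefficients and both series evaluated at 1; the bounds
    on radius 2 make 1 an interior point. *)
Lemma psum_cexp z : psum cexp_coeff z (cexp z).
Proof.
case: z => x y.
have [M Mb] := @cexp_coeff_pbnd ((normc x%:C + normc ('i * y%:C)) * 2)
  ltac:(by rewrite mulr_ge0 // addr_ge0 ?normc_ge0).
have h1 : pbnd (fun n => cexp_coeff n * x%:C ^+ n) 2 M.
  apply: pbnd_scale; apply: pbnd_le Mb.
  apply/andP; split; first by rewrite mulr_ge0 ?normc_ge0.
  by rewrite ler_wpM2r // lerDl normc_ge0.
have h2 : pbnd (fun n => cexp_coeff n * ('i * y%:C) ^+ n) 2 M.
  apply: pbnd_scale; apply: pbnd_le Mb.
  apply/andP; split; first by rewrite mulr_ge0 ?normc_ge0.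
  by rewrite ler_wpM2r // lerDr normc_ge0.
have p1 : psum (fun n => cexp_coeff n * x%:C ^+ n) 1 (expR x)%:C.
  by apply/psum_scale; rewrite mulr1; exact: psum_expR.
have p2 : psum (fun n => cexp_coeff n * ('i * y%:C) ^+ n) 1 (cos y +i* sin y).
  by apply/psum_scale; rewrite mulr1; exact: psum_cis.
have n1 : normc (1 : C) < 2 by rewrite normc1 ltr1n.
have := psumM (ltr0Sn R 1) h1 h2 n1 p1 p2.
move=> /(psum_eq (pconv_exp _ _))/psum_scale; rewrite mulr1 /cexp.
by rewrite (_ : x%:C + 'i * y%:C = x +i* y) //; simpc.
Qed.

End ComplexExp.

(** * The identity theorem and complex derivatives *)

Section Identity.
Variable R : realType.
Local Notation C := R[i].
Implicit Types (z w s l c d : C) (r M x y q : R) (a b : nat -> C) (f g : C -> C).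

(** If [a n] is the first nonzero coefficient, then at a zero [w] of [F] the term [a n * w ^ n] is
    bounded by a tail of order [|w| ^ (n + 1)], which is impossible for small [w]; [e] is the
    threshold. *)
Lemma pcoeff_zero a r M (F : C -> C) : 0 < r -> pbnd a r M ->
  (forall w, normc w < r -> psum a w (F w)) ->
  (forall e, 0 < e -> exists w, [/\ w != 0, normc w < e & F w = 0]) ->
  forall n, a n = 0.
Proof.
move=> r0 Ma aF H; elim/ltn_ind => n IH.
have M0 := pbnd_ge0 (ltW r0) Ma.
apply/eqP; apply: contraT => an; rewrite -normc_gt0 in an.
have rn : 0 < r ^+ n.+1 by rewrite exprn_gt0.
have M1 : 0 < 2 * M + 1 by rewrite ltr_wpDl // mulr_ge0.
pose e := Num.min (r / 2) (normc (a n) * r ^+ n.+1 / (2 * M + 1)).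
have [|w [w0 we Fw]] := H e; first by rewrite lt_min !divr_gt0 ?mulr_gt0.
move: we; rewrite lt_min => /andP[we1 we2].
rewrite -normc_gt0 in w0.
have wr : normc w < r by lra.
have := psum_tail n.+1 (aF _ wr) r0 Ma (ltW we1).
rewrite Fw big_ord_recr /= big1 => [|i _]; last by rewrite IH ?mul0r.
rewrite !add0r normcN normcM normcX expr_div_n [normc w ^+ n.+1]exprS.
rewrite (_ : 2 * M * _ = (2 * M * normc w / r ^+ n.+1) * normc w ^+ n); last first.
  by ring.
rewrite ler_pM2r ?exprn_gt0 // ler_pdivlMr // leNgt => /negP[].
move: we2; rewrite ltr_pdivlMr // => h.
by apply: le_lt_trans h; nra.
Qed.

Lemma analytic_eq_near f g s : analytic_at f s -> analytic_at g s ->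
  (forall e : R, 0 < e -> exists z, [/\ z != s, normc (z - s) < e & f z = g z]) ->
  \forall z \near s, f z = g z.
Proof.
move=> fs gs H.
have := analyticD fs (analyticM (analytic_cst (-1) s) gs).
move=> /analyticP[a [r [M [r0 Ma aF]]]].
have a0 : forall n, a n = 0.
  apply: (pcoeff_zero r0 Ma aF) => e /H[z [zs ze fg]].
  exists (z - s); split=> //; first by rewrite subr_eq0.
  by rewrite subrKC fg mulN1r subrr.
apply/nbhsCP; exists r => // z /aF; rewrite subrKC => h.
apply/eqP; rewrite -subr_eq0 -mulN1r; apply/eqP.
apply: (psum_unique h).
have := @psum_finite _ a (z - s) 0; rewrite big_ord0; apply => n _.
exact: a0.
Qed.

Lemma near_near s (P : set C) : (\forall z \near s, P z) ->
  exists2 d : R, 0 < d & forall z, normc (z - s) < d -> \forall u \near z, P u.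
Proof.
move=> /nbhsCP[d d0 dP]; exists d => // z zs; apply/nbhsCP.
exists (d - normc (z - s)); first by rewrite subr_gt0.
move=> u uz; apply: dP; apply: le_lt_trans (normc_triB u z s) _.
by rewrite -ltrBrDr.
Qed.

(** [E] collects the parameters up to which [f] and [g] agree around every earlier point. Points of
    agreement accumulate at its supremum [c], so the functions agree near [p c]; this neighbourhood
    contains points further along the segment, unless [c = 1]. *)
Lemma analytic_eq_segment f g s l :
  (forall t : R, 0 <= t <= 1 -> analytic_at f (s + t%:C * (l - s)) /\
                                analytic_at g (s + t%:C * (l - s))) ->
  (\forall z \near s, f z = g z) -> \forall z \near l, f z = g z.
Proof.
move=> H fgs; have [<-//|sl] := eqVneq s l.
have ls0 : 0 < normc (l - s) by rewrite normc_gt0 subr_eq0 eq_sym.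
pose p t : C := s + t%:C * (l - s).
have pB t u : normc (p t - p u) = `|t - u| * normc (l - s).
  by rewrite -normcR -normcM /p; congr normc; rewrite rmorphB /=; ring.
pose E := [set t : R | 0 <= t <= 1 /\
  forall u, 0 <= u <= t -> \forall z \near p u, f z = g z].
have p0 : p 0 = s by rewrite /p rmorph0 mul0r addr0.
have p1 : p 1 = l by rewrite /p rmorph1 mul1r subrKC.
have E0 : E 0.
  split=> [|u]; first by rewrite lexx ler01.
  by rewrite -eq_le => /eqP<-; rewrite p0.
have Eub : ubound E 1 by move=> t [/andP[]].
have supE : has_sup E by split; [exists 0|exists 1].
pose c := sup E.
have c0 : 0 <= c by apply: sup_upper_bound.
have c1 : c <= 1 by apply: ge_sup => //; exists 0.
have below u : 0 <= u < c -> \forall z \near p u, f z = g z.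
  move=> /andP[u0 uc]; have [|t [_ Et] ut] := @sup_adherent _ E (c - u) _ supE.
    by rewrite subr_gt0.
  by apply: Et; rewrite u0 /=; move: ut; rewrite -/c opprB addrC subrK => /ltW.
have [fc gc] := H c ltac:(by rewrite c0).
rewrite -/(p c) in fc gc.
have near_c : \forall z \near p c, f z = g z.
  have [c00|cn0] := eqVneq c 0; first by rewrite c00 p0.
  have cp : 0 < c by rewrite lt_def cn0.
  apply: analytic_eq_near => // e e0.
  pose d := Num.min (c / 2) (e / normc (l - s) / 2).
  have d0 : 0 < d by rewrite lt_min !divr_gt0.
  have dc : d <= c / 2 by rewrite ge_min lexx.
  have de : d < e / normc (l - s).
    apply: (@le_lt_trans _ _ (e / normc (l - s) / 2)).
      by rewrite ge_min lexx orbT.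
    by rewrite ltr_pdivrMr // ltr_pMr ?divr_gt0 // ltr1n.
  have pd : normc (p (c - d) - p c) = d * normc (l - s).
    by rewrite pB addrAC subrr sub0r normrN gtr0_norm.
  exists (p (c - d)); split.
  - rewrite -subr_eq0 -normc_eq0 pd gt_eqF // mulr_gt0 //.
  - by rewrite pd -ltr_pdivlMr.
  - have /nbhsCP[r r0] : \forall z \near p (c - d), f z = g z.
      by apply: below; apply/andP; split; lra.
    by apply; rewrite subrr normc0.
have [d d0 dP] := near_near near_c.
have Ect t : 0 <= t <= 1 -> t - c < d / normc (l - s) -> E t.
  move=> /andP[t0 t1] tc; split; first by rewrite t0.
  move=> u /andP[u0 ut]; have [uc|cu] := ltP u c.
    by apply: below; rewrite u0.
  apply: dP; rewrite pB -ltr_pdivlMr // ger0_norm ?subr_ge0 //.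
  by apply: le_lt_trans tc; rewrite lerB.
have dl : 0 < d / normc (l - s) by rewrite divr_gt0.
have [c11|cn1] := eqVneq c 1; first by rewrite -p1 -c11.
have clt : c < 1 by rewrite lt_def eq_sym cn1.
pose t := Num.min 1 (c + d / normc (l - s) / 2).
have : E t.
  apply: Ect.
    by rewrite le_min ler01 addr_ge0 //= ?ge_min ?lexx // ltW // divr_gt0.
  rewrite ltrBlDl; apply: (@le_lt_trans _ _ (c + d / normc (l - s) / 2)).
    by rewrite ge_min lexx orbT.
  by rewrite ltrD2l ltr_pdivrMr // ltr_pMr // ltr1n.
move=> /(sup_upper_bound supE); rewrite -/c leNgt => /negP[].
by rewrite lt_min clt ltrDl divr_gt0.
Qed.

End Identity.

(** * Complex derivatives and termwise differentiation *)

Section Derivative.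
Variable R : realType.
Local Notation C := R[i].
Implicit Types (z w s l c d h : C) (r M x y q : R) (a b : nat -> C) (f g : C -> C).

(** Differentiability with a quadratic remainder. Power series satisfy it, it composes by explicit
    estimates, and it determines the library derivative. *)
Definition cdiff f z d := exists K e : R, [/\ 0 <= K, 0 < e &
  forall h, normc h < e -> normc (f (z + h) - f z - d * h) <= K * normc h ^+ 2].

Lemma cdiff_derive1 f z d : cdiff f z d -> f^`()%classic z = d.
Proof.
move=> [K [e [K0 e0 H]]]; rewrite /derive1.
apply: cvg_lim; first exact: norm_hausdorff.
apply/cvgCP/cvgrPdist_lt => x x0.
apply/(@nbhsCP R 0).
exists (Num.min e (x / (K + 1))).
  by rewrite lt_min e0 divr_gt0 // ltr_wpDl.
move=> h; rewrite subr0 lt_min => /andP[he hx] h0.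
rewrite sub0r normrN ger0_norm ?normc_ge0 //.
have hn : 0 < normc h by rewrite normc_gt0.
have -> : h^-1 *: (f (h + z) - f z) - d = h^-1 * (f (z + h) - f z - d * h).
  rewrite [h^-1 *: _]/(h^-1 * _) mulrBr [h^-1 * (d * h)]mulrCA mulVf // mulr1.
  by rewrite addrC [h + z]addrC addrC.
rewrite normcM normcV; apply: (@le_lt_trans _ _ (K * normc h)).
  rewrite mulrC ler_pdivrMr // -mulrA -expr2; exact: H.
rewrite ltr_pdivlMr ?ltr_wpDl // in hx.
by nra.
Qed.

Lemma cdiff_comp f g z d d' : cdiff f z d -> cdiff g (f z) d' ->
  cdiff (fun u => g (f u)) z (d' * d).
Proof.
move=> [K [e [K0 e0 H]]] [K' [e' [K'0 e'0 H']]].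
pose L := normc d + K.
have L0 : 0 <= L by rewrite addr_ge0 ?normc_ge0.
have L1 : 0 < L + 1 by rewrite ltr_wpDl.
exists (normc d' * K + K' * L ^+ 2), (Num.min (Num.min e 1) (e' / (L + 1))); split.
- by rewrite addr_ge0 // mulr_ge0 ?normc_ge0 ?exprn_ge0.
- by rewrite !lt_min e0 ltr01 divr_gt0.
move=> h; rewrite !lt_min => /andP[/andP[he h1] he'].
pose k := f (z + h) - f z.
have hk := H _ he; rewrite -/k in hk.
have n0 := normc_ge0 h.
have kL : normc k <= L * normc h.
  have -> : k = (k - d * h) + d * h by rewrite subrK.
  apply: le_trans (le_normcD _ _) _; rewrite normcM.
  have : K * normc h ^+ 2 <= K * normc h.
    by rewrite ler_wpM2l // expr2 ler_piMl // ltW.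
  by rewrite /L; lra.
have ke' : normc k < e'.
  rewrite ltr_pdivlMr // in he'; apply: le_lt_trans kL _; apply: le_lt_trans he'.
  by rewrite mulrC ler_wpM2l // lerDl.
have h2 := H' _ ke'; rewrite /k subrKC -/k in h2.
have -> : g (f (z + h)) - g (f z) - d' * d * h =
  (g (f (z + h)) - g (f z) - d' * k) + d' * (k - d * h) by ring.
apply: le_trans (le_normcD _ _) _; rewrite normcM.
rewrite mulrDl addrC lerD //.
  by rewrite -mulrA ler_wpM2l // normc_ge0.
apply: le_trans h2 _; rewrite -mulrA ler_wpM2l // -exprMn.
by rewrite lerXn2r // nnegrE ?normc_ge0 // mulr_ge0.
Qed.

(** The remainder is at most [n^2 r^(n-2) |h|^2]; multiplying by [r ^ 2] avoids the exponent [n - 2]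
    for [n < 2]. *)
Lemma powD_remainder w h r n : 0 < r -> normc w <= r -> normc (w + h) <= r ->
  normc ((w + h) ^+ n - w ^+ n - n%:R * w ^+ n.-1 * h) * r ^+ 2 <=
  n%:R ^+ 2 * r ^+ n * normc h ^+ 2.
Proof.
move=> r0 wr whr; elim: n => [|n IH].
  by rewrite !expr0 subrr !mulr0n !mul0r subrr normc0 expr0n /= !mul0r.
set D := (w + h) ^+ n - w ^+ n - n%:R * w ^+ n.-1 * h in IH.
have -> : (w + h) ^+ n.+1 - w ^+ n.+1 - n.+1%:R * w ^+ n.+1.-1 * h =
    (w + h) * D + n%:R * w ^+ n.-1 * h ^+ 2.
  rewrite /D /= -natr1 !exprS; case: n {IH D} => [|n]; first by rewrite !expr0; ring.
  by rewrite /= !exprS; ring.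
have hn := normc_ge0 h.
have rn : 0 <= r ^+ n by rewrite exprn_ge0 // ltW.
have i1 : normc ((w + h) * D) * r ^+ 2 <= r * (n%:R ^+ 2 * r ^+ n * normc h ^+ 2).
  by rewrite normcM -mulrA ler_pM ?normc_ge0 // mulr_ge0 ?normc_ge0 ?exprn_ge0 ?ltW.
have i2 : normc (n%:R * w ^+ n.-1 * h ^+ 2) * r ^+ 2 <=
    n%:R * (r * r ^+ n) * normc h ^+ 2.
  rewrite !normcM !normcX natC normcR ger0_norm //.
  rewrite [leLHS](_ : _ = n%:R * (normc w ^+ n.-1 * r ^+ 2) * normc h ^+ 2);
    last by ring.
  rewrite ler_wpM2r ?exprn_ge0 //; case: n {IH D rn i1} => [|n].
    by rewrite !mulr0n !mul0r.
  rewrite ler_wpM2l //= [leRHS](_ : _ = r ^+ n * r ^+ 2); last by rewrite !exprS; ring.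
  by rewrite ler_wpM2r ?exprn_ge0 ?(ltW r0) // lerXn2r ?nnegrE ?normc_ge0 ?(ltW r0).
apply: le_trans (ler_wpM2r _ (le_normcD _ _)) _; first by rewrite exprn_ge0 // ltW.
rewrite mulrDl; apply: le_trans (lerD i1 i2) _.
have h2 : 0 <= normc h ^+ 2 by rewrite exprn_ge0.
have n1 : 0 <= n%:R :> R by [].
rewrite -natr1 [r ^+ n.+1]exprS.
have -> : r * (n%:R ^+ 2 * r ^+ n * normc h ^+ 2) + n%:R * (r * r ^+ n) * normc h ^+ 2
  = (n%:R ^+ 2 + n%:R) * (r * r ^+ n * normc h ^+ 2) by ring.
rewrite -[leRHS]mulrA ler_wpM2r //; first by rewrite !mulr_ge0 // ltW.
by rewrite sqrrD; lra.
Qed.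

Definition pderiv a n : C := n.+1%:R * a n.+1.

Lemma psum_pderiv a w l : psum (pderiv a) w l ->
  (fun n => normc (\sum_(k < n) a k * (k%:R * w ^+ k.-1) - l)) @ \oo --> (0 : R).
Proof.
move=> /psumP h; rewrite -(cvg_shiftS _).
suff -> : [sequence normc (\sum_(k < n.+1) a k * (k%:R * w ^+ k.-1) - l)]_n =
  (fun n => normc (\sum_(k < n) pderiv a k * w ^+ k - l)) by [].
apply/funext => n /=; congr (normc (_ - _)); rewrite big_ord_recl mul0r mulr0 add0r.
by apply: eq_bigr => i _; rewrite /pderiv mulrA [a _ * _]mulrC.
Qed.

(** At a radius [p] strictly between [|w|] and [r], the remainders of the monomials are bounded by
    multiples of [k^2 (p / r)^k |h|^2], which can be summed. The estimate is proved for partial sums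
    and passes to the limit. *)
Lemma psum_cdiff a r M (F : C -> C) w : 0 < r -> pbnd a r M ->
  (forall u, normc u < r -> psum a u (F u)) -> normc w < r ->
  exists2 l, psum (pderiv a) w l & cdiff F w l.
Proof.
move=> r0 Ma aF wr; have M0 := pbnd_ge0 (ltW r0) Ma.
pose p := (normc w + r) / 2.
have wn := normc_ge0 w.
have p0 : 0 < p by rewrite /p; lra.
have pr : p < r by rewrite /p; lra.
have wp : normc w < p by rewrite /p; lra.
have q0 : 0 <= p / r by rewrite divr_ge0 ?(ltW p0) ?(ltW r0).
have q1 : p / r < 1 by rewrite ltr_pdivrMr // mul1r.
(* Two applications turn [k^2 (p / r)^k] into a multiple of [q2 ^ k], one for each factor [k]. *)
have [|K1 [q' [K10 q'01 H1]]] := @mulrn_geo R (p / r); first by rewrite q0.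
have [|K2 [q2 [K20 /andP[q20 q21] H2]]] := @mulrn_geo R q'; first by [].
have Mp k : normc (a k) * p ^+ k <= M * (p / r) ^+ k.
  by have := pbnd_pow p%:C k r0 Ma; rewrite normcM normcX normcR gtr0_norm.
have bd : pbnd (pderiv a) p (M * K1 / p).
  move=> n; rewrite /pderiv normcM natC normcR ger0_norm // ler_pdivlMr //.
  rewrite [leLHS](_ : _ = n.+1%:R * (normc (a n.+1) * p ^+ n.+1)); last first.
    by rewrite exprSr; ring.
  apply: le_trans (ler_wpM2l (ler0n _ _) (Mp _)) _; rewrite mulrCA.
  rewrite ler_wpM2l //; apply: le_trans (H1 _) _.
  by rewrite ler_piMr // exprn_ile1 //; case/andP: q'01 => // ? /ltW.
have [l hl] := psum_exists p0 bd wp.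
exists l => //.
pose K := M * K1 * K2 / (1 - q2) / p ^+ 2.
have q2' : 0 < 1 - q2 by rewrite subr_gt0.
have K0 : 0 <= K.
  apply: divr_ge0; last by rewrite exprn_ge0 // ltW.
  by apply: divr_ge0; [rewrite !mulr_ge0|exact: ltW].
exists K, (p - normc w); split; [exact: K0|by rewrite subr_gt0|].
move=> h hh.
have whp : normc (w + h) <= p.
  by apply: le_trans (le_normcD _ _) _; lra.
have /psumP s1 := aF _ (le_lt_trans whp pr).
have /psumP s0 := aF _ wr.
have s2 := psum_pderiv hl.
pose u n : R := normc (\sum_(k < n) a k * (w + h) ^+ k - F (w + h)) +
  (normc (\sum_(k < n) a k * w ^+ k - F w) +
   normc h * normc (\sum_(k < n) a k * (k%:R * w ^+ k.-1) - l)).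
have u0 : u @ \oo --> (0 : R).
  have -> : 0 = 0 + (0 + normc h * 0) :> R by rewrite mulr0 !addr0.
  by apply: cvgD => //; apply: cvgD => //; apply: cvgMr.
apply: (le_add_cvg0 (n := 0%N) u0) => N _.
have -> : F (w + h) - F w - l * h =
  - (\sum_(k < N) a k * (w + h) ^+ k - F (w + h)) +
  ((\sum_(k < N) a k * w ^+ k - F w) +
  h * (\sum_(k < N) a k * (k%:R * w ^+ k.-1) - l)) +
  \sum_(k < N) a k * ((w + h) ^+ k - w ^+ k - k%:R * w ^+ k.-1 * h).
  have -> : \sum_(k < N) a k * ((w + h) ^+ k - w ^+ k - k%:R * w ^+ k.-1 * h) =
    \sum_(k < N) a k * (w + h) ^+ k - \sum_(k < N) a k * w ^+ k -
    h * \sum_(k < N) a k * (k%:R * w ^+ k.-1).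
    by rewrite mulr_sumr -!sumrB; apply: eq_bigr => k _; ring.
  by ring.
apply: le_trans (le_normcD _ _) _; apply: lerD.
  apply: le_trans (le_normcD _ _) _; rewrite normcN lerD2l.
  by apply: le_trans (le_normcD _ _) _; rewrite normcM.
apply: le_trans (normc_sum _ _ _) _.
apply: (@le_trans _ _ (\sum_(k < N) M * K1 * K2 / p ^+ 2 * normc h ^+ 2 * q2 ^+ k)).
  apply: ler_sum => k _; rewrite normcM.
  have hp2 : 0 < p ^+ 2 by rewrite exprn_gt0.
  rewrite -(ler_pM2r hp2) -[leLHS]mulrA.
  have rem := @powD_remainder w h p k p0 (ltW wp) whp.
  apply: le_trans (ler_wpM2l (normc_ge0 _) rem) _.
  have -> : M * K1 * K2 / p ^+ 2 * normc h ^+ 2 * q2 ^+ k * p ^+ 2 =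
    (M * (K1 * (K2 * q2 ^+ k))) * normc h ^+ 2.
    by field; rewrite gt_eqF.
  rewrite [leLHS](_ : _ = k%:R ^+ 2 * (normc (a k) * p ^+ k) * normc h ^+ 2);
    last by ring.
  rewrite ler_wpM2r ?exprn_ge0 ?normc_ge0 //.
  apply: le_trans (ler_wpM2l _ (Mp k)) _; first by rewrite exprn_ge0.
  have -> : k%:R ^+ 2 * (M * (p / r) ^+ k) = M * (k%:R * (k%:R * (p / r) ^+ k)).
    by ring.
  rewrite ler_wpM2l //.
  apply: le_trans (ler_wpM2l (ler0n _ k) (H1 k)) _.
  by rewrite mulrCA ler_wpM2l.
rewrite -mulr_sumr.
have sg : \sum_(k < N) q2 ^+ k <= (1 - q2)^-1.
  rewrite -[leRHS]mul1r ler_pdivlMr // mulrC.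
  have := subrX1 q2 N; rewrite -opprB -[q2 - 1]opprB mulNr => /oppr_inj <-.
  by rewrite gerBl exprn_ge0.
rewrite /K.
have -> : M * K1 * K2 / (1 - q2) / p ^+ 2 * normc h ^+ 2 =
  M * K1 * K2 / p ^+ 2 * normc h ^+ 2 * (1 - q2)^-1 by ring.
rewrite ler_wpM2l // mulr_ge0 ?exprn_ge0 ?normc_ge0 //.
by apply: divr_ge0; [rewrite !mulr_ge0|rewrite exprn_ge0 // ltW].
Qed.

End Derivative.

(** * Integrals depending analytically on a parameter *)

Section CexpTheory.
Variable R : realType.
Local Notation C := R[i].
Implicit Types (z w : C) (x : R).

Lemma cexpD z w : cexp (z + w) = cexp z * cexp w.
Proof.
case: z => a b; case: w => c d; rewrite /cexp /= expRD sinD cosD.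
by simpc; congr (_ +i* _); ring.
Qed.

Lemma cexp0 : cexp (0 : C) = 1.
Proof. by rewrite /cexp /= expR0 cos0 sin0; simpc. Qed.

Lemma cexpR x : cexp x%:C = (expR x)%:C :> C.
Proof. by rewrite /cexp /= cos0 sin0; simpc. Qed.

Lemma normc_cexp z : normc (cexp z) = expR (complex.Re z).
Proof.
case: z => a b; rewrite /cexp normcM normcR ger0_norm ?expR_ge0 //=.
by rewrite cos2Dsin2 sqrtr1 mulr1.
Qed.

End CexpTheory.

(** * Complex-valued integrals *)

Section ComplexIntegral.
Context d (T : measurableType d) (R : realType).
Variables (mu : {measure set T -> \bar R}) (D : set T).
Hypothesis mD : measurable D.
Local Notation C := R[i].
Local Notation Re := complex.Re.
Local Notation Im := complex.Im.
Implicit Types (f g : T -> C) (h : T -> R).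

(** The measure is arbitrary: Lebesgue measure gives [Gamma] and the Mellin integrals, the counting
    measure gives the Dirichlet series. *)
Definition cint f : C :=
  (\int[mu]_(t in D) Re (f t))%R +i* (\int[mu]_(t in D) Im (f t))%R.

Definition cmeas f := measurable_fun D (fun t => Re (f t)) /\
  measurable_fun D (fun t => Im (f t)).

Definition cintegrable f := mu.-integrable D (EFin \o (fun t => Re (f t))) /\
  mu.-integrable D (EFin \o (fun t => Im (f t))).

Lemma le_integrableR h h' : measurable_fun D h ->
  (forall t, D t -> `|h t| <= `|h' t|) -> mu.-integrable D (EFin \o h') ->
  mu.-integrable D (EFin \o h).
Proof.
by move=> mh hh'; apply: le_integrable => //; exact/measurable_EFinP.
Qed.

Lemma cmeasM f g : cmeas f -> cmeas g -> cmeas (fun t => f t * g t).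
Proof.
move=> [fr fi] [gr gi]; split.
  have -> : (fun t => Re (f t * g t)) =
    (fun t => Re (f t) * Re (g t) - Im (f t) * Im (g t)).
    by apply/funext => t; case: (f t); case: (g t).
  by apply: measurable_funB; apply: measurable_funM.
have -> : (fun t => Im (f t * g t)) =
  (fun t => Re (f t) * Im (g t) + Im (f t) * Re (g t)).
  by apply/funext => t; case: (f t) => a b; case: (g t) => a' b' /=; ring.
by apply: measurable_funD; apply: measurable_funM.
Qed.

Lemma cmeasD f g : cmeas f -> cmeas g -> cmeas (fun t => f t + g t).
Proof.
move=> [fr fi] [gr gi]; split.
  by under eq_fun do rewrite ReD; apply: measurable_funD.
by under eq_fun do rewrite ImD; apply: measurable_funD.
Qed.

Lemma cmeasR h : measurable_fun D h -> cmeas (fun t => (h t)%:C).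
Proof. by move=> mh; split => //=; exact: measurable_cst. Qed.

Lemma cmeas_cst (c : C) : cmeas (fun=> c).
Proof. by split; exact: measurable_cst. Qed.

Lemma cmeas_sum n (f : nat -> T -> C) : (forall k, cmeas (f k)) ->
  cmeas (fun t => \sum_(k < n) f k t).
Proof.
move=> mf; elim: n => [|n IH].
  by under eq_fun do rewrite big_ord0; exact: cmeas_cst.
by under eq_fun do rewrite big_ord_recr /=; apply: cmeasD.
Qed.

Lemma cmeasX f n : cmeas f -> cmeas (fun t => f t ^+ n).
Proof.
move=> mf; elim: n => [|n IH].
  by under eq_fun do rewrite expr0; exact: cmeas_cst.
by under eq_fun do rewrite exprS; apply: cmeasM.
Qed.

Lemma cmeas_cexp f : cmeas f -> cmeas (fun t => cexp (f t)).
Proof.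
move=> [fr fi]; rewrite /cexp; apply: cmeasM.
  by apply: cmeasR; exact: measurableT_comp.
split => /=; apply: measurableT_comp => //.
  exact: (continuous_measurable_fun (@continuous_cos R)).
exact: (continuous_measurable_fun (@continuous_sin R)).
Qed.

Lemma cintegrable_le f h : cmeas f -> mu.-integrable D (EFin \o h) ->
  (forall t, D t -> normc (f t) <= h t) -> cintegrable f.
Proof.
move=> [fr fi] ih fh.
by split; apply: le_integrableR ih => // t /fh fht;
  apply: le_trans (le_trans fht (ler_norm _)); rewrite (ler_Re, ler_Im).
Qed.

Lemma eq_cint f g : (forall t, D t -> f t = g t) -> cint f = cint g.
Proof.
move=> fg; rewrite /cint; congr (_ +i* _).
  by apply: eq_Rintegral => t /set_mem /fg ->.
by apply: eq_Rintegral => t /set_mem /fg ->.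
Qed.

Lemma cintD f g : cintegrable f -> cintegrable g ->
  cint (fun t => f t + g t) = cint f + cint g.
Proof.
move=> [fr fi] [gr gi]; rewrite /cint; simpc.
by congr (_ +i* _); (under eq_Rintegral do rewrite ?ReD ?ImD);
  rewrite RintegralD.
Qed.

Lemma cintegrableD f g : cintegrable f -> cintegrable g ->
  cintegrable (fun t => f t + g t).
Proof.
move=> [fr fi] [gr gi]; split.
  rewrite (_ : EFin \o _ = (EFin \o (fun t => Re (f t))) \+
    (EFin \o (fun t => Re (g t)))); first exact: integrableD.
  by apply/funext => t /=; rewrite ReD.
rewrite (_ : EFin \o _ = (EFin \o (fun t => Im (f t))) \+
  (EFin \o (fun t => Im (g t)))); first exact: integrableD.
by apply/funext => t /=; rewrite ImD.
Qed.

Lemma cintegrable0 : cintegrable (fun=> 0).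
Proof. by split; exact: integrable0. Qed.

Lemma integrableZlR (x : R) h : mu.-integrable D (EFin \o h) ->
  mu.-integrable D (EFin \o (fun t => x * h t)).
Proof. by move=> /(integrableZl mD x). Qed.

Lemma integrableDR h h' : mu.-integrable D (EFin \o h) ->
  mu.-integrable D (EFin \o h') ->
  mu.-integrable D (EFin \o (fun t => h t + h' t)).
Proof. exact: integrableD. Qed.

Lemma cintegrableZ c f : cintegrable f -> cintegrable (fun t => c * f t).
Proof.
move=> [fr fi]; case: c => a b.
have := (integrableZlR a fr, integrableZlR b fi,
         integrableZlR a fi, integrableZlR b fr) => -[[[arr bfi] afi] bfr].
split.
  apply: eq_integrable (integrableB mD arr bfi) => // t _ /=.
  by case: (f t).
apply: eq_integrable (integrableD mD afi bfr) => // t _ /=.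
by case: (f t).
Qed.

Lemma cintZ c f : cintegrable f -> cint (fun t => c * f t) = c * cint f.
Proof.
move=> [fr fi]; case: c => a b; rewrite /cint; simpc.
have := (integrableZlR a fr, integrableZlR b fi,
         integrableZlR a fi, integrableZlR b fr) => -[[[arr bfi] afi] bfr].
congr (_ +i* _).
  rewrite -!RintegralZl // -RintegralB //.
  by apply: eq_Rintegral => t _; case: (f t).
rewrite -!RintegralZl // -RintegralD //.
by apply: eq_Rintegral => t _; case: (f t).
Qed.

Lemma cint_sum n (f : nat -> T -> C) : (forall k, cintegrable (f k)) ->
  cintegrable (fun t => \sum_(k < n) f k t) /\
  cint (fun t => \sum_(k < n) f k t) = \sum_(k < n) cint (f k).
Proof.
move=> fI; elim: n => [|n [IH1 IH2]].
  under eq_fun do rewrite big_ord0.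
  split; first exact: cintegrable0.
  by rewrite big_ord0 /cint /Rintegral !integral0.
under eq_fun do rewrite big_ord_recr /=.
split; first exact: cintegrableD.
by rewrite cintD // IH2 big_ord_recr.
Qed.

Lemma Rintegral_cvg (h_ : nat -> T -> R) h (k : T -> R) :
  (forall n, measurable_fun D (h_ n)) -> measurable_fun D h ->
  (forall t, D t -> (fun n => h_ n t) @ \oo --> h t) ->
  mu.-integrable D (EFin \o k) ->
  (forall n t, D t -> `|h_ n t| <= k t) ->
  mu.-integrable D (EFin \o h) /\
  (fun n => \int[mu]_(t in D) h_ n t)%R @ \oo --> (\int[mu]_(t in D) h t)%R.
Proof.
move=> mh_ mh h_h kI h_k.
have [|||||hI _ hc] := @dominated_convergence _ _ _ mu D mD
  (fun n => EFin \o h_ n) (EFin \o h) (EFin \o k).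
- by move=> n; exact/measurable_EFinP.
- exact/measurable_EFinP.
- by apply: aeW => t Dt; apply: cvg_EFin; [exact: nearW|exact: h_h].
- by [].
- by apply: aeW => t n Dt /=; rewrite lee_fin; exact: h_k.
split => //.
apply: (@fine_cvg _ _ _ _ (fun n => \int[mu]_(t in D) (h_ n t)%:E)%E).
by rewrite fineK ?integrable_fin_num.
Qed.

Lemma cint_cvg (f_ : nat -> T -> C) f h :
  (forall n, cmeas (f_ n)) -> cmeas f ->
  (forall t, D t -> (fun n => f_ n t) @ \oo --> f t) ->
  mu.-integrable D (EFin \o h) ->
  (forall n t, D t -> normc (f_ n t) <= h t) ->
  (fun n => cint (f_ n)) @ \oo --> cint f.
Proof.
move=> mf_ [fr fi] ff hI fh.
have fc t : D t -> (fun n => normc (f_ n t - f t)) @ \oo --> (0 : R).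
  by move=> /ff/cvgCP.
apply: cvgC_ReIm.
- apply: (proj2 (@Rintegral_cvg _ _ h _ fr _ hI _)).
  + by move=> n; case: (mf_ n).
  + move=> t Dt; apply/cvgrPdist_lt => e e0.
    move/cvgrPdist_lt/(_ _ e0): (fc _ Dt); apply: filterS => n.
    rewrite sub0r normrN ger0_norm ?normc_ge0 // normcB.
    by apply: le_lt_trans; rewrite -ReN -ReD ler_Re.
  + by move=> n t Dt; apply: le_trans (ler_Re _) (fh _ _ Dt).
- apply: (proj2 (@Rintegral_cvg _ _ h _ fi _ hI _)).
  + by move=> n; case: (mf_ n).
  + move=> t Dt; apply/cvgrPdist_lt => e e0.
    move/cvgrPdist_lt/(_ _ e0): (fc _ Dt); apply: filterS => n.
    rewrite sub0r normrN ger0_norm ?normc_ge0 // normcB.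
    by apply: le_lt_trans; rewrite -ImN -ImD ler_Im.
  + by move=> n t Dt; apply: le_trans (ler_Im _) (fh _ _ Dt).
Qed.

End ComplexIntegral.

(** * Power series of exponential integrals *)

Section ExponentialIntegral.
Context d (T : measurableType d) (R : realType).
Variables (mu : {measure set T -> \bar R}) (D : set T).
Hypothesis mD : measurable D.
Local Notation C := R[i].
Variables (g : T -> C) (L : T -> R) (r : R).
Hypothesis mg : cmeas D g.
Hypothesis mL : measurable_fun D L.
Hypothesis gI : mu.-integrable D (EFin \o (fun t => normc (g t) * expR (r * `|L t|))).

(** Taylor coefficients at 0 of the integral of [g e^(w L)] as a function of [w]. *)
Definition exp_moment n : C :=
  cexp_coeff R n * cint mu D (fun t => g t * (L t)%:C ^+ n).

Lemma sum_exp_le (x : R) n : 0 <= x -> \sum_(k < n) x ^+ k / k`!%:R <= expR x.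
Proof.
move=> x0; have -> : \sum_(k < n) x ^+ k / k`!%:R = series (exp_coeff x) n.
  by rewrite /series /= big_mkord.
apply: nondecreasing_cvgn_le; last exact: is_cvg_series_exp_coeff.
apply: nondecreasing_series => k _ _.
exact: exp_coeff_ge0.
Qed.

(** All partial sums of the series of [g e^(w L)] are dominated by [|g| e^(r |L|)], so dominated
    convergence integrates the exponential series term by term. *)
Lemma psum_exp_moment w : 0 < r -> normc w <= r ->
  psum exp_moment w (cint mu D (fun t => g t * cexp (w * (L t)%:C))).
Proof.
move=> r0 wr.
have mLn k : cmeas D (fun t => g t * (L t)%:C ^+ k).
  by apply: cmeasM => //; apply: cmeasX; exact: cmeasR.
pose f k t := cexp_coeff R k * w ^+ k * (g t * (L t)%:C ^+ k).
pose F n t := \sum_(k < n) f k t.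
have nf k t : normc (f k t) = normc (g t) * ((normc w * `|L t|) ^+ k / k`!%:R).
  rewrite /f !normcM !normcX normcR cexp_coeffE normcR ger0_norm //.
  by rewrite exprMn; ring.
have nF n t : normc (F n t) <= normc (g t) * expR (r * `|L t|).
  apply: le_trans (normc_sum _ _ _) _; under eq_bigr do rewrite nf.
  rewrite -mulr_sumr ler_wpM2l ?normc_ge0 //.
  apply: le_trans (sum_exp_le _ _) _; first by rewrite mulr_ge0 ?normc_ge0.
  by rewrite ler_expR ler_wpM2r.
have mf k : cmeas D (f k) by apply: cmeasM => //; exact: cmeas_cst.
have Lk k (x : R) : 0 <= x -> x ^+ k / k`!%:R <= expR x.
  move=> x0; apply: (le_trans _ (sum_exp_le k.+1 x0)).
  by rewrite big_ord_recr /= lerDr sumr_ge0 // => i _; rewrite divr_ge0 ?exprn_ge0.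
have gLI k : cintegrable mu D (fun t => g t * (L t)%:C ^+ k).
  apply: (cintegrable_le mD (mLn k) (integrableZlR mD (k`!%:R / r ^+ k) gI)).
  move=> t Dt; rewrite normcM normcX normcR mulrCA ler_wpM2l ?normc_ge0 //.
  have := Lk k (r * `|L t|) ltac:(by rewrite mulr_ge0 // ltW).
  rewrite ler_pdivrMr ?ltr0n ?fact_gt0 // exprMn => h.
  rewrite mulrAC ler_pdivlMr ?exprn_gt0 //.
  by rewrite mulrC [leRHS]mulrC.
have fI k : cintegrable mu D (f k) by exact: cintegrableZ.
apply/psumP; apply/cvgCP.
have Fc : (fun n => cint mu D (F n)) @ \oo -->
    cint mu D (fun t => g t * cexp (w * (L t)%:C)).
  apply: (cint_cvg mD _ _ _ gI) => //.
  - by move=> n; exact: cmeas_sum.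
  - apply: cmeasM => //; apply: cmeas_cexp; apply: cmeasM; first exact: cmeas_cst.
    exact: cmeasR.
  - move=> t Dt; have /psumP/cvgCP h := psum_cexp (w * (L t)%:C).
    have FF := @filter_filter _ _ eventually_filter.
    have {}h := @cvgcM _ _ _ FF _ _ _ _ (@cvg_cst _ (g t) _ _ _) h.
    have e : (fun n => F n t) =
      (fun n => g t * \sum_(k < n) cexp_coeff R k * (w * (L t)%:C) ^+ k).
      apply/funext => n; rewrite mulr_sumr; apply: eq_bigr => k _.
      by rewrite /f exprMn; ring.
    by rewrite e; apply h.
suff e : (fun n => \sum_(k < n) exp_moment k * w ^+ k) = (fun n => cint mu D (F n)).
  by rewrite e.
apply/funext => n; rewrite (proj2 (cint_sum mD n fI)); apply: eq_bigr => k _.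
by rewrite /f cintZ // /exp_moment; ring.
Qed.

End ExponentialIntegral.

(** * Integration on the half-line *)

Section HalfLine.
Variable R : realType.
Local Notation mu := (@lebesgue_measure R).
Implicit Types (f F G : R -> R) (a b c x y t : R).

Definition cont_pos f := forall t, 0 < t -> {for t, continuous f}.

Lemma cont_posM f g : cont_pos f -> cont_pos g -> cont_pos (fun t => f t * g t).
Proof. by move=> cf cg t t0; apply: cvgM; [exact: cf|exact: cg]. Qed.

Lemma cont_pos_within f a b : 0 < a -> cont_pos f ->
  {within `[a, b], continuous f}.
Proof.
move=> a0 cf; apply: continuous_in_subspaceT => t; rewrite inE /= in_itv /=.
by move=> /andP[at_ _]; apply: cf; exact: lt_le_trans at_.
Qed.

Lemma cont_pos_measurable f : cont_pos f -> measurable_fun (`]0, +oo[ : set R) f.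
Proof.
move=> cf; apply: subspace_continuous_measurable_fun => //.
apply: continuous_in_subspaceT => t; rewrite inE /= in_itv /= andbT.
exact: cf.
Qed.

Lemma cont_pos_measurableS f (D : set R) : cont_pos f -> measurable D ->
  D `<=` (`]0, +oo[ : set R) -> measurable_fun D f.
Proof.
move=> cf mD sD; apply: (measurable_funS _ sD) => //.
exact: cont_pos_measurable.
Qed.

Lemma cont_pos_integrable f a b : 0 < a -> cont_pos f ->
  mu.-integrable `[a, b] (EFin \o f).
Proof.
move=> a0 cf; apply: continuous_compact_integrable; first exact: segment_compact.
exact: cont_pos_within.
Qed.

Lemma FTC2_pos f F a b : 0 < a -> a < b -> cont_pos f ->
  (forall t, 0 < t -> is_derive t 1 F (f t)) ->
  (\int[mu]_(t in `[a, b]) (f t)%:E = (F b - F a)%:E)%E.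
Proof.
move=> a0 ab cf dF; rewrite (@continuous_FTC2 _ f F) //.
- exact: cont_pos_within.
- have cF t : 0 < t -> {for t, continuous F}.
    move=> /dF[dt _]; apply: differentiable_continuous; exact/derivable1_diffP.
  split=> [t||].
  + rewrite in_itv /= => /andP[at_ _].
    by case: (dF t (lt_trans a0 at_)).
  + by apply: cvg_at_right_filter; exact: cF.
  + by apply: cvg_at_left_filter; apply: cF; exact: lt_trans ab.
- move=> t; rewrite in_itv /= => /andP[at_ _].
  by rewrite derive1E; case: (dF t (lt_trans a0 at_)).
Qed.

(** With the parameter [D], scaling by [c] maps the exhaustion for [D = 1] onto the one for [D = c],
    so a substitution on compact intervals extends to the half-line. *)
Lemma exhaust0y (D : R) f : 0 < D -> measurable_fun (`]0, +oo[ : set R) f ->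
  (forall t, 0 < t -> 0 <= f t) ->
  (\int[mu]_(t in `[(D / n.+1%:R)%R, (D * n.+1%:R)%R]) (f t)%:E)%E @[n --> \oo] -->
  (\int[mu]_(t in `]0%R, +oo[) (f t)%:E)%E.
Proof.
move=> D0 mf f0; pose E n : set R := `[(D / n.+1%:R)%R, (D * n.+1%:R)%R]%classic.
have E0 n : E n `<=` (`]0, +oo[ : set R).
  move=> t; rewrite /E /= !in_itv /= andbT => /andP[h _].
  by apply: lt_le_trans h; rewrite divr_gt0.
have -> : `]0, +oo[%classic = \bigcup_n E n.
  apply/seteqP; split => [t|t [n _ /E0//]].
  rewrite /= in_itv /= andbT => t0.
  pose m := Num.truncn (Num.max (t / D) (D / t)).
  have : Num.max (t / D) (D / t) < m.+1%:R.
    by apply: truncnS_gt; rewrite le_max divr_ge0 // ltW.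
  rewrite gt_max ltr_pdivrMr // => /andP[h1]; rewrite ltr_pdivrMr // => h2.
  exists m => //; rewrite /E /= in_itv /=; apply/andP; split.
    by rewrite ler_pdivrMr // mulrC ltW.
  by rewrite mulrC ltW.
apply: (@ge0_nondecreasing_set_cvg_integral _ (measurableTypeR R) R E (fun t => (f t)%:E) (@lebesgue_measure R)).
- apply/nondecreasing_seqP => n; rewrite subsetEset => t.
  rewrite /E /= !in_itv /= => /andP[h1 h2]; apply/andP; split.
    apply: le_trans h1; rewrite ler_pM2l // lef_pV2 ?posrE // ler_nat //.
  by apply: le_trans h2 _; rewrite ler_pM2l // ler_nat.
- by move=> n; exact: measurable_itv.
- move=> n; apply/measurable_EFinP; apply: (measurable_funS _ (E0 n)) => //.
- move=> n t /E0; rewrite /= in_itv /= andbT => t0.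
  by rewrite lee_fin f0.
Qed.

Lemma exhausty (a : R) f : measurable_fun (`[a, +oo[ : set R) f ->
  (forall t, a <= t -> 0 <= f t) ->
  (\int[mu]_(t in `[a, (a + n.+1%:R)%R]) (f t)%:E)%E @[n --> \oo] -->
  (\int[mu]_(t in `[a, +oo[) (f t)%:E)%E.
Proof.
move=> mf f0; pose E n : set R := `[a, (a + n.+1%:R)%R]%classic.
have E0 n : E n `<=` (`[a, +oo[ : set R).
  by move=> t; rewrite /E /= !in_itv /= andbT => /andP[].
have -> : `[a, +oo[%classic = \bigcup_n E n.
  apply/seteqP; split => [t|t [n _ /E0//]].
  rewrite /= in_itv /= andbT => t0.
  exists (Num.truncn (t - a)) => //; rewrite /E /= in_itv /= t0 /=.
  by rewrite addrC -lerBlDr ltW // truncnS_gt // subr_ge0.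
apply: (@ge0_nondecreasing_set_cvg_integral _ (measurableTypeR R) R E (fun t => (f t)%:E) (@lebesgue_measure R)).
- apply/nondecreasing_seqP => n; rewrite subsetEset => t.
  rewrite /E /= !in_itv /= => /andP[-> h2] /=.
  by apply: le_trans h2 _; rewrite lerD2l ler_nat.
- by move=> n; exact: measurable_itv.
- move=> n; apply/measurable_EFinP; apply: (measurable_funS _ (E0 n)) => //.
- move=> n t /E0; rewrite /= in_itv /= andbT => t0.
  by rewrite lee_fin f0.
Qed.

Lemma exhaust01 f : measurable_fun (`]0, 1] : set R) f ->
  (forall t, 0 < t -> 0 <= f t) ->
  (\int[mu]_(t in `[n.+1%:R^-1%R, 1%R]) (f t)%:E)%E @[n --> \oo] -->
  (\int[mu]_(t in `]0%R, 1%R]) (f t)%:E)%E.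
Proof.
move=> mf f0; pose E n : set R := `[n.+1%:R^-1%R, 1%R]%classic.
have E0 n : E n `<=` (`]0, 1] : set R).
  move=> t; rewrite /E /= !in_itv /= => /andP[h ->].
  by rewrite andbT; apply: lt_le_trans h; rewrite invr_gt0.
have -> : `]0, 1]%classic = \bigcup_n E n.
  apply/seteqP; split => [t|t [n _ /E0//]].
  rewrite /= in_itv /= => /andP[t0 t1].
  exists (Num.truncn t^-1) => //; rewrite /E /= in_itv /= t1 andbT.
  rewrite -[leRHS]invrK lef_pV2 ?posrE ?invr_gt0 //.
  by rewrite ltW // truncnS_gt // invr_ge0 ltW.
apply: (@ge0_nondecreasing_set_cvg_integral _ (measurableTypeR R) R E (fun t => (f t)%:E) (@lebesgue_measure R)).
- apply/nondecreasing_seqP => n; rewrite subsetEset => t.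
  rewrite /E /= !in_itv /= => /andP[h ->]; rewrite andbT.
  by apply: le_trans h; rewrite lef_pV2 ?posrE // ler_nat.
- by move=> n; exact: measurable_itv.
- move=> n; apply/measurable_EFinP; apply: (measurable_funS _ (E0 n)) => //.
- move=> n t /E0; rewrite /= in_itv /= => /andP[t0 _].
  by rewrite lee_fin f0.
Qed.

Lemma integral_scale c f : 0 < c -> cont_pos f -> (forall t, 0 < t -> 0 <= f t) ->
  (\int[mu]_(t in `]0%R, +oo[) (f t)%:E =
   \int[mu]_(t in `]0%R, +oo[) (f (c * t) * c)%:E)%E.
Proof.
move=> c0 cf f0.
have cg : cont_pos (fun t => f (c * t) * c).
  apply: cont_posM; last by move=> t _; exact: cvg_cst.
  move=> t t0; apply: (@continuous_comp _ _ _ (fun t => c * t) f).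
    exact: mulrl_continuous.
  by apply: cf; rewrite mulr_gt0.
have h1 := exhaust0y c0 (cont_pos_measurable cf) f0.
have g0 t : 0 < t -> 0 <= f (c * t) * c.
  by move=> t0; rewrite mulr_ge0 ?(ltW c0) // f0 // mulr_gt0.
have h2 := exhaust0y ltr01 (cont_pos_measurable cg) g0.
suff e n : (\int[mu]_(t in `[(c / n.+1%:R)%R, (c * n.+1%:R)%R]) (f t)%:E =
    \int[mu]_(t in `[(1 / n.+1%:R)%R, (1 * n.+1%:R)%R]) (f (c * t) * c)%:E)%E.
  move: h1; under eq_fun do rewrite e; move=> h1.
  exact: (cvg_unique _ h1 h2).
rewrite !mul1r.
have D t : is_derive t 1 (fun x : R => c * x) c.
  by apply: is_derive_eq; exact: mulr1.
have D1 : (fun x : R => c * x)^`()%classic = cst c.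
  by apply/funext => t; rewrite derive1E; case: (D t).
have ab : n.+1%:R^-1 <= n.+1%:R :> R.
  by apply: (@le_trans _ _ 1); rewrite ?invf_le1 // ler1n.
rewrite (@integration_by_substitution_increasing _ (fun x => c * x) f).
- by rewrite D1.
- by [].
- by move=> x y _ _; rewrite ltr_pM2l.
- by rewrite D1 => x _; exact: cvg_cst.
- by rewrite D1; exact: is_cvg_cst.
- by rewrite D1; exact: is_cvg_cst.
- split=> [x _||]; first by case: (D x).
    by apply: cvg_at_right_filter; exact: mulrl_continuous.
  by apply: cvg_at_left_filter; exact: mulrl_continuous.
- by apply: cont_pos_within => //; rewrite mulr_gt0 // invr_gt0.
Qed.

(** The inversion [t -> 1 / t] exchanges [[1 / N, 1]] and [[1, N]]; the two exhaustions are then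
    compared in the limit. *)
Lemma integral_inv f : cont_pos f -> (forall t, 0 < t -> 0 <= f t) ->
  (\int[mu]_(t in `]0%R, 1%R]) (f t)%:E =
   \int[mu]_(t in `[1%R, +oo[) (f t^-1 * t ^- 2)%:E)%E.
Proof.
move=> cf f0.
have ci : cont_pos (@GRing.inv R).
  by move=> t t0; apply: inv_continuous; rewrite gt_eqF.
have ci2 : cont_pos (fun t : R => t ^- 2).
  move=> t t0; apply: (@continuous_comp _ _ _ (fun t => t ^+ 2) (@GRing.inv R)).
    exact: exprn_continuous.
  by apply: ci; rewrite exprn_gt0.
have cg : cont_pos (fun t => f t^-1 * t ^- 2).
  apply: cont_posM => // t t0; apply: (@continuous_comp _ _ _ (@GRing.inv R) f).
    exact: ci.
  by apply: cf; rewrite invr_gt0.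
have s1 : (`]0, 1] : set R) `<=` `]0, +oo[.
  by move=> t; rewrite /= !in_itv /= => /andP[->].
have s2 : (`[1, +oo[ : set R) `<=` `]0, +oo[.
  by move=> t; rewrite /= !in_itv /= !andbT; apply: lt_le_trans.
have h1 := exhaust01 (cont_pos_measurableS cf (measurable_itv _) s1) f0.
have g0 t : 1 <= t -> 0 <= f t^-1 * t ^- 2.
  move=> t1; have t0 : 0 < t by apply: lt_le_trans t1.
  by rewrite mulr_ge0 ?invr_ge0 ?exprn_ge0 ?(ltW t0) // f0 // invr_gt0.
have h2 := exhausty (cont_pos_measurableS cg (measurable_itv _) s2) g0.
have {}h2 : (\int[mu]_(t in `[1%R, n.+2%:R]) (f t^-1 * t ^- 2)%:E)%E @[n --> \oo] -->
  (\int[mu]_(t in `[1%R, +oo[) (f t^-1 * t ^- 2)%:E)%E.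
  by move: h2; under eq_fun do rewrite nat1r.
(* The shift aligns the left endpoint [1 / (n + 2)] with the right endpoint [1 + (n + 1)] of the
   other exhaustion. *)
move: h1; rewrite -(cvg_shiftS _) /= => h1.
suff e n : (\int[mu]_(t in `[n.+2%:R^-1%R, 1%R]) (f t)%:E =
    \int[mu]_(t in `[1%R, n.+2%:R]) (f t^-1 * t ^- 2)%:E)%E.
  move: h1; under eq_fun do rewrite e; move=> h1.
  exact: (cvg_unique _ h1 h2).
have D t : 0 < t -> is_derive t 1 (@GRing.inv R) (- t ^- 2).
  move=> t0; have h := @is_deriveV R id t 1 1 _ (is_derive_id t 1).
  by have := h ltac:(by rewrite gt_eqF); rewrite /GRing.scale /= mulr1.
have D1 t : 0 < t -> (@GRing.inv R)^`()%classic t = - t ^- 2.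
  by move=> t0; rewrite derive1E; case: (D t t0).
have cN : cont_pos ((@GRing.inv R)^`()%classic).
  move=> t t0; rewrite /prop_for /continuous_at D1 //.
  apply: (@cvg_trans _ ((fun t => - t ^- 2) x @[x --> t])).
    apply: near_eq_cvg; near=> x; rewrite D1 //.
    by near: x; exact: lt_nbhsr.
  by have h := cvgN (ci2 t t0); apply: h.
have n0 : 0 < n.+2%:R :> R by [].
have -> : `[n.+2%:R^-1, 1]%classic = `[n.+2%:R^-1, 1^-1]%classic :> set R
  by rewrite invr1.
rewrite (@integration_by_substitution_decreasing _ (@GRing.inv R) f).
- apply: eq_integral => t; rewrite inE /= in_itv /= => /andP[t1 _].
  transitivity (f t^-1 * - (@GRing.inv R)^`()%classic t)%:E => //.
  by rewrite D1 ?opprK //; apply: lt_le_trans t1.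
- by rewrite ler1n.
- move=> x y; rewrite !in_itv /= => /andP[x1 _] /andP[y1 _] xy.
  by rewrite ltf_pV2 // posrE; apply: lt_le_trans (_ : 1 <= _).
- move=> x; rewrite in_itv /= => /andP[x1 _]; apply: cN; exact: lt_trans x1.
- apply/cvg_ex; exists ((@GRing.inv R)^`()%classic 1).
  by apply: cvg_at_right_filter; exact: cN.
- apply/cvg_ex; exists ((@GRing.inv R)^`()%classic n.+2%:R).
  by apply: cvg_at_left_filter; exact: cN.
- split=> [x||].
  + by rewrite in_itv /= => /andP[x1 _]; case: (D x (lt_trans ltr01 x1)).
  + by apply: cvg_at_right_filter; exact: ci.
  + by apply: cvg_at_left_filter; exact: ci.
- by rewrite invr1; apply: cont_pos_within => //; rewrite invr_gt0.
Unshelve. all: by end_near. Qed.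

End HalfLine.

(** * Elementary inequalities for cosine, exponential and logarithm *)

Section Inequalities.
Variable R : realType.
Implicit Types (x y z u t b : R) (f df : R -> R).

Lemma derive_ge0_le f df b : (forall x, is_derive x 1 f (df x)) -> 0 <= b ->
  (forall x, 0 <= x <= b -> 0 <= df x) -> f 0 <= f b.
Proof.
move=> dfx b0 d0; have [|c] := @MVT_segment R f df 0 b b0 (fun x _ => dfx x).
  apply: derivable_within_continuous => x _; by case: (dfx x).
rewrite in_itv /= subr0 => /d0 c0 e.
by rewrite -subr_ge0 e mulr_ge0.
Qed.

Lemma sin_le x : 0 <= x -> sin x <= x.
Proof.
move=> x0; rewrite -subr_ge0.
have -> : 0 = 0 - sin 0 :> R by rewrite sin0 subrr.
by apply: (@derive_ge0_le (fun x => x - sin x) (fun x => 1 - cos x)).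
Qed.

Lemma cos_ge_1Bsqr x : 1 - x ^+ 2 / 2 <= cos x.
Proof.
wlog x0 : x / 0 <= x.
  move=> H; have [/H//|/ltW x0] := lerP 0 x.
  by rewrite -cosN -sqrrN; apply: H; rewrite oppr_ge0.
rewrite -subr_ge0.
have -> : 0 = cos 0 - (1 - 0 ^+ 2 / 2) :> R.
  by rewrite cos0 expr0n mul0r subr0 subrr.
apply: (@derive_ge0_le (fun x => cos x - (1 - x ^+ 2 / 2)) (fun x => x - sin x)) => //.
  move=> y; apply: is_derive_eq.
  by rewrite /GRing.scale /=; field.
by move=> y /andP[y0 _]; rewrite subr_ge0 sin_le.
Qed.

Lemma mulr_cos_le_sin x : 0 <= x <= pi -> x * cos x <= sin x.
Proof.
move=> /andP[x0 xpi]; rewrite -subr_ge0.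
have -> : 0 = sin 0 - 0 * cos 0 :> R by rewrite sin0 mul0r subrr.
apply: (@derive_ge0_le (fun x => sin x - x * cos x) (fun x => x * sin x)) => //.
  move=> y; apply: is_derive_eq.
  by rewrite /GRing.scale /=; ring.
move=> y /andP[y0 yx]; rewrite mulr_ge0 // sin_ge0_pi // y0.
exact: le_trans xpi.
Qed.

(** The product [cos x * e^(x^2 / 2)] decreases on the nonnegative half, because [x cos x <= sin x].
    The bound makes high powers of cosine Gaussian. *)
Lemma cos_le_expR x : `|x| <= pi / 2 -> cos x <= expR (- (x ^+ 2 / 2)).
Proof.
have p0 := pi_gt0 R.
wlog x0 : x / 0 <= x.
  move=> H; have [/H//|/ltW x0 xp] := lerP 0 x.
  by rewrite -cosN -sqrrN; apply: H; rewrite ?oppr_ge0 ?normrN.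
rewrite ger0_norm // => xp.
suff : cos x * expR (x ^+ 2 / 2) <= 1.
  by rewrite expRN -[(expR _)^-1]mul1r ler_pdivlMr // expR_gt0.
rewrite -lerN2.
have -> : - 1 = - (cos 0 * expR (0 ^+ 2 / 2)) :> R.
  by rewrite cos0 expr0n mul0r expR0 mulr1.
apply: (@derive_ge0_le (fun x => - (cos x * expR (x ^+ 2 / 2)))
  (fun x => expR (x ^+ 2 / 2) * (sin x - x * cos x))) => //.
  move=> y.
  have d1 : is_derive y 1 (fun x : R => x ^+ 2 / 2) y.
    by apply: is_derive_eq; rewrite /GRing.scale /=; field.
  have d2 : is_derive y 1 (fun x : R => expR (x ^+ 2 / 2)) (y * expR (y ^+ 2 / 2)).
    have h := @is_derive1_comp R expR _ y _ _ (is_derive_expR _) d1.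
    by apply: (is_derive_eq h); rewrite mulrC.
  apply: is_derive_eq.
  by rewrite /GRing.scale /=; ring.
move=> y /andP[y0 yx]; rewrite mulr_ge0 ?expR_ge0 // subr_ge0 mulr_cos_le_sin //.
by rewrite y0 /=; lra.
Qed.

(* From [E := e^z >= 1 + z + z^2/2 + z^3/6] one gets [(E - 1 - z^2/2)^2 >= z^2 + z^4/4]. *)
Lemma cosh_ge z : 2 + z ^+ 2 <= expR z + expR (- z).
Proof.
wlog z0 : z / 0 <= z.
  move=> H; have [/H//|/ltW z0] := lerP 0 z.
  have := H (- z); rewrite sqrrN opprK oppr_ge0 => /(_ z0).
  by rewrite [expR (- z) + _]addrC.
set E := expR z.
have E0 : 0 < E by exact: expR_gt0.
have hE : z + z ^+ 3 / 6 <= E - (1 + z ^+ 2 / 2).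
  have := sum_exp_le 4 z0; rewrite !big_ord_recr big_ord0 /= -/E.
  rewrite !factS fact0 !muln1 expr0 expr1 => h; lra.
have h2 : (z + z ^+ 3 / 6) ^+ 2 <= (E - (1 + z ^+ 2 / 2)) ^+ 2.
  have h0 : 0 <= z + z ^+ 3 / 6 by rewrite addr_ge0 // divr_ge0 // exprn_ge0.
  by rewrite lerXn2r // nnegrE // (le_trans h0).
rewrite expRN -/E.
suff : (2 + z ^+ 2) * E <= E ^+ 2 + 1.
  move=> h; rewrite -(ler_pM2r E0) [leRHS]mulrDl mulVf ?gt_eqF // -expr2 //.
have h4 : 0 <= z ^+ 4 by rewrite exprn_ge0.
have h6 : 0 <= z ^+ 6 by rewrite exprn_ge0.
have e1 : (z + z ^+ 3 / 6) ^+ 2 = z ^+ 2 + z ^+ 4 / 3 + z ^+ 6 / 36 by field.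
have e2 : (E - (1 + z ^+ 2 / 2)) ^+ 2 =
  E ^+ 2 - (2 + z ^+ 2) * E + 1 + z ^+ 2 + z ^+ 4 / 4 by field.
lra.
Qed.

Lemma sqr_ln_le u : 0 < u -> ln u ^+ 2 <= u - 2 + u^-1.
Proof.
move=> u0; have := cosh_ge (ln u); rewrite expRN lnK ?posrE //; lra.
Qed.

End Inequalities.

(** * The Gamma function and its reciprocal *)

Section HalfLineIntegrable.
Variable R : realType.
Local Notation mu := (@lebesgue_measure R).
Implicit Types (f F G : R -> R) (a b c x y t K B : R).

Lemma cont_pos_integrableS f f' (D : set R) : measurable D ->
  D `<=` (`]0, +oo[ : set R) -> cont_pos f ->
  (forall t, D t -> `|f t| <= f' t) ->
  mu.-integrable D (EFin \o f') -> mu.-integrable D (EFin \o f).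
Proof.
move=> mD D0 cf ff' If'.
apply: (@le_integrableR _ (measurableTypeR R) R (@lebesgue_measure R) D mD f f' _ _ If').
  exact: cont_pos_measurableS.
by move=> t /ff' h; apply: le_trans h (ler_norm _).
Qed.

Lemma integrable_pos_bound f B : cont_pos f -> (forall t, 0 < t -> 0 <= f t) ->
  (forall n : nat, (\int[mu]_(t in `[(n.+1%:R^-1)%R, n.+1%:R]) (f t)%:E <= B%:E)%E) ->
  mu.-integrable (`]0, +oo[ : set R) (EFin \o f).
Proof.
move=> cf f0 fB; apply/integrableP; split.
  by apply/measurable_EFinP; exact: cont_pos_measurable.
under eq_integral.
  move=> t; rewrite inE /= in_itv /= andbT => t0.
  rewrite ger0_norm ?f0 //; over.
apply: (@le_lt_trans _ _ B%:E); last by rewrite ltry.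
have h := exhaust0y ltr01 (cont_pos_measurable cf) f0.
apply: (cvge_le _ h); near=> n; rewrite !mul1r; exact: fB.
Unshelve. all: by end_near. Qed.

Lemma Rintegral_gt0 f (D : set R) c : measurable D -> `[1, 2] `<=` D ->
  mu.-integrable D (EFin \o f) -> (forall t, D t -> 0 <= f t) -> 0 < c ->
  (forall t, 1 <= t <= 2 -> c <= f t) -> 0 < (\int[mu]_(t in D) f t)%R.
Proof.
move=> mD sD If f0 c0 fc; apply: (lt_le_trans c0).
rewrite -lee_fin /Rintegral fineK ?integrable_fin_num //.
have -> : c%:E = (\int[mu]_(t in `[1%R, 2%R]) (cst c%:E t))%E.
  rewrite integral_cst //= lebesgue_measure_itv /= lte_fin ltr1n -EFinB.
  by rewrite (_ : 2 - 1 = 1) ?mule1 //; lra.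
apply: (@le_trans _ _ (\int[mu]_(t in `[1%R, 2%R]) (f t)%:E)%E).
  apply: ge0_le_integral => //.
  - by move=> t _; rewrite /= lee_fin; exact: ltW.
  - by case/integrableP: If => mf _; exact: measurable_funS mf.
apply: ge0_subset_integral => //.
by case/integrableP: If.
Qed.

Lemma is_derive_pow x t : 0 < t ->
  is_derive t 1 (fun t : R => expR (x * ln t)) (x / t * expR (x * ln t)).
Proof.
move=> t0; have h1 : is_derive t 1 (fun t => x * ln t) (x / t).
  have h := is_derive1_ln t0.
  by apply: is_derive_eq.
have h := @is_derive1_comp R expR _ t _ _ (is_derive_expR _) h1.
by apply: (is_derive_eq h); rewrite mulrC.
Qed.

Lemma cont_pos_derivable f df : (forall t, 0 < t -> is_derive t 1 f (df t)) ->
  cont_pos f.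
Proof.
move=> dF t /dF[dt _]; apply: differentiable_continuous; exact/derivable1_diffP.
Qed.

Lemma cont_pos_ln : cont_pos (@ln R).
Proof. by apply: cont_pos_derivable => t t0; exact: is_derive1_ln. Qed.

Lemma cont_pos_comp f F : cont_pos f -> continuous F -> cont_pos (fun t => F (f t)).
Proof.
move=> cf cF t t0; apply: (@continuous_comp _ _ _ f F); first exact: cf.
exact: cF.
Qed.

Lemma cont_posD f F : cont_pos f -> cont_pos F -> cont_pos (fun t => f t + F t).
Proof. by move=> cf cg t t0; apply: cvgD; [exact: cf|exact: cg]. Qed.

Lemma cont_pos_cst c : cont_pos (fun=> c).
Proof. by move=> t _; exact: cvg_cst. Qed.

Lemma cont_pos_id : cont_pos (fun t : R => t).
Proof. by move=> t _; exact: cvg_id. Qed.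

Lemma cont_pos_expR f : cont_pos f -> cont_pos (fun t => expR (f t)).
Proof. by move=> cf; apply: cont_pos_comp => //; exact: continuous_expR. Qed.

End HalfLineIntegrable.

(** * The real Gamma function *)

Section RealGamma.
Variable R : realType.
Local Notation mu := (@lebesgue_measure R).
Local Notation H0 := (`]0%R, +oo[%classic : set R).
Implicit Types (a b c x y t K B r : R).

(** Euler's integrand [t^(x-1) e^(-t)], written as one exponential. *)
Definition gfun x t : R := expR ((x - 1) * ln t - t).

Lemma cont_pos_gfun x : cont_pos (gfun x).
Proof.
apply: cont_pos_expR; apply: cont_posD.
  by apply: cont_posM; [exact: cont_pos_cst|exact: cont_pos_ln].
by move=> t t0; apply: cvgN; exact: cvg_id.
Qed.

(** The inequality [1 + ln v <= v] at [v = t / (a + 1)] gives [a (ln t - ln (a + 1)) <= t]. *)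
Lemma pow_expRN_le a t : 0 <= a -> 0 < t ->
  expR (a * ln t - t) <= expR (a * ln (a + 1)).
Proof.
move=> a0 t0; rewrite ler_expR.
have a1 : 0 < a + 1 by rewrite ltr_wpDl.
have := expR_ge1Dx (ln (t / (a + 1))).
rewrite lnK ?posrE ?divr_gt0 // ln_div ?posrE // ler_pdivlMr // => h.
have : a * (ln t - ln (a + 1)) <= t.
  have [l0|l0] := lerP 0 (ln t - ln (a + 1)).
    apply: le_trans h; have := mulr_ge0 a0 l0; nra.
  by apply: le_trans (ltW t0); rewrite mulr_ge0_le0 // ltW.
lra.
Qed.

Lemma invr_expR_ln t : 0 < t -> t^-1 = expR (- ln t).
Proof. by move=> t0; rewrite expRN lnK // posrE. Qed.

(** The comparison function [f] is the derivative of [- 1 / (1 + t^x)], a primitive bounded at both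
    ends. Near 0 it behaves like [x t^(x-1)], and its power decay at infinity dominates [e^(-t)]
    times a power. *)
Lemma integrable_gfun x : 0 < x -> mu.-integrable H0 (EFin \o gfun x).
Proof.
move=> x0.
pose p t := expR (x * ln t).
pose F t := - (1 + p t)^-1.
pose f t := x / t * p t / (1 + p t) ^+ 2.
have p0 t : 0 < p t by exact: expR_gt0.
have p1 t : 0 < 1 + p t by rewrite addr_gt0.
have dp t : 0 < t -> is_derive t 1 p (x / t * p t) by exact: is_derive_pow.
have dF t : 0 < t -> is_derive t 1 F (f t).
  move=> t0; have d1 := dp _ t0.
  have d2 : is_derive t 1 (fun t => 1 + p t) (x / t * p t).
    have h := is_deriveD (is_derive_cst (1 : R) t 1) d1.
    by apply: (is_derive_eq h); rewrite add0r.
  have n0 : 1 + p t != 0 by rewrite gt_eqF.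
  have h := is_deriveN (@is_deriveV R (fun t => 1 + p t) t _ 1 n0 d2).
  apply: (is_derive_eq h); rewrite /f /GRing.scale /=; field.
  by rewrite !gt_eqF.
have cp : cont_pos p by apply: cont_pos_derivable dp.
have ci : cont_pos (@GRing.inv R).
  by move=> t t0; apply: inv_continuous; rewrite gt_eqF.
have cf : cont_pos f.
  apply: cont_posM; first by apply: cont_posM => //; apply: cont_posM => //;
    exact: cont_pos_cst.
  move=> t t0; apply: (@continuous_comp _ _ _ (fun t => (1 + p t) ^+ 2) (@GRing.inv R)).
    apply: (@continuous_comp _ _ _ (fun t => 1 + p t) (fun y => y ^+ 2)).
      by apply: cont_posD => //; exact: cont_pos_cst.
    exact: exprn_continuous.
  by apply: ci; rewrite exprn_gt0.
have f0 t : 0 < t -> 0 <= f t.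
  by move=> t0; rewrite /f !mulr_ge0 ?invr_ge0 ?exprn_ge0 ?ltW.
have If : mu.-integrable H0 (EFin \o f).
  apply: (@integrable_pos_bound _ f 1 cf f0) => n.
  have := @FTC2_pos _ f F n.+1%:R^-1 n.+1%:R.
  case: n => [|n].
    by rewrite invr1 => _; rewrite set_itv1 integral_set1 // lee_fin.
  rewrite invr_gt0 => -> //; last first.
    by apply: (@lt_trans _ _ 1); rewrite ?invf_lt1 // ltr1n.
  rewrite lee_fin /F opprK; apply: (@le_trans _ _ (0 + 1)); last by rewrite add0r.
  apply: lerD; first by rewrite oppr_le0 invr_ge0 ltW.
  by rewrite invf_le1 // lerDl ltW.
(* [K] bounds [t^(2x) e^(-t)]; together with [(1 + p)^2 <= 2 + 2 p^2] and [e^(-t) <= 1] this gives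
   the constant [C]. *)
pose K := expR (x * 2 * ln (x * 2 + 1)).
have K0 : 0 < K by exact: expR_gt0.
pose C := (2 + 2 * K) / x.
apply: (@cont_pos_integrableS _ _ (fun t => C * f t)) => //.
- exact: cont_pos_gfun.
- move=> t; rewrite /= in_itv /= andbT => t0.
  rewrite ger0_norm ?expR_ge0 //.
  have -> : gfun x t = (p t / t) * expR (- t).
    by rewrite /gfun /p (invr_expR_ln t0) -!expRD; congr expR; ring.
  have -> : C * f t = (p t / t) * ((2 + 2 * K) / (1 + p t) ^+ 2).
    by rewrite /C /f; field; rewrite !gt_eqF.
  have pt0 : 0 <= p t / t by rewrite divr_ge0 // ltW.
  rewrite ler_wpM2l // ler_pdivlMr ?exprn_gt0 //.
  have e1 : expR (- t) <= 1 by rewrite -expR0 ler_expR oppr_le0 ltW.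
  have e2 : expR (- t) * p t ^+ 2 <= K.
    rewrite /p -expRM_natl -expRD.
    have := @pow_expRN_le (x * 2) t _ t0; rewrite -/K => h.
    apply: le_trans (h _); last by rewrite mulr_ge0 // ltW.
    by rewrite ler_expR; lra.
  have e0 := expR_gt0 (- t).
  have : (1 + p t) ^+ 2 <= 2 + 2 * p t ^+ 2 by have := sqr_ge0 (1 - p t); lra.
  move=> /(ler_wpM2l (ltW e0)); lra.
- exact: integrableZlR.
Qed.

Lemma gfun_expR_norm x r t : 0 < t ->
  gfun x t * expR (r * `|ln t|) <= gfun (x + r) t + gfun (x - r) t.
Proof.
move=> t0; rewrite /gfun -expRD.
have [l0|l0] := lerP 0 (ln t).
  rewrite ger0_norm // [X in expR X <= _](_ : _ = (x + r - 1) * ln t - t); last by ring.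
  by rewrite lerDl expR_ge0.
rewrite ltr0_norm // [X in expR X <= _](_ : _ = (x - r - 1) * ln t - t); last by ring.
by rewrite lerDr expR_ge0.
Qed.

Lemma integrable_gfun_expR x r : 0 <= r < x ->
  mu.-integrable H0 (EFin \o (fun t => gfun x t * expR (r * `|ln t|))).
Proof.
move=> /andP[r0 rx].
apply: (@cont_pos_integrableS _ _ (fun t => gfun (x + r) t + gfun (x - r) t)) => //.
- apply: cont_posM; first exact: cont_pos_gfun.
  apply: cont_pos_expR; apply: cont_posM; first exact: cont_pos_cst.
  by apply: cont_pos_comp; [exact: cont_pos_ln|exact: norm_continuous].
- move=> t; rewrite /= in_itv /= andbT => t0.
  by rewrite ger0_norm ?mulr_ge0 ?expR_ge0 // gfun_expR_norm.
- have h1 := @integrable_gfun (x + r) ltac:(lra).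
  have h2 := @integrable_gfun (x - r) ltac:(lra).
  exact: integrableDR.
Qed.

Definition GammaR x : R := (\int[mu]_(t in H0) gfun x t)%R.

Lemma GammaR_gt0 x : 0 < x -> 0 < GammaR x.
Proof.
move=> x0; pose c := expR (- (`|x - 1| * ln 2 + 2)).
apply: (@Rintegral_gt0 _ _ _ c) => //.
- move=> t; rewrite /= !in_itv /= andbT => /andP[t1 _]; exact: lt_le_trans t1.
- exact: integrable_gfun.
- by move=> t _; exact: expR_ge0.
- exact: expR_gt0.
move=> t /andP[t1 t2]; rewrite /c /gfun ler_expR opprD lerD ?lerN2 //.
have l0 : 0 <= ln t by rewrite ln_ge0.
have l2 : ln t <= ln 2 by rewrite ler_ln ?posrE //; exact: lt_le_trans t1.
rewrite lerNl -mulNr; apply: (@le_trans _ _ (`|x - 1| * ln t)).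
  by rewrite ler_wpM2r // -normrN ler_norm.
by rewrite ler_wpM2l.
Qed.

Lemma cvg_Rintegral_exhaust f : cont_pos f -> (forall t, 0 < t -> 0 <= f t) ->
  mu.-integrable H0 (EFin \o f) ->
  (fun n : nat => \int[mu]_(t in `[(n.+1%:R^-1)%R, n.+1%:R]) f t)%R @ \oo -->
  (\int[mu]_(t in H0) f t)%R.
Proof.
move=> cf f0 If; have h := exhaust0y ltr01 (cont_pos_measurable cf) f0.
apply: fine_cvg; rewrite fineK ?integrable_fin_num //.
by move: h; under eq_fun do rewrite !mul1r.
Qed.

Lemma cvg_pow_inv x : 0 < x -> (fun n : nat => expR (x * ln n.+1%:R^-1)) @ \oo --> (0 : R).
Proof.
move=> x0; apply/cvgrPdist_lt => e e0; near=> n.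
rewrite sub0r normrN ger0_norm ?expR_ge0 //.
rewrite -[ltRHS]lnK ?posrE // ltr_expR lnV ?posrE // mulrN ltrNl.
rewrite mulrC -ltr_pdivrMr // -ltr_expR lnK ?posrE //.
apply: (@lt_trans _ _ n%:R); last by rewrite ltr_nat.
near: n; exact: nbhs_infty_gtr.
Unshelve. all: by end_near. Qed.

(** Integration by parts on [[1 / (n + 1), n + 1]]: the boundary function [F = - t^x e^(-t)] tends
    to 0 at both ends. *)
Lemma GammaRS x : 0 < x -> GammaR (x + 1) = x * GammaR x.
Proof.
move=> x0; have x10 : 0 < x + 1 by rewrite addr_gt0.
pose F t := - expR (x * ln t) * expR (- t).
pose f t := gfun (x + 1) t - x * gfun x t.
have fE t : 0 < t -> gfun x t = expR (x * ln t) / t * expR (- t).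
  by move=> t0; rewrite /gfun (invr_expR_ln t0) -!expRD; congr expR; ring.
have fE1 t : gfun (x + 1) t = expR (x * ln t) * expR (- t).
  by rewrite /gfun -!expRD; congr expR; ring.
have dF t : 0 < t -> is_derive t 1 F (f t).
  move=> t0; have d1 := is_derive_pow x t0.
  have d2 : is_derive t 1 (fun t => expR (- t)) (- expR (- t)).
    have d0 : is_derive t 1 (fun t : R => - t) (- 1) by apply: is_derive_eq.
    have h := @is_derive1_comp R expR _ t _ _ (is_derive_expR _) d0.
    by apply: (is_derive_eq h); rewrite mulrN mulr1.
  apply: is_derive_eq; rewrite /f fE // fE1 /GRing.scale /=; field.
  by rewrite gt_eqF.
have cf : cont_pos f.
  move=> t t0; apply: cvgB; first exact: cont_pos_gfun.
  by apply: cvgMr; exact: cont_pos_gfun.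
have h1 := cvg_Rintegral_exhaust (@cont_pos_gfun (x + 1)) (fun t _ => expR_ge0 _)
  (integrable_gfun x10).
have h2 := cvg_Rintegral_exhaust (@cont_pos_gfun x) (fun t _ => expR_ge0 _)
  (integrable_gfun x0).
have h3 : (fun n : nat => F n.+1%:R - F n.+1%:R^-1) @ \oo --> (0 : R).
  rewrite -[0]subr0; apply: cvgB.
  - rewrite -oppr0.
    rewrite (_ : (fun n : nat => F n.+1%:R) =
      (fun n : nat => - (expR (x * ln n.+1%:R) * expR (- n.+1%:R)))); last first.
      by apply/funext => n; rewrite /F mulNr.
    apply: cvgN; pose K := expR ((x + 1) * ln (x + 1 + 1)).
    apply: (@squeeze_cvgr _ _ _ R (fun=> 0) (fun n : nat => K * expR (1 * ln n.+1%:R^-1))).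
    + near=> n; rewrite mulr_ge0 ?expR_ge0 //= mul1r lnV ?posrE // -ler_pdivrMr ?expR_gt0 //.
      rewrite -expRN opprK -!expRD.
      apply: le_trans (@pow_expRN_le (x + 1) n.+1%:R (ltW x10) _) => //.
      by rewrite ler_expR; lra.
    + exact: cvg_cst.
    + by rewrite -[X in _ --> X](mulr0 K); apply: cvgMr; exact: cvg_pow_inv.
  - apply/cvgrPdist_lt => e e0; near=> n.
    rewrite sub0r normrN /F mulNr normrN ger0_norm ?mulr_ge0 ?expR_ge0 //.
    apply: (@le_lt_trans _ _ (expR (x * ln n.+1%:R^-1))).
      rewrite ler_piMr ?expR_ge0 // -expR0 ler_expR oppr_le0 invr_ge0 //.
    have : `|0 - expR (x * ln n.+1%:R^-1)| < e.
      by near: n; move/cvgrPdist_lt: (cvg_pow_inv x0); apply.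
    by rewrite sub0r normrN ger0_norm ?expR_ge0.
have h4 : (fun n : nat =>
    \int[mu]_(t in `[(n.+1%:R^-1)%R, n.+1%:R]) gfun (x + 1) t -
    x * \int[mu]_(t in `[(n.+1%:R^-1)%R, n.+1%:R]) gfun x t)%R @ \oo -->
    GammaR (x + 1) - x * GammaR x.
  by apply: cvgB => //; apply: cvgMr.
apply/eqP; rewrite -subr_eq0; apply/eqP.
apply: (cvg_unique _ h4) => //.
apply: cvg_trans h3; apply: near_eq_cvg; exists 1%N => // -[//|n] _.
have n0 : 0 < n.+2%:R^-1 :> R by rewrite invr_gt0.
rewrite -RintegralZl //; last exact: cont_pos_integrable (@cont_pos_gfun _).
rewrite -RintegralB //.
- rewrite /Rintegral (FTC2_pos (F := F)) //.
  by apply: (@lt_trans _ _ 1); rewrite ?invf_lt1 // ltr1n.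
- exact: cont_pos_integrable (@cont_pos_gfun _).
- apply: integrableZlR => //; exact: cont_pos_integrable (@cont_pos_gfun _).
Unshelve. all: by end_near. Qed.

End RealGamma.

(** * Analyticity of exponential integrals *)

Section AnalyticIntegral.
Context d (T : measurableType d) (R : realType).
Variables (mu : {measure set T -> \bar R}) (D : set T).
Local Notation C := R[i].

(** The expansion at 0 is moved to [s] by absorbing [e^(s L)] into the weight. *)
Lemma analytic_exp_integral (g : T -> C) (L : T -> R) (s : C) (r : R) :
  measurable D -> cmeas D g -> measurable_fun D L -> 0 < r ->
  mu.-integrable D
    (EFin \o (fun t => normc (g t * cexp (s * (L t)%:C)) * expR (r * `|L t|))) ->
  analytic_at (fun z => cint mu D (fun t => g t * cexp (z * (L t)%:C))) s.
Proof.
move=> mD mg mL r0 gI.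
pose g' t := g t * cexp (s * (L t)%:C).
have mg' : cmeas D g'.
  apply: cmeasM => //; apply: cmeas_cexp; apply: cmeasM; first exact: cmeas_cst.
  exact: cmeasR.
exists (exp_moment mu D g' L); apply/nbhsCP; exists r => // z zs.
have [] := psum_exp_moment mD mg' mL gI r0 (ltW zs).
rewrite (@eq_cint _ _ _ mu D _ (fun t => g t * cexp (z * (L t)%:C))) // => t _.
by rewrite /g' -mulrA -cexpD -mulrDl subrKC.
Qed.

End AnalyticIntegral.

Section HalfPlane.
Variable R : realType.
Local Notation C := R[i].
Local Notation Re := complex.Re.
Local Notation Im := complex.Im.

Lemma analytic_id (s : C) : analytic_at (fun z => z) s.
Proof.
have := @analytic_affine R 1 0 s.
by rewrite (_ : (fun z => 1 * z + 0) = id) //; apply/funext => z; rewrite mul1r addr0.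
Qed.

Lemma analytic_shift (f : C -> C) (d s : C) : analytic_at f (s + d) ->
  analytic_at (fun z => f (z + d)) s.
Proof.
move=> h; have := @analytic_comp_affine R f 1 d s; rewrite mul1r => /(_ h).
rewrite (_ : (fun z => f (1 * z + d)) = (fun z => f (z + d))) //.
by apply/funext => z; rewrite mul1r.
Qed.

(** Agreement on a real ray accumulates at [x0], and by convexity the segment from [x0] to any point
    stays in the half-plane. This transfers identities of real integrals and series to complex
    arguments. *)
Lemma analytic_eq_halfplane (f g : C -> C) (c x0 : R) : c < x0 ->
  (forall s, c < Re s -> analytic_at f s) ->
  (forall s, c < Re s -> analytic_at g s) ->
  (forall x, x0 <= x -> f x%:C = g x%:C) ->
  forall s, c < Re s -> f s = g s.
Proof.
move=> cx fa ga fg s cs.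
have near0 : \forall z \near x0%:C, f z = g z.
  apply: analytic_eq_near; [exact: fa|exact: ga|] => e e0.
  have e2 : 0 < e / 2 by rewrite divr_gt0.
  have d : (x0 + e / 2)%:C - x0%:C = (e / 2)%:C by rewrite -rmorphB addrAC subrr add0r.
  exists (x0 + e / 2)%:C; split.
  - by rewrite -subr_eq0 d -normc_eq0 normcR normr_eq0 gt_eqF.
  - rewrite d normcR gtr0_norm //.
    by rewrite ltr_pdivrMr // ltr_pMr // ltr1n.
  - by apply: fg; rewrite lerDl divr_ge0 // ltW.
have /nbhsCP[r r0] : \forall z \near s, f z = g z.
  apply: (analytic_eq_segment _ near0) => t /andP[t0 t1].
  suff h : c < Re (x0%:C + t%:C * (s - x0%:C)) by split; [exact: fa|exact: ga].
  rewrite ReD Re_real_mul ReD ReN /=.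
  have -> : x0 + t * (Re s - x0) = (1 - t) * x0 + t * Re s by ring.
  have [->|tn0] := eqVneq t 0; first by rewrite subr0 mul1r mul0r addr0.
  have tp : 0 < t by rewrite lt_def tn0.
  have t1' : 0 <= 1 - t by rewrite subr_ge0.
  have -> : c = (1 - t) * c + t * c by ring.
  by apply: ler_ltD; [rewrite ler_wpM2l // ltW|rewrite ltr_pM2l].
by apply; rewrite subrr normc0.
Qed.

End HalfPlane.

(** * Euler's integral on the right half-plane *)

Section ComplexGamma.
Variable R : realType.
Local Notation mu := (@lebesgue_measure R).
Local Notation H0 := (`]0%R, +oo[%classic : set R).
Local Notation C := R[i].
Local Notation Re := complex.Re.
Local Notation Im := complex.Im.
Implicit Types (s z : C) (x y t : R).

Definition gamma_weight t : C := (expR (- ln t - t))%:C.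

Lemma normc_gamma_integrand s t :
  normc (gamma_weight t * cexp (s * (ln t)%:C)) = gfun (Re s) t.
Proof.
rewrite normcM normcR ger0_norm ?expR_ge0 // normc_cexp [s * _]mulrC Re_real_mul.
by rewrite -expRD /gfun; congr expR; ring.
Qed.

Lemma Gamma_eulerE s : Gamma_euler s =
  cint mu H0 (fun t => gamma_weight t * cexp (s * (ln t)%:C)).
Proof.
apply: eq_cint => t; rewrite /= in_itv /= andbT => t0.
rewrite /cpow /gamma_weight -!cexpR -!cexpD; congr cexp.
by rewrite rmorphB rmorphN /= rmorphN /=; ring.
Qed.

Lemma measurable_ln0 : measurable_fun H0 (@ln R).
Proof. exact: cont_pos_measurable (@cont_pos_ln R). Qed.

Lemma cmeas_gamma_weight : cmeas H0 gamma_weight.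
Proof.
apply: cmeasR; apply: cont_pos_measurable; apply: cont_pos_expR.
apply: cont_posD => t t0; apply: cvgN; [exact: cont_pos_ln|exact: cvg_id].
Qed.

Lemma Gamma_euler_analytic s : 0 < Re s -> analytic_at (@Gamma_euler R) s.
Proof.
move=> s0; have -> : @Gamma_euler R = fun s =>
    cint mu H0 (fun t => gamma_weight t * cexp (s * (ln t)%:C)).
  by apply/funext => z; exact: Gamma_eulerE.
have r0 : 0 < Re s / 2 by rewrite divr_gt0.
apply: (analytic_exp_integral _ _ _ r0) => //.
- exact: cmeas_gamma_weight.
- exact: measurable_ln0.
under [X in EFin \o X]eq_fun do rewrite normc_gamma_integrand.
by apply: integrable_gfun_expR; apply/andP; split; lra.
Qed.

Lemma Gamma_euler_real x : Gamma_euler x%:C = (GammaR x)%:C.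
Proof.
rewrite Gamma_eulerE.
have e t : gamma_weight t * cexp (x%:C * (ln t)%:C) = (gfun x t)%:C.
  rewrite -realCM cexpR -realCM -expRD /gfun; congr ((expR _)%:C); ring.
rewrite /cint; under eq_Rintegral do rewrite e.
rewrite [X in _ +i* X](_ : _ = 0) //.
rewrite (@eq_Rintegral _ _ _ mu _ (fun=> 0)) ?Rintegral_cst ?mul0r // => t _.
by rewrite e.
Qed.

Lemma Gamma_eulerS s : 0 < Re s -> Gamma_euler (s + 1) = s * Gamma_euler s.
Proof.
apply: (@analytic_eq_halfplane R (fun s => Gamma_euler (s + 1))
  (fun s => s * Gamma_euler s) 0 1) => // {}s.
- move=> s0.
  by apply: analytic_shift; apply: Gamma_euler_analytic; rewrite ReD addr_gt0.
- move=> s0; apply: analyticM; [exact: analytic_id|exact: Gamma_euler_analytic].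
- move=> x1; have x0 : 0 < s by apply: lt_le_trans x1.
  by rewrite -[1]/(1%:C) -rmorphD !Gamma_euler_real GammaRS // realCM.
Qed.

(* If [Gamma (x + iy) = 0], the average of [cos (y (ln t - ln x))] against
   [t^(x-1) e^-t] vanishes, but [(ln (t / x))^2 <= t/x - 2 + x/t] has average
   [1 / (x - 1)]. *)
Lemma Gamma_euler_neq0 s : 1 + Im s ^+ 2 < Re s -> Gamma_euler s != 0.
Proof.
case: s => x y /= yx; apply/eqP => G0.
have x1 : 1 < x by apply: le_lt_trans yx; rewrite lerDl sqr_ge0.
have x0 : 0 < x by apply: lt_trans x1.
have y2 : 0 <= y ^+ 2 by exact: sqr_ge0.
have Ig v : 0 < v -> mu.-integrable H0 (EFin \o gfun v) by exact: integrable_gfun.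
have e t : gamma_weight t * cexp ((x +i* y) * (ln t)%:C) =
    (gfun x t)%:C * (cos (y * ln t) +i* sin (y * ln t)).
  have -> : (x +i* y) * (ln t)%:C = (x * ln t) +i* (y * ln t) by simpc.
  rewrite /cexp [complex.Re _]/= [complex.Im _]/= mulrA -realCM -expRD /gfun.
  by congr ((expR _)%:C * _); ring.
have cfun (h : R -> R) : continuous h -> (forall u, `|h u| <= 1) -> forall b,
    mu.-integrable H0 (EFin \o (fun t => gfun x t * h (y * ln t + b))).
  move=> ch h1 b; apply: (@cont_pos_integrableS _ _ (gfun x)) => //.
  - apply: cont_posM; first exact: cont_pos_gfun.
    apply: cont_pos_comp => //; apply: cont_posD; last exact: cont_pos_cst.
    by apply: cont_posM; [exact: cont_pos_cst|exact: cont_pos_ln].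
  - move=> t _; rewrite normrM ger0_norm ?expR_ge0 // ler_piMr ?expR_ge0 //.
  - exact: Ig.
have Ic := cfun _ (@continuous_cos R) (@cos_max R).
have Is := cfun _ (@continuous_sin R) (@sin_max R).
have [Gc Gs] : (\int[mu]_(t in H0) (gfun x t * cos (y * ln t + 0)) = 0 /\
                \int[mu]_(t in H0) (gfun x t * sin (y * ln t + 0)) = 0)%R.
  rewrite Gamma_eulerE in G0; have hc := congr1 (@Re R) G0; have hs := congr1 (@Im R) G0.
  split.
    transitivity (Re (0 : C)) => //; rewrite -hc; apply: eq_Rintegral => t _.
    by rewrite e addr0 Re_real_mul.
  transitivity (Im (0 : C)) => //; rewrite -hs; apply: eq_Rintegral => t _.
  by rewrite e addr0 Im_real_mul.
pose b := y * ln x.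
have Gb : (\int[mu]_(t in H0) (gfun x t * cos (y * ln t + - b)) = 0)%R.
  rewrite (@eq_Rintegral _ _ _ mu _ (fun t =>
    cos b * (gfun x t * cos (y * ln t + 0)) +
    sin b * (gfun x t * sin (y * ln t + 0)))); last first.
    by move=> t _; rewrite cosB !addr0; ring.
  rewrite RintegralD //; [|exact: integrableZlR|exact: integrableZlR].
  by rewrite !RintegralZl // Gc Gs !mulr0 addr0.
pose k := y ^+ 2 / 2.
have k0 : 0 <= k by rewrite divr_ge0.
have xm1 : 0 < x - 1 by rewrite subr_gt0.
have xp1 : 0 < x + 1 by rewrite addr_gt0.
pose h t := (1 + 2 * k) * gfun x t + ((- k / x) * gfun (x + 1) t +
   (- k * x) * gfun (x - 1) t).
have IZ c v : 0 < v -> mu.-integrable H0 (EFin \o (fun t => c * gfun v t)).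
  by move=> v0; apply: integrableZlR => //; exact: Ig.
have Ih1 := IZ (1 + 2 * k) _ x0.
have Ih2 := IZ (- k / x) _ xp1.
have Ih3 := IZ (- k * x) _ xm1.
have Ih23 : mu.-integrable H0 (EFin \o (fun t => (- k / x) * gfun (x + 1) t +
    (- k * x) * gfun (x - 1) t)) by exact: integrableDR.
have Ih : mu.-integrable H0 (EFin \o h) by exact: integrableDR.
have hle t : H0 t -> h t <= gfun x t * cos (y * ln t + - b).
  rewrite /= in_itv /= andbT => t0.
  have g1 : gfun (x + 1) t = gfun x t * t.
    transitivity (gfun x t * expR (ln t)); last by rewrite lnK.
    by rewrite /gfun -expRD; congr expR; ring.
  have g2 : gfun (x - 1) t = gfun x t * t^-1.
    by rewrite /gfun (invr_expR_ln t0) -expRD; congr expR; ring.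
  have -> : h t = gfun x t * (1 - k * (t / x - 2 + (t / x)^-1)).
    by rewrite /h g1 g2; field; rewrite !gt_eqF.
  rewrite ler_wpM2l ?expR_ge0 //.
  apply: le_trans (cos_ge_1Bsqr _).
  have -> : y * ln t + - b = y * ln (t / x).
    by rewrite ln_div ?posrE // /b; ring.
  rewrite exprMn lerD2l lerN2 mulrAC -/k ler_wpM2l //.
  by apply: sqr_ln_le; rewrite divr_gt0.
have : (\int[mu]_(t in H0) h t <= 0)%R.
  by rewrite -[leRHS]Gb; apply: le_Rintegral => //; exact: Ic.
rewrite /h RintegralD // RintegralD // !RintegralZl //;
  [|exact: Ig|exact: Ig|exact: Ig].
rewrite -!/(GammaR _) GammaRS //.
have GE : GammaR x = (x - 1) * GammaR (x - 1).
  by rewrite -(GammaRS xm1) subrK.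
have G1 := GammaR_gt0 xm1.
rewrite leNgt => /negP[].
(* By the recurrence the integral of [h] is [GammaR (x - 1) * (x - 1 - y^2 / 2)], which is positive
   since [y^2 < x - 1]. *)
rewrite GE [ltRHS](_ : _ = GammaR (x - 1) * (x - 1 - k)); last first.
  by field; rewrite gt_eqF.
by rewrite mulr_gt0 // /k; lra.
Qed.

End ComplexGamma.

(** * The entire function 1 / Gamma *)

Section ReciprocalGamma.
Variable R : realType.
Local Notation C := R[i].
Local Notation Re := complex.Re.
Local Notation Im := complex.Im.
Implicit Types (s z : C) (x y t : R) (n m : nat).

(** The rising factorial. *)
Definition gprod n s : C := \prod_(k < n) (s + k%:R).

Definition rGamma_shift n s : C := gprod n s / Gamma_euler (s + n%:R).

(** The parabolic region in which [Gamma_euler (s + n)] is known to be nonzero; it is open,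
    increases with [n] and exhausts the plane. *)
Definition far_right n s := 1 + Im s ^+ 2 < Re s + n%:R.

Lemma ReDn s n : Re (s + n%:R) = Re s + n%:R.
Proof. by rewrite natC ReD. Qed.

Lemma ImDn s n : Im (s + n%:R) = Im s.
Proof. by rewrite natC ImD /= addr0. Qed.

Lemma far_right_neq0 n s : far_right n s -> Gamma_euler (s + n%:R) != 0.
Proof. by move=> h; apply: Gamma_euler_neq0; rewrite ReDn ImDn. Qed.

Lemma far_right_gt0 n s : far_right n s -> 0 < Re (s + n%:R).
Proof.
rewrite ReDn /far_right; apply: le_lt_trans.
by rewrite addr_ge0 ?sqr_ge0.
Qed.

Lemma far_right_le n m s : (n <= m)%N -> far_right n s -> far_right m s.
Proof.
by move=> nm h; apply: (lt_le_trans h); rewrite lerD2l ler_nat.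
Qed.

Lemma rGamma_shiftS n s : far_right n s ->
  rGamma_shift n.+1 s = rGamma_shift n s.
Proof.
move=> h; have p0 := far_right_gt0 h.
have sn0 : s + n%:R != 0 by apply: contraTneq p0 => ->; rewrite ltxx.
rewrite /rGamma_shift /gprod big_ord_recr /= -natr1 addrA Gamma_eulerS //.
by rewrite invfM mulrA mulfK.
Qed.

Lemma rGamma_shift_le n m s : (n <= m)%N -> far_right n s ->
  rGamma_shift m s = rGamma_shift n s.
Proof.
move=> nm h; rewrite -(subnKC nm); elim: (m - n)%N => [|k IH].
  by rewrite addn0.
rewrite addnS rGamma_shiftS // ; apply: far_right_le h; exact: leq_addr.
Qed.

(** The shift depends on [s] and is large enough for [far_right]; by the recurrence every other
    admissible shift gives the same value. *)
Definition rGamma s : C :=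
  rGamma_shift (Num.truncn `|1 + Im s ^+ 2 - Re s|).+1 s.

Lemma rGammaE n s : far_right n s -> rGamma s = rGamma_shift n s.
Proof.
move=> h; rewrite /rGamma; set m := (Num.truncn _).+1.
have hm : far_right m s.
  rewrite /far_right -ltrBlDl; apply: le_lt_trans (ler_norm _) _.
  by rewrite truncnS_gt.
have [nm|/ltnW mn] := leqP n m; first exact: rGamma_shift_le.
by apply/esym; exact: rGamma_shift_le.
Qed.

Lemma gprod_analytic n s : analytic_at (gprod n) s.
Proof.
rewrite /gprod; elim: n => [|n IH].
  rewrite (_ : (fun s => _) = fun=> 1); first exact: analytic_cst.
  by apply/funext => z; rewrite big_ord0.
rewrite (_ : (fun s => _) = fun z => gprod n z * (z + n%:R)).
  exact: (analyticM IH (analyticD (analytic_id s) (analytic_cst n%:R s))).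
by apply/funext => z; rewrite /gprod big_ord_recr.
Qed.

Lemma rGamma_shift_analytic n s : far_right n s -> analytic_at (rGamma_shift n) s.
Proof.
move=> h; apply: analyticM; first exact: gprod_analytic.
apply: analyticV; last exact: far_right_neq0.
by apply: analytic_shift; apply: Gamma_euler_analytic; exact: far_right_gt0.
Qed.

Lemma far_right_near n s : far_right n s -> \forall z \near s, far_right n z.
Proof.
rewrite /far_right => h; apply/nbhsCP.
(* A displacement [d < 1] raises [Im ^ 2] by at most [d (2 |Im s| + 1)] and lowers [Re] by at most
   [d], which the numerator of [e] leaves room for. *)
pose e := (Re s + n%:R - (1 + Im s ^+ 2)) / (2 * (2 * `|Im s| + 3)).
have e0 : 0 < 2 * (2 * `|Im s| + 3) by rewrite mulr_gt0 // ltr_wpDl // mulr_ge0.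
exists (Num.min 1 e); first by rewrite lt_min ltr01 divr_gt0 // subr_gt0.
move=> z; rewrite lt_min => /andP[z1 ze].
have hr : `|Re z - Re s| <= normc (z - s) by rewrite -ReN -ReD ler_Re.
have hi : `|Im z - Im s| <= normc (z - s) by rewrite -ImN -ImD ler_Im.
set d := normc (z - s) in z1 ze hr hi.
rewrite ltr_pdivlMr // in ze.
have n0 : 0 <= `|Im s| by [].
have h1 : Im z ^+ 2 <= Im s ^+ 2 + d * (2 * `|Im s| + 1).
  have -> : Im z = Im s + (Im z - Im s) by rewrite subrKC.
  rewrite sqrrD -addrA lerD2l.
  have : Im s * (Im z - Im s) <= `|Im s| * d.
    by apply: le_trans (ler_norm _) _; rewrite normrM ler_wpM2l.
  have : (Im z - Im s) ^+ 2 <= d.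
    rewrite -real_normK ?num_real // expr2.
    apply: le_trans (_ : `|Im z - Im s| * 1 <= _); last by rewrite mulr1.
    by rewrite ler_wpM2l // (le_trans hi) // ltW.
  by lra.
have h2 : Re s - d <= Re z.
  by rewrite lerBlDr -lerBlDl -opprB; apply: le_trans hr; rewrite -normrN ler_norm.
have d0 : 0 <= d by exact: normc_ge0.
nra.
Qed.

(** Near [s] one fixed shift serves for all points, so [rGamma] is locally a polynomial divided by a
    nonvanishing analytic function. *)
Lemma rGamma_analytic s : analytic_at rGamma s.
Proof.
pose n := (Num.truncn `|1 + Im s ^+ 2 - Re s|).+1.
have h : far_right n s.
  rewrite /far_right -ltrBlDl; apply: le_lt_trans (ler_norm _) _.
  by rewrite truncnS_gt.
apply: (analytic_near (rGamma_shift_analytic h)).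
have := far_right_near h.
by apply: (@filterS _ _ (nbhs_filter s)) => z /rGammaE ->.
Qed.

Lemma Gamma_euler_shift n s : 0 < Re s ->
  Gamma_euler (s + n%:R) = gprod n s * Gamma_euler s.
Proof.
move=> s0; elim: n => [|n IH]; first by rewrite addr0 /gprod big_ord0 mul1r.
rewrite -natr1 addrA Gamma_eulerS; last by rewrite ReDn ltr_wpDr.
by rewrite IH /gprod big_ord_recr /=; ring.
Qed.

Lemma Gamma_euler_rGamma s : 0 < Re s -> Gamma_euler s * rGamma s = 1.
Proof.
move=> s0; pose n := (Num.truncn `|1 + Im s ^+ 2 - Re s|).+1.
have h : far_right n s.
  rewrite /far_right -ltrBlDl; apply: le_lt_trans (ler_norm _) _.
  by rewrite truncnS_gt.
rewrite (rGammaE h) /rGamma_shift mulrA [_ * gprod n s]mulrC.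
by rewrite -Gamma_euler_shift // divff // far_right_neq0.
Qed.

End ReciprocalGamma.

(** * The Dirichlet series as an integral over the counting measure *)

Section Dirichlet.
Variable R : realType.
Local Notation C := R[i].
Local Notation Re := complex.Re.
Local Notation Im := complex.Im.
Implicit Types (s z : C) (x y t a : R) (n m : nat).

Lemma summable_count (u b : nat -> R) : (forall n, `|u n| <= b n) ->
  cvgn (series b) -> summable setT (EFin \o u).
Proof.
move=> ub bc; rewrite /summable -nneseries_esumT; last by move=> n; rewrite /= lee_fin.
have vc : cvgn (series (fun n => `|u n|)).
  apply: (series_le_cvg _ _ ub bc) => // n; exact: le_trans (ub n).
have -> : (\sum_(k <oo) `|(EFin \o u) k|)%E = (limn (series (fun n => `|u n|)))%:E.
  rewrite -EFin_lim //; congr (limn _); apply/funext => n /=.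
  by rewrite /series /= sumEFin.
by rewrite ltry.
Qed.

Lemma cvg_series_Rintegral_count (u b : nat -> R) : (forall n, `|u n| <= b n) ->
  cvgn (series b) ->
  series u @ \oo --> (\int[counting]_t u t)%R.
Proof.
move=> ub bc; have su := summable_count ub bc.
have uc : cvgn (series u).
  apply: (@normed_cvg _ R); apply: (series_le_cvg _ _ ub bc) => // n.
  exact: le_trans (ub n).
suff -> : (\int[counting]_t u t)%R = limn (series u) by [].
rewrite /Rintegral integral_count //.
have -> : (\sum_(k <oo) (u k)%:E)%E = (limn (series u))%:E.
  rewrite -EFin_lim //; congr (limn _); apply/funext => n /=.
  by rewrite /series /= sumEFin.
by [].
Qed.

Lemma integrable_count (b : nat -> R) : (forall n, 0 <= b n) -> cvgn (series b) ->
  (@counting _ R).-integrable setT (EFin \o b).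
Proof.
move=> b0 bc; apply/integrableP; split => //.
rewrite ge0_integral_count => [|k]; last by rewrite /= lee_fin.
have -> : (\sum_(k <oo) `|(EFin \o b) k|)%E = (limn (series b))%:E.
  rewrite -EFin_lim //; congr (limn _); apply/funext => n /=.
  by rewrite /series /= sumEFin; congr EFin; apply: eq_bigr => i _; rewrite ger0_norm.
by rewrite ltry.
Qed.

(* [n^-a - (n+1)^-a >= a (n+1)^(-a-1)], which telescopes. *)
Lemma cvg_series_pow x : 1 < x -> cvgn (series (fun n => expR (- x * ln n.+1%:R) : R)).
Proof.
move=> x1; pose a := x - 1.
have a0 : 0 < a by rewrite subr_gt0.
have x0 : 0 < x by apply: lt_trans x1.
pose p n := expR (- a * ln n.+1%:R) : R.
have key n : a * expR (- x * ln n.+2%:R) <= p n - p n.+1.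
  have n1 : 0 < n.+1%:R :> R by [].
  have n2 : 0 < n.+2%:R :> R by [].
  have -> : expR (- x * ln n.+2%:R) = p n.+1 * n.+2%:R^-1.
    by rewrite (invr_expR_ln n2) /p -expRD; congr expR; rewrite /a; ring.
  suff h : p n.+1 * (1 + a * n.+2%:R^-1) <= p n.
    by rewrite lerBrDl; apply: le_trans h; rewrite mulrDr mulr1 lerD2l mulrCA.
  have -> : p n = p n.+1 * expR (a * (ln n.+2%:R - ln n.+1%:R)).
    by rewrite /p -expRD; congr expR; ring.
  rewrite ler_wpM2l ?expR_ge0 //; apply: le_trans (expR_ge1Dx _).
  rewrite lerD2l ler_wpM2l ?(ltW a0) //.
  have e : n.+1%:R / n.+2%:R = 1 - n.+2%:R^-1 :> R.
    rewrite (_ : n.+1%:R = n.+2%:R - 1); last by rewrite -[n.+2%:R]natr1 addrK.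
    by rewrite mulrBl divff ?gt_eqF // mul1r.
  have := expR_ge1Dx (ln (n.+1%:R / n.+2%:R : R)).
  rewrite lnK ?posrE ?divr_gt0 // ln_div ?posrE // e.
  move: (n.+2%:R^-1) => v; lra.
apply: nondecreasing_is_cvgn.
  by apply: nondecreasing_series => n _ _; exact: expR_ge0.
exists (1 + a^-1) => _ [n _ <-]; rewrite /series /=.
case: n => [|n]; first by rewrite big_nil addr_ge0 // invr_ge0 ltW.
rewrite big_nat_recl // ln1 mulr0 expR0 lerD2l.
rewrite -[leRHS]mul1r ler_pdivlMr //.
rewrite mulrC mulr_sumr big_mkord.
have H m : \sum_(i < m) a * expR (- x * ln i.+2%:R) <= p 0%N - p m.
  elim: m => [|m IH]; first by rewrite big_ord0 subrr.
  by rewrite big_ord_recr /=; have := key m; lra.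
apply: le_trans (H n) _.
by rewrite /p ln1 mulr0 expR0 gerBl expR_ge0.
Qed.

Lemma cint_count_term s n :
  (fun=> 1 : C) n * cexp (s * (- ln n.+1%:R)%:C) = cpow n.+1%:R (- s).
Proof. by rewrite mul1r /cpow rmorphN mulrN mulNr. Qed.

Lemma normc_cpow s x : normc (cpow x s) = expR (Re s * ln x).
Proof. by rewrite /cpow normc_cexp mulrC Re_real_mul mulrC. Qed.

(** The series is an exponential integral with [L n = - ln (n + 1)] for the counting measure. The
    radius [r = (Re s - 1) / 2] keeps the dominating exponent [Re s - r] above 1. *)
Lemma Dirichlet_analytic :
  exists D : C -> C, (forall s, 1 < Re s -> analytic_at D s) /\
    (forall s, 1 < Re s -> series (fun n => cpow n.+1%:R (- s)) @ \oo --> D s).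
Proof.
exists (fun s => cint (@counting _ R) setT
  (fun n : nat => (fun=> 1 : C) n * cexp (s * (- ln n.+1%:R)%:C))).
split=> s s1; last first.
  have bd n : normc (cpow n.+1%:R (- s)) <= expR (- Re s * ln n.+1%:R).
    by rewrite normc_cpow ReN.
  have bc := cvg_series_pow s1.
  have hr : forall n, `|Re (cpow n.+1%:R (- s))| <= expR (- Re s * ln n.+1%:R).
    by move=> n; apply: le_trans (ler_Re _) (bd n).
  have hi : forall n, `|Im (cpow n.+1%:R (- s))| <= expR (- Re s * ln n.+1%:R).
    by move=> n; apply: le_trans (ler_Im _) (bd n).
  rewrite (@eq_cint _ _ _ _ _ _ (fun n : nat => cpow n.+1%:R (- s))); last first.
    by move=> n _; exact: cint_count_term.
  apply: cvgC_ReIm; rewrite /cint /=.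
    rewrite (_ : (fun n => _) = series (fun n => Re (cpow n.+1%:R (- s)))).
      exact: cvg_series_Rintegral_count hr bc.
    by apply/funext => n; rewrite /series /= Re_sum.
  rewrite (_ : (fun n => _) = series (fun n => Im (cpow n.+1%:R (- s)))).
    exact: cvg_series_Rintegral_count hi bc.
  by apply/funext => n; rewrite /series /= Im_sum.
pose r := (Re s - 1) / 2.
have r0 : 0 < r by rewrite divr_gt0 // subr_gt0.
have xr : 1 < Re s - r by rewrite /r; lra.
apply: (@analytic_exp_integral _ _ R _ setT (fun=> 1) (fun n => - ln n.+1%:R) s r) => //.
rewrite [X in EFin \o X](_ : _ =
    (fun n : nat => expR (- (Re s - r) * ln n.+1%:R))).
  apply: integrable_count; first by move=> n; exact: expR_ge0.
  exact: cvg_series_pow.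
apply/funext => n; rewrite mul1r normc_cexp mulrC [s * _]mulrC Re_real_mul.
rewrite normrN ger0_norm ?ln_ge0 ?ler1n // -expRD; congr expR; ring.
Qed.

End Dirichlet.

(** * The functional equation of theta *)

Section PolyaIdentity.
Variable R : realType.
Implicit Types (x y : R) (m n k l q r : nat).

Lemma cosX_expand N x : (2 * cos x) ^+ N =
  \sum_(r < N.+1) 'C(N, r)%:R * cos ((N%:R - 2 * r%:R) * x).
Proof.
elim: N => [|N IH].
  by rewrite expr0 big_ord1 bin0 mul1r mulr0 subr0 mul0r cos0.
rewrite exprS IH mulr_sumr.
have e r : 2 * cos x * ('C(N, r)%:R * cos ((N%:R - 2 * r%:R) * x)) =
   'C(N, r)%:R * cos ((N.+1%:R - 2 * r%:R) * x) +
   'C(N, r)%:R * cos ((N.+1%:R - 2 * r.+1%:R) * x).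
  have -> : (N.+1%:R - 2 * r%:R) * x = (N%:R - 2 * r%:R) * x + x.
    by rewrite -natr1; ring.
  have -> : (N.+1%:R - 2 * r.+1%:R) * x = (N%:R - 2 * r%:R) * x - x.
    by rewrite -!natr1; ring.
  by rewrite cosD cosB; ring.
under eq_bigr do rewrite e.
rewrite big_split /= [RHS]big_ord_recl bin0 [X in X + _ = _]big_ord_recl bin0.
rewrite -addrA; congr (_ + _).
under [RHS]eq_bigr do rewrite /bump /= binS natrD mulrDl.
rewrite big_split /=; congr (_ + _).
by rewrite [RHS]big_ord_recr /= bin_small // mul0r addr0.
Qed.

Lemma Dirichlet_kernel q y :
  sin (y / 2) * (1 + 2 * \sum_(k < q) cos (k.+1%:R * y)) = sin (q%:R * y + y / 2).
Proof.
elim: q => [|q IH]; first by rewrite big_ord0 mulr0 addr0 mulr1 mul0r add0r.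
rewrite big_ord_recr /=; set S := \sum_(k < q) _ in IH *.
have -> : sin (y / 2) * (1 + 2 * (S + cos (q.+1%:R * y))) =
  sin (y / 2) * (1 + 2 * S) + 2 * (sin (y / 2) * cos (q.+1%:R * y)) by ring.
rewrite IH.
have -> : q%:R * y + y / 2 = q.+1%:R * y - y / 2 by rewrite -natr1; field.
by rewrite sinB sinD; ring.
Qed.

Lemma sin_natpi n : sin (n%:R * pi) = 0 :> R.
Proof.
elim: n => [|n IH]; first by rewrite mul0r sin0.
by rewrite -natr1 mulrDl mul1r sinDpi IH oppr0.
Qed.

Lemma cos_nat2pi n : cos (n%:R * (2 * pi)) = 1 :> R.
Proof.
rewrite (mulr_natl pi 2); elim: n => [|n IH]; first by rewrite mul0r cos0.
by rewrite -natr1 mulrDl mul1r cosD2pi IH.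
Qed.

(** Orthogonality of characters modulo [l]: as [l = 2 q + 1] is odd, the nonzero residues pair up as
    [k] and [- k], and each pair contributes twice a cosine. Off the multiples of [l], the numerator
    of the Dirichlet kernel is [sin (j pi) = 0] while its denominator does not vanish. *)
Lemma sum_cos_roots q j : let l := q.*2.+1 in
  1 + 2 * \sum_(k < q) cos (2 * j%:R * (pi * k.+1%:R / l%:R)) =
  (l * (l %| j))%:R :> R.
Proof.
move=> l; have l0 : (0 < l)%N by [].
have lR : l%:R != 0 :> R by rewrite pnatr_eq0.
have [/dvdnP[d ->]|lj] := boolP (l %| j)%N.
  rewrite muln1; under eq_bigr => k _.
    have -> : 2 * (d * l)%:R * (pi * k.+1%:R / l%:R) = (d * k.+1)%:R * (2 * pi) :> R.
      by rewrite !natrM; field.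
    rewrite cos_nat2pi; over.
  by rewrite sumr_const card_ord /l -[q.*2.+1%:R]natr1 -mul2n natrM addrC.
rewrite muln0; pose y : R := 2 * (pi * j%:R / l%:R).
have sy : sin (y / 2) != 0.
  have -> : y / 2 = pi * j%:R / l%:R by rewrite /y; field.
  rewrite (divn_eq j l) natrD natrM.
  have -> : pi * ((j %/ l)%:R * l%:R + (j %% l)%:R) / l%:R =
    (j %/ l)%:R * pi + pi * ((j %% l)%:R / l%:R) :> R by field.
  have h : 0 < sin (pi * ((j %% l)%:R / l%:R)) :> R.
    apply: sin_gt0_pi; rewrite pmulr_rgt0 ?pi_gt0 // divr_gt0 ?ltr0n //; last first.
      by rewrite lt0n.
    by rewrite gtr_pMr ?pi_gt0 // ltr_pdivrMr ?ltr0n // mul1r ltr_nat ltn_mod.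
  elim: (j %/ l)%N => [|d IH]; first by rewrite mul0r add0r gt_eqF.
  by rewrite -natr1 mulrDl mul1r addrAC sinDpi oppr_eq0.
apply: (mulfI sy); rewrite mulr0.
under eq_bigr => k _.
  have -> : 2 * j%:R * (pi * k.+1%:R / l%:R) = k.+1%:R * y by rewrite /y; field.
  over.
rewrite Dirichlet_kernel.
have -> : q%:R * y + y / 2 = l%:R * (y / 2).
  by rewrite /l -[q.*2.+1%:R]natr1 -mul2n natrM; field.
have -> : l%:R * (y / 2) = j%:R * pi by rewrite /y; field.
exact: sin_natpi.
Qed.

Lemma sum_multiples (F : nat -> R) l M : (0 < l)%N ->
  \sum_(k < M * l) (l %| k.+1)%:R * F k.+1 = \sum_(j < M) F (j.+1 * l)%N.
Proof.
move=> l0; elim: M => [|M IH]; first by rewrite mul0n !big_ord0.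
rewrite big_ord_recr /= -IH mulSn addnC big_split_ord /=; congr (_ + _).
case: l l0 {IH} => // l _; rewrite big_ord_recr /= big1 => [|k _].
  by rewrite add0r -addnS -mulSnr dvdn_mull // mul1r mulSn addnC.
rewrite -addnS dvdn_addr ?dvdn_mull // gtnNdvd ?mul0r //.
by rewrite ltnS.
Qed.

(** Expanding [(2 cos x)^(2m)] symmetrically about its middle term and summing over the [l] nodes
    keeps only the frequencies divisible by [l]. The left side pairs the nodes [k] and [- k]. *)
Lemma polya_identity q m : let l := q.*2.+1 in
  4 ^+ m * (1 + 2 * \sum_(k < q) cos (pi * k.+1%:R / l%:R) ^+ m.*2) =
  l%:R * ('C(m.*2, m)%:R + 2 * \sum_(j < m) 'C(m.*2, m + j.+1 * l)%:R) :> R.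
Proof.
move=> l; pose x k : R := pi * k.+1%:R / l%:R.
have p4 y : 4 ^+ m * y ^+ m.*2 = (2 * y) ^+ m.*2.
  by rewrite -mul2n !exprM -exprMn; congr (_ ^+ m); ring.
have fold y : (2 * cos y) ^+ m.*2 = 'C(m.*2, m)%:R +
    2 * \sum_(j < m) 'C(m.*2, m + j.+1)%:R * cos (2 * j.+1%:R * y).
  rewrite cosX_expand.
  have -> : m.*2.+1 = (m + m.+1)%N by rewrite addnS addnn.
  rewrite big_split_ord /= big_ord_recl /= addn0.
  have -> : (m.*2%:R - 2 * m%:R) * y = 0 by rewrite -mul2n natrM subrr mul0r.
  rewrite cos0 mulr1 addrCA; congr (_ + _); rewrite mulr_natl mulr2n; congr (_ + _).
    rewrite (reindex_inj rev_ord_inj) /=; apply: eq_bigr => j _.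
    have jm : (j.+1 <= m)%N by exact: ltn_ord.
    rewrite -(bin_sub (n := m.*2)); last by rewrite -addnn; apply: leq_trans (leq_subr _ _) (leq_addr _ _).
    have -> : (m.*2 - (m - j.+1) = m + j.+1)%N by rewrite -addnn; lia.
    congr (_ * cos _); rewrite -mul2n natrM natrB //; ring.
  apply: eq_bigr => j _; rewrite /bump /=; congr (_ * _).
  rewrite -cosN; congr cos; rewrite -mul2n natrM natrD; ring.
rewrite mulrDr mulr1 mulrCA mulr_sumr.
under eq_bigr => k _ do rewrite p4 fold.
(* The contribution of the node 0, expanded like the others. *)
have c0 : 4 ^+ m = 'C(m.*2, m)%:R +
    2 * \sum_(j < m) 'C(m.*2, m + j.+1)%:R :> R.
  have := fold 0; rewrite cos0 mulr1.
  under eq_bigr do rewrite mulr0 cos0 mulr1.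
  by move=> <-; rewrite -mul2n exprM; congr (_ ^+ m); ring.
rewrite c0 big_split /= sumr_const card_ord -mulr_sumr.
rewrite exchange_big /=.
have -> : \sum_(j < m) \sum_(i < q) 'C(m.*2, m + j.+1)%:R * cos (2 * j.+1%:R * x i) =
  \sum_(j < m) 'C(m.*2, m + j.+1)%:R * \sum_(i < q) cos (2 * j.+1%:R * x i).
  by apply: eq_bigr => j _; rewrite mulr_sumr.
set A := 'C(m.*2, m)%:R; set D := fun j : nat => \sum_(i < q) cos (2 * j.+1%:R * x i).
have -> : \sum_(j < m) 'C(m.*2, m + j.+1 * l)%:R =
    \sum_(k < m) (l %| k.+1)%:R * 'C(m.*2, m + k.+1)%:R :> R.
  rewrite -(@sum_multiples (fun k => 'C(m.*2, m + k)%:R) l m) //.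
  have -> : (m * l = m + m * l.-1)%N by rewrite /l /=; lia.
  rewrite big_split_ord /= [X in _ + X]big1 ?addr0 // => k _.
  by rewrite bin_small ?mulr0 //; lia.
have -> : l%:R * (A + 2 * \sum_(k < m) (l %| k.+1)%:R * 'C(m.*2, m + k.+1)%:R) =
  l%:R * A + 2 * \sum_(k < m) 'C(m.*2, m + k.+1)%:R * (1 + 2 * D k).
  rewrite mulrDr; congr (_ + _); rewrite mulrCA; congr (_ * _).
  rewrite mulr_sumr; apply: eq_bigr => k _; rewrite sum_cos_roots -/l natrM; ring.
under [in RHS]eq_bigr do rewrite mulrDr mulr1.
have lE : l%:R = 2 * q%:R + 1 :> R by rewrite /l -[q.*2.+1%:R]natr1 -mul2n natrM.
rewrite big_split /= lE -[A *+ q]mulr_natl.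
have -> : \sum_(i < m) 'C(m.*2, m + i.+1)%:R * (2 * D i) =
  2 * \sum_(i < m) 'C(m.*2, m + i.+1)%:R * D i.
  by rewrite mulr_sumr; apply: eq_bigr => i _; rewrite mulrCA.
ring.
Qed.

End PolyaIdentity.

(** * Limits of sums and sequences *)

Section RealLimits.
Variable R : realType.
Implicit Types (u v : nat -> R) (x y a b : R).

Lemma cvg_expR_seq u a : u @ \oo --> a -> (fun n => expR (u n)) @ \oo --> expR a.
Proof. by move=> ua; apply: (continuous_cvg _ _ ua); exact: continuous_expR. Qed.

(** Tannery's theorem with a geometric majorant: dominated convergence for the counting measure. The
    finite sums become integrals because [u n] vanishes from index [N n] on. *)
Lemma tannery (u : nat -> nat -> R) v M q (N : nat -> nat) : 0 <= q < 1 ->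
  (forall n k, `|u n k| <= M * q ^+ k) ->
  (forall k, (fun n => u n k) @ \oo --> v k) ->
  (forall n k, (N n <= k)%N -> u n k = 0) ->
  (fun n => \sum_(k < N n) u n k) @ \oo --> limn (series v).
Proof.
move=> q01 uM uv uN; have [q0 q1] := andP q01.
have M0 : 0 <= M by have := uM 0%N 0%N; rewrite expr0 mulr1; apply: le_trans.
pose b k := M * q ^+ k.
have b0 k : 0 <= b k by rewrite mulr_ge0 ?exprn_ge0.
have bc : cvgn (series b).
  by apply: (@is_cvg_geometric_series _ M q); rewrite ger0_norm.
have vM k : `|v k| <= b k.
  have h : (fun n => `|u n k|) @ \oo --> `|v k| by apply: cvg_norm; exact: uv.
  rewrite -(cvg_lim (@Rhausdorff R) h); apply: limr_le; last by near=> n; exact: uM.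
  by apply/cvg_ex; exists `|v k|.
have uE n : \sum_(k < N n) u n k = (\int[@counting _ R]_k u n k)%R.
  have h := cvg_series_Rintegral_count (uM n) bc.
  apply: (cvg_unique _ _ h) => //.
  apply: cvg_near_cst; exists (N n) => // k /= Nk.
  rewrite /series /= (big_cat_nat (n := N n)) //= big_mkord [X in _ + X]big1_seq ?addr0 //.
  by move=> i; rewrite mem_index_iota => /and3P[_ /uN].
under eq_fun do rewrite uE.
have -> : limn (series v) = (\int[@counting _ R]_k v k)%R.
  apply: cvg_lim; first exact: Rhausdorff.
  exact: cvg_series_Rintegral_count vM bc.
apply: (proj2 (@Rintegral_cvg _ _ R (@counting _ R) setT measurableT u v b _ _ _ _ _)) => //.
exact: integrable_count.
Unshelve. all: by end_near. Qed.

Lemma cvg_inv_nat (a : R) : (fun n : nat => a / n%:R) @ \oo --> (0 : R).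
Proof.
have h : (fun n : nat => a * n.+1%:R^-1) @ \oo --> a * 0.
  by apply: cvgMr; have := @cvg_harmonic R.
by rewrite mulr0 in h; rewrite -(cvg_shiftS _).
Qed.

Lemma squeeze0 u v a : (forall n, (0 < n)%N -> `|u n - a| <= v n) ->
  v @ \oo --> (0 : R) -> u @ \oo --> a.
Proof.
move=> uv v0; apply/cvgrPdist_lt => e e0.
move/cvgrPdist_lt/(_ e e0): v0 => h; near=> n.
have n0 : (0 < n)%N by near: n; exists 1%N.
rewrite distrC; apply: le_lt_trans (uv n n0) _.
have : `|0 - v n| < e by near: n.
by rewrite sub0r normrN; apply: le_lt_trans; exact: ler_norm.
Unshelve. all: by end_near. Qed.

Lemma cvg_div1 u v a : u @ \oo --> a -> v @ \oo --> (1 : R) ->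
  (fun n => u n / v n) @ \oo --> a.
Proof.
move=> ua v1; have h : (fun n => u n / v n) @ \oo --> a / 1.
  by apply: cvgM => //; apply: cvgV => //; exact: oner_neq0.
by rewrite divr1 in h.
Qed.

Lemma cvg_1D u : u @ \oo --> (0 : R) -> (fun n => 1 + u n) @ \oo --> (1 : R).
Proof.
move=> u0; have h : (fun n => 1 + u n) @ \oo --> (1 + 0 : R).
  by apply: cvgD => //; exact: cvg_cst.
by rewrite addr0 in h.
Qed.

Lemma cvg_1B u : u @ \oo --> (0 : R) -> (fun n => 1 - u n) @ \oo --> (1 : R).
Proof.
move=> u0; apply: cvg_1D.
by rewrite -oppr0; apply: cvgN.
Qed.

Lemma sqr_succ_ge k : k%:R <= k.+1%:R ^+ 2 :> R.
Proof. by rewrite -natrX ler_nat; nia. Qed.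

End RealLimits.

(** * Gaussian bounds for binomial coefficients *)

Section BinomialRatio.
Variable R : realType.
Implicit Types (x y : R) (m n k i K : nat).

Definition binr m k : R := 'C(m.*2, m + k)%:R / 'C(m.*2, m)%:R.

Lemma bin_mid_gt0 m : 0 < 'C(m.*2, m)%:R :> R.
Proof. by rewrite ltr0n bin_gt0 -addnn leq_addr. Qed.

Lemma binr0 m : binr m 0 = 1.
Proof. by rewrite /binr addn0 divff // gt_eqF // bin_mid_gt0. Qed.

Lemma binrS m k : binr m k.+1 = binr m k * ((m - k)%:R / (m + k.+1)%:R).
Proof.
have n0 : (m + k.+1)%:R != 0 :> R by rewrite pnatr_eq0 addnS.
have c0 : 'C(m.*2, m)%:R != 0 :> R by rewrite gt_eqF // bin_mid_gt0.
have h : ((m + k.+1) * 'C(m.*2, m + k.+1) = (m - k) * 'C(m.*2, m + k))%N.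
  by rewrite addnS mul_bin_left; congr (_ * _)%N; lia.
have {}h := congr1 (fun i => i%:R : R) h; rewrite !natrM in h.
rewrite /binr; move: n0 h; move: (m + k.+1)%:R => N n0 h.
by apply: (mulfI n0); rewrite mulrA h; field; rewrite n0 c0.
Qed.

Lemma binr_ge0 m k : 0 <= binr m k.
Proof. by rewrite divr_ge0. Qed.

Lemma binr_eq0 m k : (m < k)%N -> binr m k = 0.
Proof. by move=> mk; rewrite /binr bin_small ?mul0r //; lia. Qed.

(** The step ratio is [(m - k) / (m + k + 1) = 1 - (2 k + 1) / (m + k + 1)], at most
    [e^(- (2 k + 1) / (m + K))], and the odd numbers add up to a square. *)
Lemma binr_le m K k : (k <= K)%N -> binr m k <= expR (- (k%:R ^+ 2 / (m + K)%:R)).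
Proof.
elim: k => [|k IH] kK; first by rewrite binr0 expr0n mul0r oppr0 expR0.
have mK : 0 < (m + K)%:R :> R by rewrite ltr0n; lia.
have mk : 0 < (m + k.+1)%:R :> R by rewrite ltr0n; lia.
rewrite binrS.
have -> : - (k.+1%:R ^+ 2 / (m + K)%:R) =
    - (k%:R ^+ 2 / (m + K)%:R) + - ((2 * k%:R + 1) / (m + K)%:R) :> R.
  by rewrite -natr1; ring.
rewrite expRD; apply: ler_pM; rewrite ?binr_ge0 ?divr_ge0 ?IH //; first exact: ltnW.
have [km|mk'] := leqP k m; last first.
  by rewrite (_ : (m - k)%N = 0%N) ?mul0r ?expR_ge0 //; lia.
apply: (@le_trans _ _ (1 - (2 * k%:R + 1) / (m + k.+1)%:R)).
  rewrite natrB // ler_pdivrMr // mulrBl divfK ?gt_eqF // natrD -natr1; lra.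
apply: le_trans (expR_ge1Dx _); rewrite lerD2l lerN2 ler_wpM2l ?addr_ge0 ?mulr_ge0 //.
by rewrite lef_pV2 ?posrE // ler_nat; lia.
Qed.

(** Dual to the upper bound: the inverse step ratio is [1 + (2 k + 1) / (m - k)], at most
    [e^((2 k + 1) / (m - K))]. *)
Lemma binr_ge m K k : (k <= K)%N -> (K < m)%N ->
  expR (- (k%:R ^+ 2 / (m - K)%:R)) <= binr m k.
Proof.
move=> kK Km; have mK : 0 < (m - K)%:R :> R by rewrite ltr0n; lia.
elim: k kK => [|k IH] kK; first by rewrite binr0 expr0n mul0r oppr0 expR0.
have mk : 0 < (m - k)%:R :> R by rewrite ltr0n; lia.
have mk1 : 0 < (m + k.+1)%:R :> R by rewrite ltr0n; lia.
rewrite binrS.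
have -> : - (k.+1%:R ^+ 2 / (m - K)%:R) =
    - (k%:R ^+ 2 / (m - K)%:R) + - ((2 * k%:R + 1) / (m - K)%:R) :> R.
  by rewrite -natr1; ring.
rewrite expRD; apply: ler_pM; rewrite ?expR_ge0 ?IH //; first exact: ltnW.
rewrite expRN -[leRHS]invrK lef_pV2 ?posrE ?expR_gt0 ?invr_gt0 ?divr_gt0 //.
rewrite invf_div; apply: le_trans (expR_ge1Dx _).
apply: (@le_trans _ _ (1 + (2 * k%:R + 1) / (m - k)%:R)).
  rewrite ler_pdivrMr // mulrDl divfK ?gt_eqF // natrD natrB; last by lia.
  rewrite -natr1; lra.
rewrite lerD2l ler_wpM2l ?addr_ge0 ?mulr_ge0 //.
by rewrite lef_pV2 ?posrE // ler_nat; lia.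
Qed.

End BinomialRatio.

(** * The limit in Polya's identity *)

Section PolyaLimit.
Variable R : realType.
Variable c : R.
Hypothesis c0 : 0 < c.
Implicit Types (n k j : nat).

(** With [m = n^2], this makes [pl n] an odd integer within 1 of [c n], so that [l / sqrt m] tends
    to [c]. *)
Definition pq n : nat := Num.truncn (c * n%:R / 2).
Definition pl n : nat := (pq n).*2.+1.

Lemma pl_bounds n : c * n%:R - 1 <= (pl n)%:R <= c * n%:R + 1 /\
  c * n%:R / 2 <= (pl n)%:R.
Proof.
have x0 : 0 <= c * n%:R / 2 by rewrite divr_ge0 // mulr_ge0 // ltW.
have /andP[h1 h2] := truncn_itv x0; rewrite -/(pq n) in h1 h2.
have e : (pl n)%:R = 2 * (pq n)%:R + 1 :> R.
  by rewrite /pl -natr1 -mul2n natrM.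
rewrite -[X in _ < X]natr1 in h2; rewrite e; have q0 : 0 <= (pq n)%:R :> R by [].
by split; [apply/andP; split; lra|lra].
Qed.

Lemma pl_gt0 n : 0 < (pl n)%:R :> R. Proof. by rewrite ltr0n. Qed.

Lemma pl_cvg : (fun n => (pl n)%:R / n%:R) @ \oo --> c.
Proof.
apply: (squeeze0 _ (cvg_inv_nat 1)) => n n0.
have nR : 0 < n%:R :> R by rewrite ltr0n.
have [/andP[h1 h2] _] := pl_bounds n.
have -> : (pl n)%:R / n%:R - c = ((pl n)%:R - c * n%:R) / n%:R :> R.
  by rewrite mulrBl mulfK // gt_eqF.
rewrite normrM normfV (ger0_norm (ltW nR)) ler_wpM2r ?invr_ge0 ?(ltW nR) //.
by rewrite ler_norml; apply/andP; split; lra.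
Qed.

Lemma plV_cvg : (fun n => n%:R / (pl n)%:R) @ \oo --> c^-1.
Proof.
rewrite (_ : (fun n => _) = (fun n => ((pl n)%:R / n%:R)^-1)).
  by apply: cvgV; [exact: lt0r_neq0|exact: pl_cvg].
by apply/funext => n; rewrite invf_div.
Qed.

Definition polyaA n : R :=
  \sum_(k < pq n) cos (pi * k.+1%:R / (pl n)%:R) ^+ (n * n).*2.

Definition polyaB n : R := \sum_(j < n * n) binr R (n * n) (j.+1 * pl n).

Lemma polya_ratio n : 4 ^+ (n * n) * (1 + 2 * polyaA n) =
  (pl n)%:R * 'C((n * n).*2, n * n)%:R * (1 + 2 * polyaB n).
Proof.
rewrite /polyaA polya_identity -/(pl n) -mulrA; congr (_ * _).
rewrite mulrDr mulr1 mulrCA; congr (_ + 2 * _).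
rewrite /polyaB mulr_sumr; apply: eq_bigr => j _.
by rewrite /binr mulrCA divff ?mulr1 // gt_eqF // bin_mid_gt0.
Qed.

Lemma cos_pow_le m (x : R) : 0 <= x <= pi / 2 ->
  cos x ^+ m.*2 <= expR (- (m%:R * x ^+ 2)).
Proof.
move=> /andP[x0 xp]; have p0 := pi_gt0 R.
have h := @cos_le_expR R x; rewrite ger0_norm // in h; have {}h := h xp.
have cx : 0 <= cos x by apply: cos_ge0_pihalf; apply/andP; split; lra.
have -> : - (m%:R * x ^+ 2) = m.*2%:R * (- (x ^+ 2 / 2)).
  by rewrite -mul2n natrM; field.
by rewrite expRM_natl lerXn2r // nnegrE ?expR_ge0.
Qed.

Lemma cos_pow_ge m (x : R) : 0 <= x < 1 ->
  expR (- (m%:R * x ^+ 2 / (1 - x ^+ 2 / 2))) <= cos x ^+ m.*2.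
Proof.
move=> /andP[x0 x1].
have x2 : x ^+ 2 < 1 by rewrite expr_lt1.
have d0 : 0 < 1 - x ^+ 2 / 2 by lra.
have -> : - (m%:R * x ^+ 2 / (1 - x ^+ 2 / 2)) =
   m.*2%:R * (- ((x ^+ 2 / 2) / (1 - x ^+ 2 / 2))).
  by rewrite -mul2n natrM; field; lra.
rewrite expRM_natl.
have h : expR (- (x ^+ 2 / 2 / (1 - x ^+ 2 / 2))) <= cos x.
  apply: le_trans (cos_ge_1Bsqr x).
  rewrite expRN -[leRHS]invrK lef_pV2 ?posrE ?expR_gt0 ?invr_gt0 //.
  apply: le_trans (expR_ge1Dx _); rewrite le_eqVlt; apply/orP; left; apply/eqP.
  by field; lra.
by rewrite lerXn2r // nnegrE ?expR_ge0 // (le_trans (expR_ge0 _) h).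
Qed.

(** With [x n] the angle, the term lies between [e^(- y / (1 - x^2 / 2))] and [e^(- y)], where
    [y = n^2 x^2] tends to [(pi (k + 1) / c)^2] and [x] to 0. *)
Lemma polyaA_term_cvg k :
  (fun n => if (k < pq n)%N then cos (pi * k.+1%:R / (pl n)%:R : R) ^+ (n * n).*2 else 0)
  @ \oo --> expR (- (pi ^+ 2 / c ^+ 2 * k.+1%:R ^+ 2)).
Proof.
have p0 := pi_gt0 R.
pose x n : R := pi * k.+1%:R / (pl n)%:R.
pose y n : R := (pi * k.+1%:R * (n%:R / (pl n)%:R)) ^+ 2.
have yc : y @ \oo --> (pi ^+ 2 / c ^+ 2 * k.+1%:R ^+ 2).
  have -> : pi ^+ 2 / c ^+ 2 * k.+1%:R ^+ 2 = (pi * k.+1%:R * c^-1) ^+ 2 :> R.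
    by rewrite !exprMn exprVn; ring.
  rewrite expr2 /y; under eq_fun do rewrite expr2.
  by apply: cvgM; apply: cvgMr; exact: plV_cvg.
have xc : x @ \oo --> (0 : R).
  have h : (fun n => pi * k.+1%:R * (n%:R / (pl n)%:R) * (1 / n%:R)) @ \oo -->
    pi * k.+1%:R * c^-1 * 0.
    by apply: cvgM; [apply: cvgMr; exact: plV_cvg|exact: cvg_inv_nat].
  rewrite mulr0 in h; apply: cvg_trans h; apply: near_eq_cvg.
  exists 1%N => // n /= n0; rewrite /x; field.
  by rewrite (gt_eqF (pl_gt0 n)) pnatr_eq0 -lt0n n0.
have ye n : (n * n)%:R * x n ^+ 2 = y n by rewrite /x /y natrM; ring.
apply: (@squeeze_cvgr _ _ _ R (fun n => expR (- (y n / (1 - x n ^+ 2 / 2))))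
  (fun n => expR (- y n))).
- near=> n.
  have kq : (k < pq n)%N.
    have : (pl n)%:R > (2 * k + 3)%:R :> R.
      have [/andP[h _] _] := pl_bounds n.
      apply: lt_le_trans h; rewrite ltrBrDr -ltr_pdivrMl //.
      by near: n; exact: nbhs_infty_gtr.
    by rewrite ltr_nat /pl; lia.
  have x0 : 0 <= x n by rewrite divr_ge0 ?mulr_ge0 // ltW.
  have x1 : x n < 1.
    have : `|0 - x n| < 1 by near: n; move/cvgrPdist_lt: xc; apply.
    by rewrite sub0r normrN ger0_norm.
  have xp : x n <= pi / 2 by have := pi_ge2 R; lra.
  by rewrite kq -!ye -/(x n) cos_pow_ge ?x0 //= cos_pow_le // x0.
- apply: cvg_expR_seq; apply: cvgN.
  apply: cvg_div1 => //; apply: cvg_1B.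
  have h : (fun n => x n * x n * 2^-1) @ \oo --> (0 * 0 * 2^-1 : R).
    by apply: cvgMl; exact: cvgM.
  by rewrite !mul0r in h; under eq_fun do rewrite expr2.
- by apply: cvg_expR_seq; apply: cvgN.
Unshelve. all: by end_near. Qed.

Lemma polyaA_cvg : polyaA @ \oo -->
  limn (series (fun k => expR (- (pi ^+ 2 / c ^+ 2 * k.+1%:R ^+ 2)))).
Proof.
(* For [n >= 1] one has [pl n <= (c + 1) n], so the Gaussian exponent of a term is at least
   [(k + 1)^2 d]; as [(k + 1)^2 >= k], a geometric majorant results. *)
have p0 := pi_gt0 R; pose d := (pi / (c + 1)) ^+ 2.
have c1 : 0 < c + 1 by rewrite addr_gt0.
have d0 : 0 < d by rewrite exprn_gt0 // divr_gt0.
pose u n k : R := if (k < pq n)%N then cos (pi * k.+1%:R / (pl n)%:R) ^+ (n * n).*2 else 0.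
have -> : polyaA = fun n => \sum_(k < pq n) u n k.
  by apply/funext => n; apply: eq_bigr => k _; rewrite /u ltn_ord.
apply: (@tannery R u _ 1 (expR (- d)) pq).
- by rewrite expR_ge0 /= -expR0 ltr_expR oppr_lt0.
- move=> n k; rewrite mul1r /u; case: ifP => [kq|_]; last by rewrite normr0 exprn_ge0 ?expR_ge0.
  have l0 := pl_gt0 n.
  have n0 : (0 < n)%N.
    by case: n kq {l0} => //; rewrite /pq mulr0 mul0r truncn0.
  have nR : 1 <= n%:R :> R by rewrite ler1n.
  rewrite ger0_norm; last by rewrite -mul2n exprM exprn_ge0 ?sqr_ge0.
  have x0 : 0 <= pi * k.+1%:R / (pl n)%:R :> R by rewrite divr_ge0 ?mulr_ge0 ?ltW.
  apply: le_trans (cos_pow_le _ _) _.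
    rewrite x0 ler_pdivrMr // -[leRHS]mulrA ler_wpM2l ?(ltW p0) //.
    rewrite ler_pdivlMl // -natrM ler_nat /pl; lia.
  rewrite -expRM_natl ler_expR mulrN lerN2.
  have [/andP[_ h] _] := pl_bounds n.
  have hn : (c + 1)^-1 <= n%:R / (pl n)%:R.
    by rewrite -div1r ler_pdivrMr // mulrAC ler_pdivlMr // mul1r; nra.
  have -> : (n * n)%:R * (pi * k.+1%:R / (pl n)%:R) ^+ 2 =
     k.+1%:R ^+ 2 * (pi * (n%:R / (pl n)%:R)) ^+ 2 :> R by rewrite natrM; ring.
  have a0 : 0 <= pi / (c + 1) by apply: divr_ge0; [exact: ltW|apply: addr_ge0 => //; exact: ltW].
  have ab : pi / (c + 1) <= pi * (n%:R / (pl n)%:R) by apply: ler_wpM2l => //; exact: ltW.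
  apply: ler_pM; [exact: ler0n|exact: ltW|exact: sqr_succ_ge|].

  by rewrite /d lerXn2r // nnegrE // (le_trans a0).
- exact: polyaA_term_cvg.
- by move=> n k qk; rewrite /u ltnNge qk.
Qed.

(** The bounds on [binr] at [K = k = (j + 1) pl n] have exponents [y / (1 - x)] and [y / (1 + x)],
    where [x = k / n^2] tends to 0 and [y = k^2 / n^2] to [c^2 (j + 1)^2]. *)
Lemma polyaB_term_cvg j : (fun n => binr R (n * n) (j.+1 * pl n)) @ \oo -->
  expR (- (c ^+ 2 * j.+1%:R ^+ 2)).
Proof.
pose w n : R := (pl n)%:R / n%:R.
pose y n : R := j.+1%:R ^+ 2 * w n ^+ 2.
pose x n : R := j.+1%:R * (w n * (1 / n%:R)).
have yc : y @ \oo --> (c ^+ 2 * j.+1%:R ^+ 2).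
  rewrite mulrC; apply: cvgMr; under eq_fun do rewrite expr2.
  by rewrite expr2; apply: cvgM; exact: pl_cvg.
have xc : x @ \oo --> (0 : R).
  rewrite -(mulr0 j.+1%:R); apply: cvgMr.
  by rewrite -(mulr0 c); apply: cvgM; [exact: pl_cvg|exact: cvg_inv_nat].
have e n : (0 < n)%N -> (j.+1 * pl n)%:R ^+ 2 = (n * n)%:R * y n.
  move=> n0; rewrite /y /w !natrM; field.
  by rewrite pnatr_eq0 -lt0n.
have e2 n : (0 < n)%N -> (j.+1 * pl n)%:R = (n * n)%:R * x n.
  move=> n0; rewrite /x /w !natrM; field.
  by rewrite pnatr_eq0 -lt0n.
apply: (@squeeze_cvgr _ _ _ R (fun n => expR (- (y n / (1 - x n))))
  (fun n => expR (- (y n / (1 + x n))))).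
- near=> n.
  have n0 : (0 < n)%N by near: n; exists 1%N.
  have m0 : 0 < (n * n)%:R :> R by rewrite ltr0n muln_gt0 n0.
  have x0 : 0 <= x n by rewrite !mulr_ge0 ?divr_ge0.
  have x1 : x n < 1.
    have : `|0 - x n| < 1 by near: n; move/cvgrPdist_lt: xc; apply.
    by rewrite sub0r normrN ger0_norm.
  have km : (j.+1 * pl n < n * n)%N by rewrite -(ltr_nat R) e2 // gtr_pMr.
  have := binr_ge R (leqnn (j.+1 * pl n)) km.
  have := binr_le R (n * n) (leqnn (j.+1 * pl n)).
  rewrite natrD natrB ?(ltnW km) // e // e2 //.
  have -> : (n * n)%:R * y n / ((n * n)%:R + (n * n)%:R * x n) = y n / (1 + x n).
    have h : 0 < 1 + x n by rewrite ltr_pwDl.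
    by rewrite -{2}[(n * n)%:R]mulr1 -mulrDr -mulf_div divff ?mul1r // gt_eqF.
  have -> : (n * n)%:R * y n / ((n * n)%:R - (n * n)%:R * x n) = y n / (1 - x n).
    have h : 0 < 1 - x n by rewrite subr_gt0.
    by rewrite -{2}[(n * n)%:R]mulr1 -mulrBr -mulf_div divff ?mul1r // gt_eqF.
  by move=> -> ->.
- apply: cvg_expR_seq; apply: cvgN.
  by apply: cvg_div1 => //; exact: cvg_1B.
- apply: cvg_expR_seq; apply: cvgN.
  by apply: cvg_div1 => //; exact: cvg_1D.
Unshelve. all: by end_near. Qed.

Lemma polyaB_cvg : polyaB @ \oo -->
  limn (series (fun k => expR (- (c ^+ 2 * k.+1%:R ^+ 2)))).
Proof.
(* From [pl n >= c n / 2] and [K = n^2], which makes the denominator [m + K = 2 n^2]: the quotient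
   of the squares is [c^2 / 8]. *)
pose d := c ^+ 2 / 8.
have d0 : 0 < d by rewrite divr_gt0 // exprn_gt0.
apply: (@tannery R (fun n j => binr R (n * n) (j.+1 * pl n)) _ 1 (expR (- d))
  (fun n => (n * n)%N)).
- by rewrite expR_ge0 /= -expR0 ltr_expR oppr_lt0.
- move=> n j; rewrite mul1r ger0_norm ?binr_ge0 //.
  have [jm|mj] := leqP (j.+1 * pl n) (n * n); last first.
    by rewrite binr_eq0 // exprn_ge0 ?expR_ge0.
  have n0 : (0 < n)%N by case: n jm => //; rewrite muln0 leqn0.
  have nR : 0 < n%:R :> R by rewrite ltr0n.
  have m0 : 0 < (n * n + n * n)%:R :> R by rewrite ltr0n; nia.
  apply: le_trans (binr_le R (n * n) jm) _.
  rewrite -expRM_natl ler_expR mulrN lerN2 ler_pdivlMr // natrD !natrM exprMn.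
  have [_ h] := pl_bounds n.
  have h2 : (c * n%:R / 2) ^+ 2 <= (pl n)%:R ^+ 2 :> R.
    by rewrite lerXn2r ?nnegrE // divr_ge0 // mulr_ge0 // ltW.
  have -> : j%:R * d * (n%:R * n%:R + n%:R * n%:R) = j%:R * (c * n%:R / 2) ^+ 2 :> R.
    by rewrite /d; field.
  by apply: ler_pM => //; [exact: sqr_ge0|exact: sqr_succ_ge].
- exact: polyaB_term_cvg.
- by move=> n k nk; rewrite binr_eq0 // /pl; nia.
Qed.

End PolyaLimit.

(** * The inversion formula *)

Section Theta.
Variable R : realType.
Implicit Types (x t c : R).

(** One half of the theta series: the sum over all integers is [1 + 2 * theta_tail x]. *)
Definition theta_tail x : R := limn (series (fun k => expR (- (x * k.+1%:R ^+ 2)))).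

Lemma theta_tail_ge0 x : 0 < x -> 0 <= theta_tail x /\
  cvgn (series (fun k => expR (- (x * k.+1%:R ^+ 2)))).
Proof.
move=> x0.
have h : cvgn (series (fun k => expR (- (x * k.+1%:R ^+ 2)))).
  apply: (@cvg_series_geo _ _ 1 (expR (- x))).
    by rewrite expR_ge0 /= -expR0 ltr_expR oppr_lt0.
  move=> n; rewrite mul1r ger0_norm ?expR_ge0 // -expRM_natl ler_expR.
  by rewrite mulrN lerN2 mulrC ler_wpM2l ?(ltW x0) // sqr_succ_ge.
split => //; apply: limr_ge => //; near=> n.
by rewrite /series /= sumr_ge0 // => i _; exact: expR_ge0.
Unshelve. all: by end_near. Qed.

(* Comparing the limits of [polya_ratio] for [c] and [sqrt pi] at the same [n]
   removes the central binomial coefficient. *)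
Lemma theta_tail_inversion c : 0 < c ->
  Num.sqrt pi * (1 + 2 * theta_tail (pi ^+ 2 / c ^+ 2)) =
  c * (1 + 2 * theta_tail (c ^+ 2)).
Proof.
move=> c0; have p0 := pi_gt0 R.
pose c' : R := Num.sqrt pi; have c'0 : 0 < c' by rewrite sqrtr_gt0.
have c'2 : c' ^+ 2 = pi by rewrite sqr_sqrtr // ltW.
have A b (b0 : 0 < b) : (fun n => 1 + 2 * polyaA b n) @ \oo -->
    1 + 2 * theta_tail (pi ^+ 2 / b ^+ 2).
  apply: cvgD; first exact: cvg_cst.
  by apply: cvgMr; exact: polyaA_cvg.
have B b (b0 : 0 < b) : (fun n => 1 + 2 * polyaB b n) @ \oo -->
    1 + 2 * theta_tail (b ^+ 2).
  apply: cvgD; first exact: cvg_cst.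
  by apply: cvgMr; exact: polyaB_cvg.
have h1 := cvgM (cvgM (pl_cvg c'0) (A c c0)) (B c' c'0).
have h2 := cvgM (cvgM (pl_cvg c0) (A c' c'0)) (B c c0).
have key n : (pl c' n)%:R / n%:R * (1 + 2 * polyaA c n) * (1 + 2 * polyaB c' n) =
  (pl c n)%:R / n%:R * (1 + 2 * polyaA c' n) * (1 + 2 * polyaB c n).
  have m4 : 4 ^+ (n * n) != 0 :> R by rewrite expf_neq0.
  have C0 : 'C((n * n).*2, n * n)%:R != 0 :> R by rewrite gt_eqF // bin_mid_gt0.
  have r1 := polya_ratio c n; have r2 := polya_ratio c' n.
  apply: (mulfI m4); apply: (mulfI C0).
  have -> : 'C((n * n).*2, n * n)%:R * (4 ^+ (n * n) * ((pl c' n)%:R / n%:R *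
      (1 + 2 * polyaA c n) * (1 + 2 * polyaB c' n))) =
    (4 ^+ (n * n) * (1 + 2 * polyaA c n)) * ((pl c' n)%:R *
      'C((n * n).*2, n * n)%:R * (1 + 2 * polyaB c' n)) / n%:R by ring.
  by rewrite -r2 r1; ring.
have h2' : (fun n => (pl c' n)%:R / n%:R * (1 + 2 * polyaA c n) * (1 + 2 * polyaB c' n))
  @ \oo --> c * (1 + 2 * theta_tail (pi ^+ 2 / c' ^+ 2)) * (1 + 2 * theta_tail (c ^+ 2)).
  by rewrite (funext key); exact: h2.
have := cvg_unique (@Rhausdorff R) (h1 _ _) h2'.
(* The parameter [sqrt pi] is self-dual, so both limits contain the factor [1 + 2 * theta_tail pi],
   which is positive and cancels. *)
have -> : pi ^+ 2 / c' ^+ 2 = pi by rewrite c'2 expr2 mulfK // gt_eqF.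
rewrite c'2 => e.
have [t0 _] := theta_tail_ge0 p0.
have n0 : 1 + 2 * theta_tail pi != 0 :> R by rewrite gt_eqF // ltr_pwDl // mulr_ge0.
apply: (mulIf n0); rewrite [RHS]mulrAC; exact: (e _ _ _).
Qed.

End Theta.

(** * Continuity and size of the theta tail *)

Section ThetaTail.
Variable R : realType.
Implicit Types (x y t m : R).
Local Notation term x := (fun k : nat => expR (- (x * k.+1%:R ^+ 2))).

(** Termwise, with [N] the square of the index, [e^(-xN) - e^(-yN) <= (y - x) N e^(-mN)], and half
    of the exponential absorbs [N] because [v e^(-v) <= 1] at [v = m N / 2]. *)
Lemma theta_tail_lip m x y : 0 < m -> m <= x -> x <= y ->
  0 <= theta_tail x - theta_tail y <= (y - x) * (2 / m * theta_tail (m / 2)).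
Proof.
move=> m0 mx xy; have x0 := lt_le_trans m0 mx; have y0 := lt_le_trans x0 xy.
have [_ cx] := theta_tail_ge0 x0; have [_ cy] := theta_tail_ge0 y0.
have m20 : 0 < m / 2 by rewrite divr_gt0.
have [_ cm] := theta_tail_ge0 m20.
rewrite subr_ge0; apply/andP; split.
  apply: (lim_series_le cy cx) => k; rewrite ler_expR lerN2 ler_wpM2r //.
pose K : R := (y - x) * (2 / m).
have -> : (y - x) * (2 / m * theta_tail (m / 2)) = limn (series (K *: term (m / 2))).
  by rewrite lim_seriesZ //; exact: mulrA.
rewrite /theta_tail -(lim_seriesB cx cy).
have h := @lim_series_le R _ _ (is_cvg_seriesB cx cy) (@is_cvg_seriesZ R _ K cm).
apply: h => k; rewrite [leLHS]/(expR _ - expR _) [leRHS]/(K * expR _).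
set N : R := k.+1%:R ^+ 2; have N0 : 0 <= N by exact: sqr_ge0.
have e1 : expR (- (x * N)) <= expR (- (m * N)) by rewrite ler_expR lerN2 ler_wpM2r.
have -> : expR (- (y * N)) = expR (- (x * N)) * expR (- ((y - x) * N)).
  by rewrite -expRD; congr expR; ring.
have e2 := @expR_ge1Dx R (- ((y - x) * N)).
have h1 : expR (- (x * N)) - expR (- (x * N)) * expR (- ((y - x) * N)) <=
    expR (- (m * N)) * ((y - x) * N).
  rewrite -{1}[expR (- (x * N))]mulr1 -mulrBr ler_pM ?expR_ge0 //.
    by rewrite subr_ge0 -expR0 ler_expR oppr_le0 mulr_ge0 // subr_ge0.
  by rewrite lerBlDr -lerBlDl addrC in e2 *; lra.
apply: le_trans h1 _.
have -> : expR (- (m * N)) = expR (- (m / 2 * N)) * expR (- (m / 2 * N)).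
  by rewrite -expRD; congr expR; field.
have e3 : m / 2 * N * expR (- (m / 2 * N)) <= 1.
  have := @expR_ge1Dx R (m / 2 * N); have e0 := expR_gt0 (m / 2 * N).
  by rewrite expRN ler_pdivrMr // mul1r; lra.
move: e3; set E := expR _ => e3.
have -> : E * E * ((y - x) * N) = K * E * (m / 2 * N * E) by rewrite /K; field; rewrite gt_eqF.
rewrite ler_piMr // mulr_ge0 ?expR_ge0 // /K mulr_ge0 ?subr_ge0 // divr_ge0 //.
exact: ltW.
Qed.

Lemma theta_tail_cont : cont_pos (@theta_tail R).
Proof.
move=> x x0; pose m := x / 2; have m0 : 0 < m by rewrite divr_gt0.
pose K := 2 / m * theta_tail (m / 2).
have [t0 _] := @theta_tail_ge0 R (m / 2) ltac:(by rewrite divr_gt0).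
have K0 : 0 <= K by rewrite mulr_ge0 // divr_ge0 // ltW.
apply/cvgrPdist_le => e e0.
pose d := Num.min m (e / (K + 1)).
have d0 : 0 < d by rewrite lt_min m0 divr_gt0 // ltr_wpDl.
near=> y.
have : `|x - y| < d.
  by near: y; exact: (@cvgr_dist_lt _ _ _ _ _ id x).
rewrite lt_min => /andP[h1 h2].
have my : m <= y by move: h1; rewrite ltr_norml /m => /andP[_]; lra.
have mx : m <= x by rewrite /m; lra.
have h3 : `|x - y| * K <= e.
  apply: le_trans (_ : e / (K + 1) * K <= e); first by rewrite ler_wpM2r // ltW.
  by rewrite mulrAC ler_pdivrMr ?ltr_wpDl // ler_wpM2l ?(ltW e0) // lerDl ler01.
case/orP: (le_total x y) => [xy|yx].
  have /andP[a b] := theta_tail_lip m0 mx xy.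
 rewrite (ger0_norm a); apply: (le_trans b); rewrite -/K; apply: le_trans h3.
  by rewrite distrC ler_wpM2r // ler_norm.
have /andP[a b] := theta_tail_lip m0 my yx.
rewrite distrC (ger0_norm a); apply: (le_trans b); rewrite -/K; apply: le_trans h3.
by rewrite ler_wpM2r // ler_norm.
Unshelve. all: by end_near. Qed.

Lemma theta_tail_ge x : 0 < x -> expR (- x) <= theta_tail x.
Proof.
move=> x0; have [_ cx] := theta_tail_ge0 x0.
have := nondecreasing_cvgn_le (_ : nondecreasing_seq (series (term x))) cx 1%N.
rewrite /series /= big_nat1 expr1n mulr1; apply.
by apply/nondecreasing_seqP => n; rewrite big_nat_recr //= lerDl expR_ge0.
Qed.

(** Comparison of the exponents [(k + 1)^2 >= k + 1] with a geometric series of ratio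
    [q = e^(-x) <= 1 / 2]. *)
Lemma theta_tail_le x : 1 <= x -> theta_tail x <= 2 * expR (- x).
Proof.
move=> x1; have x0 : 0 < x by lra.
have [_ cx] := theta_tail_ge0 x0.
pose q := expR (- x); have q0 : 0 < q by exact: expR_gt0.
have q2 : q <= 1 / 2.
  rewrite /q expRN div1r lef_pV2 ?posrE ?expR_gt0 //.
  by have := @expR_ge1Dx R x; lra.
have qn : `|q| < 1 by rewrite gtr0_norm //; lra.
have hq := @cvg_geometric_series R q q qn.
have -> : 2 * q = q / (1 / 2) by field.
apply: (@le_trans _ _ (q / (1 - q))); last first.
  by rewrite ler_pM2l // lef_pV2 ?posrE; lra.
have -> : q / (1 - q) = limn (series (geometric q q)) by apply/esym/cvg_lim.
apply: (lim_series_le cx (@is_cvg_geometric_series R q q qn)) => k.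
have -> : geometric q q k = q ^+ k.+1 by exact: (esym (exprS q k)).
rewrite /q -expRM_natl ler_expR mulrN lerN2.
by rewrite mulrC ler_wpM2l ?(ltW x0) // -natrX ler_nat; nia.
Qed.

End ThetaTail.

(** * Mellin transform and continuation of zeta *)

Section RealMellin.
Variable R : realType.
Local Notation mu := (@lebesgue_measure R).
Local Notation H0 := (`]0%R, +oo[%classic : set R).
Local Notation H1 := (`[1%R, +oo[%classic : set R).
Implicit Types (a b x t : R).

Definition psi t : R := theta_tail (pi * t).
(** The Mellin integrand [psi(t) t^a]. *)
Definition jfun a t : R := psi t * expR (a * ln t).

Lemma psi_ge0 t : 0 < t -> 0 <= psi t.
Proof. by move=> t0; have [] := @theta_tail_ge0 R (pi * t) (mulr_gt0 (pi_gt0 R) t0). Qed.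

Lemma cont_pos_psi : cont_pos psi.
Proof.
move=> t t0; have h := @theta_tail_cont R (pi * t) (mulr_gt0 (pi_gt0 R) t0).
apply: (@continuous_comp _ _ _ (fun t : R => pi * t) (@theta_tail R)); last exact: h.
by apply: cvgMr.
Qed.

Lemma cont_pos_pow a : cont_pos (fun t : R => expR (a * ln t)).
Proof.
have h := cont_posM (@cont_pos_cst R a) (@cont_pos_ln R).
by have {}h := cont_pos_expR h; apply: h.
Qed.

Lemma cont_pos_jfun a : cont_pos (jfun a).
Proof. by have h := cont_posM cont_pos_psi (@cont_pos_pow a); apply: h. Qed.

Lemma jfun_ge0 a t : 0 < t -> 0 <= jfun a t.
Proof. by move=> t0; rewrite mulr_ge0 ?expR_ge0 ?psi_ge0. Qed.

Lemma H1_sub : H1 `<=` H0.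
Proof. by move=> t /=; rewrite !in_itv /= !andbT; apply: lt_le_trans. Qed.

Lemma sqrt_expR t : 0 < t -> Num.sqrt t = expR (2^-1 * ln t).
Proof.
move=> t0; apply/eqP; rewrite -(@eqrXn2 _ 2) ?expR_ge0 ?sqrtr_ge0 //.
rewrite sqr_sqrtr ?(ltW t0) // -expRM_natl.
have -> : 2%:R * (2^-1 * ln t) = ln t by field.
by rewrite lnK ?posrE.
Qed.

(** The theta inversion at [c = sqrt (pi t)], that is [1 + 2 psi(1/t) = sqrt t (1 + 2 psi(t))],
    solved for [psi(1/t)]. *)
Lemma psi_inv t : 0 < t ->
  psi t^-1 = expR (2^-1 * ln t) * psi t + 2^-1 * expR (2^-1 * ln t) - 2^-1.
Proof.
move=> t0; have p0 := pi_gt0 R; have pt := mulr_gt0 p0 t0.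
pose c : R := Num.sqrt (pi * t); have c0 : 0 < c by rewrite sqrtr_gt0.
have c2 : c ^+ 2 = pi * t by rewrite sqr_sqrtr // ltW.
have cE : c = Num.sqrt pi * expR (2^-1 * ln t) by rewrite /c sqrtrM ?sqrt_expR // ltW.
have := theta_tail_inversion c0; rewrite c2 [in RHS]cE -[RHS]mulrA.
have -> : pi ^+ 2 / (pi * t) = pi * t^-1 :> R.
  by rewrite invfM mulrA expr2 mulfK // gt_eqF.
have s0 : Num.sqrt pi != 0 :> R by rewrite gt_eqF // sqrtr_gt0.
by move/(mulfI s0); rewrite -/(psi t) -/(psi t^-1); lra.
Qed.

Lemma psi_le t : 1 <= t -> psi t <= 2 * expR (- t).
Proof.
move=> t1; have p2 := pi_ge2 R; have pt : t <= pi * t by rewrite ler_peMl //; lra.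
apply: le_trans (theta_tail_le (le_trans t1 pt)) _.
by rewrite ler_pM2l // ler_expR lerN2.
Qed.

(** On [[1, oo[] the integrand is at most [2 t^|a| e^(-t)], an Euler integrand, whatever the sign of
    [a]; hence the Mellin integral over this half-line is entire. *)
Lemma integrable_jfun a : mu.-integrable H1 (EFin \o jfun a).
Proof.
apply: (@cont_pos_integrableS _ _ (fun t => 2 * gfun (`|a| + 1) t)).
- exact: measurable_itv.
- exact: H1_sub.
- by have h := @cont_pos_jfun a; apply: h.
- move=> t; rewrite /= in_itv /= andbT => t1; have t0 : 0 < t by lra.
  rewrite ger0_norm ?jfun_ge0 // /jfun /gfun addrK.
  rewrite expRD [expR _ * expR _]mulrC mulrA ler_pM ?expR_ge0 ?psi_ge0 ?psi_le //.
  by rewrite ler_expR ler_wpM2r ?ln_ge0 // ler_norm.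
- apply: integrableZlR; first exact: measurable_itv.
  apply: integrableS (@integrable_gfun R (`|a| + 1) _) => //; try exact: measurable_itv.
  exact: H1_sub.
Qed.

Lemma integral_pow b : 1 < b ->
  (\int[mu]_(t in H1) (expR (- b * ln t))%:E = (b - 1)^-1%:E)%E.
Proof.
move=> b1; pose F t : R := - (b - 1)^-1 * expR ((1 - b) * ln t).
have b0 : b - 1 != 0 by rewrite gt_eqF ?subr_gt0.
have cf := @cont_pos_pow (- b).
have h : (\int[mu]_(t in `[1%R, (1 + n.+1%:R)%R]) (expR (- b * ln t))%:E)%E @[n --> \oo]
   --> ((b - 1)^-1%:E)%E.
  have E n : (\int[mu]_(t in `[1%R, (1 + n.+1%:R)%R]) (expR (- b * ln t))%:E =
     (F (1 + n.+1%:R) - F 1)%:E)%E.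
    apply: (@FTC2_pos R (fun t => expR (- b * ln t)) F 1 (1 + n.+1%:R)).
    - exact: ltr01.
    - by rewrite ltrDl.
    - by apply: cf.
    move=> t t0.
    have h := is_derive_pow (1 - b) t0.
    have -> : expR (- b * ln t) = - (b - 1)^-1 * ((1 - b) / t * expR ((1 - b) * ln t)).
      have -> : (1 - b) * ln t = - b * ln t + ln t by ring.
      by rewrite expRD lnK ?posrE //; field; rewrite b0 gt_eqF.
    exact: is_deriveZ.
  under eq_fun do rewrite E.
  apply: cvg_EFin; first by apply: nearW.
  have := @cvg_pow_inv R (b - 1); rewrite subr_gt0 => /(_ b1) hc.
  have {}hc : (fun n : nat => expR ((1 - b) * ln (1 + n.+1%:R : R))) @ \oo --> (0 : R).
    rewrite -cvg_shiftS in hc; apply: cvg_trans hc; apply: near_eq_cvg; near=> n.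
    rewrite /= lnV ?posrE // -[n.+2%:R]natr1 [_ + 1]addrC; congr expR; ring.
  rewrite (_ : (b - 1)^-1 = - (b - 1)^-1 * 0 - F 1); last first.
    by rewrite /F ln1 !mulr0 expR0; ring.
  by apply: cvgB; [exact: cvgMr|exact: cvg_cst].
have := exhausty (cont_pos_measurableS cf _ H1_sub) _.
move=> /(_ (measurable_itv _) (fun t _ => expR_ge0 _)) h2.
by apply: (cvg_unique _ h2 h).
Unshelve. all: by end_near. Qed.

End RealMellin.

(** * The Mellin transform of psi on the real axis *)

Section MellinIdentity.
Variable R : realType.
Local Notation mu := (@lebesgue_measure R).
Local Notation H0 := (`]0%R, +oo[%classic : set R).
Local Notation H1 := (`[1%R, +oo[%classic : set R).
Implicit Types (a b x t : R).

Lemma integral_exp_scaled a l : 0 < a -> 0 < l ->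
  (\int[mu]_(t in H0) (expR (- (l * t)) * expR ((a - 1) * ln t))%:E =
   (expR (- a * ln l) * GammaR a)%:E)%E.
Proof.
move=> a0 l0; have If := integrable_gfun a0.
have -> : (\int[mu]_(t in H0) (expR (- (l * t)) * expR ((a - 1) * ln t))%:E =
   \int[mu]_(t in H0) ((expR (- a * ln l))%:E * (gfun a (l * t) * l)%:E))%E.
  apply: eq_integral => t; rewrite inE /= in_itv /= andbT => t0.
  rewrite -EFinM; congr EFin; rewrite /gfun lnM ?posrE // -{5}[l]lnK ?posrE //.
  by rewrite -!expRD; congr expR; ring.
rewrite ge0_integralZl.
- rewrite EFinM -integral_scale //.
  - by rewrite /GammaR fineK // integrable_fin_num.
  - by have h := @cont_pos_gfun R a; apply: h.
  - by move=> t _; exact: expR_ge0.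
- exact: measurable_itv.
- apply/measurable_EFinP; apply: cont_pos_measurable => t t0.
  apply: cvgM; last exact: cvg_cst.
  apply: (@continuous_comp _ _ _ (fun t : R => l * t) (gfun a)); first exact: cvgMr.
  by have h := @cont_pos_gfun R a; apply: h; rewrite mulr_gt0.
- by move=> t _; rewrite lee_fin mulr_ge0 ?expR_ge0 // ltW.
- by rewrite lee_fin expR_ge0.
Qed.

Definition zeta_real x : R := limn (series (fun n => expR (- x * ln n.+1%:R))).

(** The series of [psi] is integrated term by term, all terms being nonnegative; by scaling, the
    term of index [k] contributes [Gamma(x/2) (pi (k + 1)^2)^(-x/2)]. *)
Lemma integral_jfun x : 1 < x ->
  (\int[mu]_(t in H0) (jfun (x / 2 - 1) t)%:E =
   (GammaR (x / 2) * expR (- (x / 2) * ln pi) * zeta_real x)%:E)%E.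
Proof.
move=> x1; pose a := x / 2; have a0 : 0 < a by rewrite divr_gt0 //; lra.
have p0 := pi_gt0 R.
pose l (k : nat) : R := pi * k.+1%:R ^+ 2.
have l0 k : 0 < l k by rewrite mulr_gt0 ?exprn_gt0.
pose h k t : R := expR (- (l k * t)) * expR ((a - 1) * ln t).
have -> : (\int[mu]_(t in H0) (jfun (x / 2 - 1) t)%:E =
    \int[mu]_(t in H0) \sum_(0 <= k <oo) (h k t)%:E)%E.
  apply: eq_integral => t; rewrite inE /= in_itv /= andbT => t0.
  have pt : 0 < pi * t by rewrite mulr_gt0.
  have [_ ct] := theta_tail_ge0 pt.
  rewrite /jfun /psi /theta_tail mulrC -/a.
  rewrite -[expR _ * _](lim_seriesZ (expR ((a - 1) * ln t)) ct).
  rewrite -EFin_lim; last exact: is_cvg_seriesZ.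
  congr (limn _); apply/funext => n; rewrite /= /series /= -sumEFin.
  apply: eq_bigr => k _; congr EFin.
  have -> : h k t = expR ((a - 1) * ln t) * expR (- (pi * t * k.+1%:R ^+ 2)).
    by rewrite /h /l [RHS]mulrC; congr (expR _ * _); ring.
  by [].
rewrite integral_nneseries //; last 2 first.
- move=> k; apply/measurable_EFinP; apply: cont_pos_measurable.
  have h1 := @cont_pos_pow R (a - 1).
  have h2 := cont_posM (@cont_pos_cst R (- l k)) (@cont_pos_id R).
  have h3 := cont_posM (cont_pos_expR h2) h1.
  rewrite (_ : h k = fun t => expR (- l k * t) * expR ((a - 1) * ln t)); first by apply: h3.
  by apply/funext => t; rewrite /h mulNr.
- by move=> k t _; rewrite lee_fin mulr_ge0 ?expR_ge0.
pose K := GammaR a * expR (- a * ln pi).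
have E k : (\int[mu]_(t in H0) (h k t)%:E = (K * expR (- x * ln k.+1%:R))%:E)%E.
  rewrite integral_exp_scaled //; congr EFin.
  rewrite /l lnM ?posrE ?exprn_gt0 // lnXn // /K mulrDr expRD [LHS]mulrC -!mulrA.
  by congr (_ * (_ * expR _)); rewrite /a -mulr_natl; field.
under eq_eseriesr do rewrite E.
have cz := cvg_series_pow x1.
rewrite -/K -[K * _](lim_seriesZ K cz) -EFin_lim; last exact: is_cvg_seriesZ.
congr (limn _); apply/funext => n; rewrite /= /series /= -sumEFin.
by apply: eq_bigr.
Qed.

Definition Jint a : R := (\int[mu]_(t in H1) jfun a t)%R.

Lemma integral_H0_split f : cont_pos f -> (forall t, 0 < t -> 0 <= f t) ->
  (\int[mu]_(t in H0) (f t)%:E = \int[mu]_(t in `]0%R, 1%R]) (f t)%:E +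
   \int[mu]_(t in H1) (f t)%:E)%E.
Proof.
move=> cf f0; have mf := cont_pos_measurable cf.
have e : H0 = (`]0%R, 1%R]%classic `|` `]1%R, +oo[%classic : set R).
  apply: (@itv_bndbnd_setU _ _ _ (BRight (1 : R))); first by rewrite bnd_simp ler01.
  by rewrite bnd_simp.
rewrite e ge0_integral_setU //=.
- congr (_ + _)%E; apply: integral_itv_obnd_cbnd; apply/measurable_EFinP.
  by apply: measurable_funS mf => //; rewrite e; exact: subsetUr.
- by apply/measurable_EFinP; rewrite -e.
- move=> t ht; have : H0 t by rewrite e.
  by rewrite /= in_itv /= andbT lee_fin; exact: f0.
- apply/eqP; rewrite -subset0 => t /= []; rewrite !in_itv /= andbT => /andP[_ h1] h2.
  by move: h1; rewrite leNgt h2.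
Qed.

(** The integral is split at 1 and the part over []0, 1]] inverted. By [psi_inv] it becomes the
    integral of [psi(t) t^(-a-1/2) + t^(-a-1/2) / 2 - t^(-a-1) / 2] with [a = x / 2], and the two
    pure powers give [1 / (x - 1)] and [1 / x]. *)
Lemma mellin_psi x : 1 < x ->
  GammaR (x / 2) * expR (- (x / 2) * ln pi) * zeta_real x =
  Jint (x / 2 - 1) + Jint (- (x / 2) - 2^-1) + (x - 1)^-1 - x^-1.
Proof.
move=> x1; apply: EFin_inj; rewrite -integral_jfun //.
pose a := x / 2; rewrite -/a; have a2 : 2^-1 < a by rewrite /a; lra.
rewrite integral_H0_split; last 2 first.
- by have h := @cont_pos_jfun R (a - 1); apply: h.
- by move=> t t0; exact: jfun_ge0.
rewrite integral_inv; last 2 first.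
- by have h := @cont_pos_jfun R (a - 1); apply: h.
- by move=> t t0; exact: jfun_ge0.
have mH : measurable H1 by exact: measurable_itv.
have IJ := @integrable_jfun R (- a - 2^-1).
have P b (b1 : 1 < b) : mu.-integrable H1 (EFin \o (fun t => expR (- b * ln t))).
  apply/integrableP; split.
    apply/measurable_EFinP; apply: cont_pos_measurableS => //.
    - by have h := @cont_pos_pow R (- b); apply: h.
    - exact: H1_sub.
  under eq_integral do rewrite /= ger0_norm ?expR_ge0 //.
  by rewrite integral_pow // ltry.
have I1 := P (a + 2^-1) ltac:(lra); have I2 := P (a + 1) ltac:(lra).
have -> : (\int[mu]_(t in H1) (jfun (a - 1) t^-1 * t ^- 2)%:E =
   \int[mu]_(t in H1) (jfun (- a - 2^-1) t + (2^-1 * expR (- (a + 2^-1) * ln t) +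
      (- 2^-1) * expR (- (a + 1) * ln t)))%:E)%E.
  apply: eq_integral => t; rewrite inE /= in_itv /= andbT => t1.
  have t0 : 0 < t by lra.
  congr EFin; rewrite /jfun psi_inv // lnV ?posrE //.
  have -> : t ^- 2 = expR (- 2 * ln t).
    by rewrite mulNr expRN mulr_natl -lnXn // lnK // posrE exprn_gt0.
  have -> : expR ((- a - 2^-1) * ln t) = expR (2^-1 * ln t) * (expR ((a - 1) * - ln t) * expR (- 2 * ln t)).
    by rewrite -!expRD; congr expR; field.
  have -> : expR (- (a + 2^-1) * ln t) = expR (2^-1 * ln t) * (expR ((a - 1) * - ln t) * expR (- 2 * ln t)).
    by rewrite -!expRD; congr expR; field.
  have -> : expR (- (a + 1) * ln t) = expR ((a - 1) * - ln t) * expR (- 2 * ln t).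
    by rewrite -!expRD; congr expR; field.
  by ring.
have Z1 : mu.-integrable H1 (EFin \o (fun t => 2^-1 * expR (- (a + 2^-1) * ln t))).
  by apply: integrableZlR.
have Z2 : mu.-integrable H1 (EFin \o (fun t => (- 2^-1) * expR (- (a + 1) * ln t))).
  by apply: integrableZlR.
have Z12 : mu.-integrable H1 (EFin \o (fun t => 2^-1 * expR (- (a + 2^-1) * ln t) +
    (- 2^-1) * expR (- (a + 1) * ln t))) by apply: integrableDR.
have h : (\int[mu]_(t in H1) (jfun (- a - 2^-1) t + (2^-1 * expR (- (a + 2^-1) * ln t) +
      (- 2^-1) * expR (- (a + 1) * ln t))) =
   Jint (- a - 2^-1) + (2^-1 * (a - 2^-1)^-1 - 2^-1 * a^-1))%R.
  rewrite RintegralD //.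
  rewrite RintegralD // !RintegralZl //.
  rewrite /Rintegral !integral_pow ?ltrDr //=; try lra.
  rewrite /Jint /Rintegral; congr (_ + (_ * _^-1 + _)); first by field.
  by rewrite mulNr addrK.
have fin (f : R -> R) : mu.-integrable H1 (EFin \o f) ->
    (\int[mu]_(t in H1) (f t)%:E = (\int[mu]_(t in H1) f t)%R%:E)%E.
  by move=> If; rewrite /Rintegral fineK // integrable_fin_num.
have If : mu.-integrable H1 (EFin \o (fun t => jfun (- a - 2^-1) t +
   (2^-1 * expR (- (a + 2^-1) * ln t) + (- 2^-1) * expR (- (a + 1) * ln t)))).
  by apply: integrableDR.
rewrite (fin _ If) h (fin _ (integrable_jfun (a - 1))).
rewrite -EFinD; congr EFin; rewrite /Jint /a.
have -> : 2^-1 * (x / 2 - 2^-1)^-1 = (x - 1)^-1 by field; rewrite gt_eqF //=; lra.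
have -> : 2^-1 * (x / 2)^-1 = x^-1 by field; rewrite gt_eqF //; lra.
by ring.
Qed.

End MellinIdentity.

(** * The completed zeta function *)

Section CompletedZeta.
Variable R : realType.
Local Notation mu := (@lebesgue_measure R).
Local Notation H1 := (`[1%R, +oo[%classic : set R).
Local Notation C := R[i].
Local Notation Re := complex.Re.
Local Notation Im := complex.Im.
Implicit Types (s z w : C) (a x t : R).

Lemma analytic_cexp s : analytic_at (@cexp R) s.
Proof.
have h0 : analytic_at (@cexp R) (1 * s + - s).
  rewrite mul1r subrr; exists (cexp_coeff R); apply/nbhsCP; exists 1 => // z _.
  by rewrite subr0; have [] := psum_cexp z.
have h := analyticM (analytic_cst (cexp s) s) (analytic_comp_affine h0).
apply: analytic_near h _ _; apply/nbhsCP; exists 1 => // z _.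
by rewrite -cexpD mul1r addrC subrK.
Qed.

Lemma analytic_cpow x s : analytic_at (@cpow R x) s.
Proof.
have h : analytic_at (@cexp R) ((ln x)%:C * s + 0) by exact: analytic_cexp.
apply: analytic_near (analytic_comp_affine h) _ _.
by apply/nbhsCP; exists 1 => // z _; rewrite addr0 mulrC.
Qed.

Definition psi_weight t : C := (psi t * expR (- ln t))%:C.

(** The integral of [psi(t) t^(s/2) dt / t] over [[1, oo[]. *)
Definition J1 s : C := cint mu H1 (fun t => psi_weight t * cexp (s * (ln t / 2)%:C)).

Lemma normc_J1_integrand s t : 1 <= t ->
  normc (psi_weight t * cexp (s * (ln t / 2)%:C)) = jfun (Re s / 2 - 1) t.
Proof.
move=> t1; have t0 : 0 < t by lra.
rewrite normcM normcR ger0_norm ?mulr_ge0 ?expR_ge0 ?psi_ge0 //.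
rewrite normc_cexp mulrC [s * _]mulrC Re_real_mul /jfun mulrCA -expRD.
by congr (_ * expR _); field.
Qed.

Lemma measurable_ln1 : measurable_fun H1 (fun t : R => ln t / 2).
Proof.
have h := cont_posM (@cont_pos_ln R) (@cont_pos_cst R 2^-1).
by apply: (cont_pos_measurableS h); [exact: measurable_itv|exact: H1_sub].
Qed.

Lemma cmeas_psi_weight : cmeas H1 psi_weight.
Proof.
apply: cmeasR.
have h1 := cont_posM (@cont_pos_cst R (- 1)) (@cont_pos_ln R).
have h := cont_posM (@cont_pos_psi R) (cont_pos_expR h1).
rewrite (_ : (fun t => psi t * expR (- ln t)) = (fun t : R => psi t * expR (- 1 * ln t))).
  by apply: (cont_pos_measurableS h); [exact: measurable_itv|exact: H1_sub].
by apply/funext => t; rewrite mulN1r.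
Qed.

Lemma integrable_J1_moment s r : 0 <= r ->
  mu.-integrable H1 (EFin \o (fun t =>
    normc (psi_weight t * cexp (s * (ln t / 2)%:C)) * expR (r * `|ln t / 2|))).
Proof.
move=> r0; have h := @integrable_jfun R (Re s / 2 - 1 + r / 2).
apply: eq_integrable h; first exact: measurable_itv.
move=> t; rewrite inE /= in_itv /= andbT => t1; congr EFin.
rewrite -[RHS]/(normc (psi_weight t * cexp (s * (ln t / 2)%:C)) * expR (r * `|ln t / 2|)).
rewrite normc_J1_integrand // ger0_norm ?divr_ge0 ?ln_ge0 //.
by rewrite /jfun -mulrA -expRD; congr (_ * expR _); field.
Qed.

Lemma J1_analytic s : analytic_at J1 s.
Proof.
apply: (analytic_exp_integral _ _ _ (ltr01 : 0 < 1 :> R)).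
- exact: measurable_itv.
- exact: cmeas_psi_weight.
- exact: measurable_ln1.
- exact: integrable_J1_moment.
Qed.

Lemma J1_real x : J1 x%:C = (Jint (x / 2 - 1))%:C.
Proof.
have e t : t \in H1 -> psi_weight t * cexp (x%:C * (ln t / 2)%:C) = (jfun (x / 2 - 1) t)%:C.
  rewrite inE /= in_itv /= andbT => t1.
  rewrite -realCM cexpR -realCM /jfun -mulrA -expRD.
  by congr ((_ * expR _)%:C); field.
rewrite /J1 /cint.
rewrite (@eq_Rintegral _ _ _ mu _ (jfun (x / 2 - 1))); last by move=> t /e ->.
rewrite [X in _ +i* X](_ : _ = 0) //.
rewrite (@eq_Rintegral _ _ _ mu _ (fun=> 0)) ?Rintegral_cst ?mul0r // => t /e ->.
by [].
Qed.

Definition Xi s : C := 1 + s * (s - 1) * (J1 s + J1 (1 - s)).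

Lemma Xi_analytic s : analytic_at Xi s.
Proof.
apply: analyticD; first exact: analytic_cst.
apply: analyticM.
  apply: analyticM; first exact: analytic_id.
  by have := analytic_affine 1 (- 1) s; under eq_fun do rewrite mul1r.
apply: analyticD; first exact: J1_analytic.
have h : analytic_at J1 (- 1 * s + 1) by exact: J1_analytic.
have := analytic_comp_affine h.
by under eq_fun do rewrite mulN1r addrC.
Qed.

(** Writing [s Gamma(s/2)] as [2 Gamma(s/2 + 1)] absorbs the factor [s] of [xi]; as [rGamma] is
    entire, only the pole at 1 remains. *)
Definition zt s : C :=
  Xi s * cpow pi (s / 2%:R) * rGamma (s / 2%:R + 1) / (2%:R * (s - 1)).

Lemma zt_analytic s : s != 1 -> analytic_at zt s.
Proof.
move=> s1; apply: analyticM; last first.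
  apply: analyticV; last by rewrite mulf_neq0 ?subr_eq0 // pnatr_eq0.
  have := analytic_affine 2%:R (- 2%:R) s.
  by under eq_fun do rewrite -[- 2%:R]mulr1 mulNr -mulrBr.
apply: analyticM.
  apply: analyticM; first exact: Xi_analytic.
  have h : analytic_at (@cpow R pi) (2%:R^-1 * s + 0) by exact: analytic_cpow.
  have := analytic_comp_affine h.
  by under eq_fun do rewrite addr0 mulrC.
have h : analytic_at (@rGamma R) (2%:R^-1 * s + 1) by exact: rGamma_analytic.
have {}h := analytic_comp_affine h.
suff -> : (fun z : C => rGamma (z / 2%:R + 1)) = (fun z => rGamma (2%:R^-1 * z + 1)) by [].
by apply/funext => z; rewrite [z / _]mulrC.
Qed.

Lemma half_real x : x%:C / 2%:R = (x / 2)%:C :> C.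
Proof. by rewrite realCM realCV natC. Qed.

Lemma zt_real x : 1 < x -> zt x%:C = (zeta_real x)%:C.
Proof.
move=> x1; have x0 : 0 < x by lra.
have a0 : 0 < x / 2 by rewrite divr_gt0.
have G0 := GammaR_gt0 a0.
have hG : rGamma (x%:C / 2%:R + 1) = ((x / 2 * GammaR (x / 2))^-1)%:C.
  have e : x%:C / 2%:R + 1 = (x / 2 + 1)%:C :> C by rewrite half_real rmorphD.
  have := @Gamma_euler_rGamma R (x%:C / 2%:R + 1).
  rewrite e Gamma_euler_real GammaRS // => /(_ ltac:(rewrite /=; lra)) h.
  apply: (@mulfI _ ((x / 2 * GammaR (x / 2))%:C)); first by rewrite fmorph_eq0 mulf_neq0 ?gt_eqF.
  by rewrite h -realCM divff // mulf_neq0 // gt_eqF.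
have m := mellin_psi x1.
have hX : Xi x%:C = (x * (x - 1) * (GammaR (x / 2) * expR (- (x / 2) * ln pi) * zeta_real x))%:C.
  rewrite /Xi (_ : 1 - x%:C = (1 - x)%:C); last by rewrite rmorphB.
  rewrite !J1_real (_ : x%:C - 1 = (x - 1)%:C); last by rewrite rmorphB.
  rewrite -realCM -rmorphD -realCM -(rmorph1 (real_complex R)) -rmorphD; congr (_%:C).
  rewrite m; have -> : (1 - x) / 2 - 1 = - (x / 2) - 2^-1 by field.
  field; rewrite (gt_eqF x0) /= gt_eqF //; lra.
rewrite /zt hX hG half_real /cpow -realCM cexpR (_ : x%:C - 1 = (x - 1)%:C); last by rewrite rmorphB.
rewrite natC -!realCM -realCV -realCM; congr (_%:C).
rewrite mulNr expRN; have := expR_gt0 (x / 2 * ln pi : R); move: (expR _) => E E0.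
by field; rewrite (gt_eqF x0) (gt_eqF G0) (gt_eqF E0) /= gt_eqF //; lra.
Qed.

Lemma Dirichlet_real x : 1 < x ->
  series (fun n => cpow n.+1%:R (- x%:C)) @ \oo --> ((zeta_real x)%:C : C).
Proof.
move=> x1; have cz := cvg_series_pow x1.
have e n : cpow n.+1%:R (- x%:C) = (expR (- x * ln n.+1%:R))%:C :> C.
  by rewrite /cpow -rmorphN -realCM cexpR.
rewrite (funext e); apply: cvgC_ReIm.
  rewrite (_ : (fun n => _) = series (fun n => expR (- x * ln n.+1%:R))); first exact: cz.
  by apply/funext => n; rewrite /series /= Re_sum.
rewrite (_ : (fun n => _) = (fun=> 0)); first exact: cvg_cst.
by apply/funext => n; rewrite /series /= Im_sum big1.
Qed.

Lemma cvgC_unique (u : nat -> C) (l l' : C) : u @ \oo --> l -> u @ \oo --> l' -> l = l'.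
Proof.
have e (x : C) : u @ \oo --> x -> lim (u @ \oo) = x.
  by move=> h; apply: cvg_lim h; exact: norm_hausdorff.
by move=> /e <- /e <-.
Qed.

Lemma is_zeta_zt : is_zeta zt.
Proof.
split; last exact: zt_analytic.
move=> s s1; have [D [Da Ds]] := Dirichlet_analytic R.
suff <- : D s = zt s by exact: Ds.
have h12 : 1 < 2 :> R by lra.
have za z : 1 < Re z -> analytic_at zt z.
  move=> z1; apply: zt_analytic; apply/eqP => z1'.
  by move: z1; rewrite z1' /= ltxx.
have eqr x : 2 <= x -> D x%:C = zt x%:C.
  move=> x2; have x1 : 1 < x by lra.
  by rewrite zt_real //; apply: cvgC_unique (Ds x%:C x1) (Dirichlet_real x1).
exact: (analytic_eq_halfplane h12 Da za eqr s1).
Qed.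

End CompletedZeta.

(** * Identification of xi near 1/2 *)

Section XiNearHalf.
Variable R : realType.
Local Notation C := R[i].
Local Notation Re := complex.Re.
Local Notation Im := complex.Im.
Implicit Types (s z w : C) (x t : R).

Lemma zetaP : is_zeta (@zeta R).
Proof.
by apply: (@getPex _ (@is_zeta R)); exists (@zt R); exact: is_zeta_zt.
Qed.

(** Both functions equal the Dirichlet series near 2. The direct segment to [1 / 2] would cross the
    pole, so agreement is carried from 2 to [2 + i] and then to [1 / 2]; the second segment has real
    part 1 at [t = 2 / 3] but imaginary part 0 only at [t = 1]. *)
Lemma zeta_zt_near_half : \forall z \near (2^-1%:C : C), zeta z = zt z.
Proof.
have [zD za] := zetaP; have [tD ta] := is_zeta_zt R.
have both s : s != 1 -> analytic_at (@zeta R) s /\ analytic_at (@zt R) s.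
  by move=> s1; split; [exact: za|exact: ta].
pose a : C := 2 +i* 0; pose b : C := 2 +i* 1.
have Ra : Re a = 2 by []. have Rb : Re b = 2 by []. have Ib : Im b = 1 by [].
have R1 : Re (1 : C) = 1 by []. have I1 : Im (1 : C) = 0 by [].
have Rc : Re (2^-1%:C : C) = 2^-1 by []. have Ic : Im (2^-1%:C : C) = 0 by [].
have near_a : \forall z \near a, zeta z = zt z.
  apply/nbhsCP; exists 1 => // z za1.
  have z1 : 1 < Re z.
    have := le_lt_trans (ler_Re (z - a)) za1; rewrite ReD ReN ltr_norml => /andP[h _].
    move: h; rewrite Ra; lra.
  exact: cvgC_unique (zD z z1) (tD z z1).
have near_b : \forall z \near b, zeta z = zt z.
  apply: analytic_eq_segment near_a => t _; apply: both; apply/eqP => e.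
  have := congr1 (@complex.Re R) e; rewrite ReD Re_real_mul ReD ReN Ra Rb R1.
  by lra.
apply: analytic_eq_segment near_b => t _; apply: both; apply/eqP => e.
have hr := congr1 (@complex.Re R) e; have hi := congr1 (@complex.Im R) e; move: hr hi.
rewrite ReD Re_real_mul ReD ReN Rb R1 Rc.
rewrite ImD Im_real_mul ImD ImN Ib I1 Ic.
by lra.
Qed.

Lemma xi_formula_Xi s : 0 < Re s -> s != 1 -> zeta s = zt s -> xi_formula s = Xi s.
Proof.
move=> s0 s1 e; rewrite /xi_formula e /zt.
have h2 : 2%:R != 0 :> C by rewrite pnatr_eq0.
have hs : s / 2%:R = (2^-1)%:C * s by rewrite mulrC realCV natC.
have sh : 0 < Re (s / 2%:R) by rewrite hs Re_real_mul mulr_gt0.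
have -> : Gamma (s / 2%:R) = Gamma_euler (s / 2%:R) by rewrite /Gamma sh.
have g1 : (s / 2%:R) * Gamma_euler (s / 2%:R) * rGamma (s / 2%:R + 1) = 1.
  rewrite -Gamma_eulerS // Gamma_euler_rGamma // ReD [Re 1]/(1 : R).
  by rewrite addr_gt0.
have c1 : cpow pi (- s / 2%:R) * cpow pi (s / 2%:R) = 1 :> C.
  by rewrite /cpow -cexpD mulNr mulNr addNr cexp0.
have n1 : s - 1 != 0 by rewrite subr_eq0.
rewrite invfM.
move: (Gamma_euler (s / 2%:R)) (rGamma (s / 2%:R + 1)) (cpow pi (- s / 2%:R)) (cpow pi (s / 2%:R)) g1 c1 => G r p q g1 c1.
have -> : s * (s - 1) * p * G * (Xi s * q * r * (2%:R^-1 / (s - 1))) =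
  Xi s * (s / 2%:R * G * r) * (p * q) * ((s - 1) / (s - 1)) by ring.
by rewrite g1 c1 divff // !mulr1.
Qed.

(** [xi] is a punctured limit, so equality around [s] and continuity of [Xi] determine its value. *)
Lemma xi_Xi s (d : R) : 0 < d ->
  (forall z, normc (z - s) < d -> xi_formula z = Xi z) -> xi s = Xi s.
Proof.
move=> d0 H; rewrite /xi; apply: cvg_lim; first exact: norm_hausdorff.
have /cvg_nbhsCP hc := analytic_continuous (Xi_analytic s).
apply/cvgCP/cvgrPdist_lt => e /hc[d' d'0 hd]; apply/(@nbhsCP R s).
exists (Num.min d d'); first by rewrite lt_min d0.
move=> z; rewrite lt_min => /andP[z1 z2] _.
by rewrite sub0r normrN ger0_norm ?normc_ge0 // H // hd.
Qed.

Lemma xi_Xi_near_half : exists2 d : R, 0 < d &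
  forall w, normc w < d -> xi (2^-1%:C + w) = Xi (2^-1%:C + w).
Proof.
have [d d0 H] := (nbhsCP _ _).1 zeta_zt_near_half.
(* Points within [e] of [1 / 2 + w] stay within [2 e] of [1 / 2]: inside the disc of radius [d], and
   with real part between [1 / 4] and [3 / 4], hence away from 1 and where [Gamma] is Euler's
   integral. *)
pose e := Num.min (d / 2) (8^-1).
have e0 : 0 < e by rewrite lt_min divr_gt0 //= invr_gt0.
exists e => // w we; apply: (@xi_Xi _ e) => // z ze.
have zh : normc (z - 2^-1%:C) < e + e.
  have -> : z - 2^-1%:C = (z - (2^-1%:C + w)) + w by ring.
  by apply: le_lt_trans (le_normcD _ _) _; rewrite ltrD.
have ed : e <= d / 2 by rewrite ge_min lexx.
have e8 : e <= 8^-1 by rewrite ge_min lexx orbT.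
have Rc : Re (2^-1%:C : C) = 2^-1 by [].
have : `|Re z - 2^-1| < 4^-1.
  have := ler_Re (z - 2^-1%:C); rewrite ReD ReN Rc.
  by move=> h; apply: le_lt_trans h _; lra.
rewrite ltr_norml => /andP[h1 h2].
apply: xi_formula_Xi; [by lra| |by apply: H; lra].
by apply/eqP => z1; have R1 : Re (1 : C) = 1 by []; move: h2; rewrite z1 R1; lra.
Qed.

End XiNearHalf.

(** * Taylor coefficients of Xi at 1/2 *)

Section Moments.
Variable R : realType.
Local Notation mu := (@lebesgue_measure R).
Local Notation H1 := (`[1%R, +oo[%classic : set R).
Implicit Types (a t : R) (f g : R -> R) (n m : nat).

(** The integrands need not be ordered pointwise: integration by parts orders only their integrals
    over each [[1, b]]. *)
Lemma le_Rintegral_H1 f g : cont_pos f -> cont_pos g ->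
  (forall t, 1 <= t -> 0 <= f t) -> (forall t, 1 <= t -> 0 <= g t) ->
  mu.-integrable H1 (EFin \o f) -> mu.-integrable H1 (EFin \o g) ->
  (forall b : R, 1 < b -> (\int[mu]_(t in `[1, b]) f t <= \int[mu]_(t in `[1, b]) g t)%R) ->
  (\int[mu]_(t in H1) f t <= \int[mu]_(t in H1) g t)%R.
Proof.
move=> cf cg f0 g0 If Ig fg.
have lim h : cont_pos h -> (forall t, 1 <= t -> 0 <= h t) ->
    mu.-integrable H1 (EFin \o h) ->
    (fun n : nat => \int[mu]_(t in `[1%R, (1 + n.+1%:R)%R]) h t)%R @ \oo -->
    (\int[mu]_(t in H1) h t)%R.
  move=> ch h0 Ih; apply: fine_cvg; rewrite fineK ?integrable_fin_num //.
  apply: exhausty => //.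
  by apply: (cont_pos_measurableS ch); [exact: measurable_itv|exact: H1_sub].
apply: (ler_cvg_to (lim f cf f0 If) (lim g cg g0 Ig)).
by near=> n; apply: fg; rewrite ltrDl.
Unshelve. all: by end_near. Qed.

Definition ell t : R := ln t / 2.
(** The moment integrand with [psi] replaced by its first term. The exponent [- 3 / 4] is
    [s / 2 - 1] at [s = 1 / 2]. *)
Definition gmom n t : R := expR (- (pi * t)) * expR (- (3 / 4) * ln t) * ell t ^+ n.
Definition pmom n t : R := jfun (- (3 / 4)) t * ell t ^+ n.

Lemma ell_ge0 t : 1 <= t -> 0 <= ell t.
Proof. by move=> t1; rewrite divr_ge0 ?ln_ge0. Qed.

Lemma cont_pos_ell n : cont_pos (fun t => ell t ^+ n).
Proof.
have h := cont_posM (@cont_pos_ln R) (@cont_pos_cst R 2^-1).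
elim: n => [|n IH].
  by have h0 := @cont_pos_cst R 1; apply: h0.
have -> : (fun t => ell t ^+ n.+1) = (fun t => (ln t * 2^-1) * ell t ^+ n).
  by apply/funext => t; rewrite exprS.
by have h1 := cont_posM h IH; apply: h1.
Qed.

Lemma cont_pos_pmom n : cont_pos (pmom n).
Proof.
by have h := cont_posM (@cont_pos_jfun R (- (3 / 4))) (@cont_pos_ell n); apply: h.
Qed.

Lemma cont_pos_epow a : cont_pos (fun t : R => expR (- (pi * t)) * expR (a * ln t)).
Proof.
have h1 := cont_posM (@cont_pos_cst R (- pi)) (@cont_pos_id R).
have h := cont_posM (cont_pos_expR h1) (@cont_pos_pow R a).
suff -> : (fun t : R => expR (- (pi * t)) * expR (a * ln t)) =
  (fun t => expR (- pi * t) * expR (a * ln t)) by apply: h.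
by apply/funext => t; rewrite mulNr.
Qed.

Lemma cont_pos_gmom n : cont_pos (gmom n).
Proof.
by have h := cont_posM (@cont_pos_epow (- (3 / 4))) (@cont_pos_ell n); apply: h.
Qed.

Lemma pmom_ge0 n t : 1 <= t -> 0 <= pmom n t.
Proof.
by move=> t1; rewrite mulr_ge0 ?exprn_ge0 ?ell_ge0 // jfun_ge0 // (lt_le_trans ltr01).
Qed.

Lemma gmom_ge0 n t : 1 <= t -> 0 <= gmom n t.
Proof. by move=> t1; rewrite !mulr_ge0 ?expR_ge0 ?exprn_ge0 ?ell_ge0. Qed.

Lemma gmom_le_pmom n t : 1 <= t -> gmom n t <= pmom n t.
Proof.
move=> t1; have t0 : 0 < t by lra.
rewrite ler_wpM2r ?exprn_ge0 ?ell_ge0 // ler_wpM2r ?expR_ge0 //.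
by apply: theta_tail_ge; rewrite mulr_gt0 ?pi_gt0.
Qed.

Lemma pmom_le_gmom n t : 1 <= t -> pmom n t <= 2 * gmom n t.
Proof.
move=> t1; rewrite /gmom !mulrA ler_wpM2r ?exprn_ge0 ?ell_ge0 // ler_wpM2r ?expR_ge0 //.
by apply: theta_tail_le; have p2 := pi_ge2 R; nra.
Qed.

Lemma integrable_pmom n : mu.-integrable H1 (EFin \o pmom n).
Proof.
(* The power is absorbed by [v^n <= n! e^v] at [v = ell t], where [e^v = t^(1/2)]. *)
apply: (@cont_pos_integrableS _ _ (fun t => n`!%:R * jfun (- (3 / 4) + 2^-1) t)).
- exact: measurable_itv.
- exact: H1_sub.
- by have h := @cont_pos_pmom n; apply: h.
- move=> t; rewrite /= in_itv /= andbT => t1; have t0 : 0 < t by lra.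
  rewrite ger0_norm ?pmom_ge0 // /pmom /jfun.
  have -> : expR ((- (3 / 4) + 2^-1) * ln t) = expR (- (3 / 4) * ln t) * expR (ell t).
    by rewrite -expRD /ell; congr expR; field.
  rewrite [leRHS]mulrCA -!mulrA.
  rewrite ler_wpM2l ?psi_ge0 //.
  rewrite [leRHS]mulrCA ler_wpM2l ?expR_ge0 //.
  rewrite -ler_pdivrMl ?ltr0n ?fact_gt0 // mulrC.
  have l0 := ell_ge0 t1.
  apply: le_trans (sum_exp_le n.+1 l0).
  by rewrite big_ord_recr /= lerDr sumr_ge0 // => i _; rewrite divr_ge0 ?exprn_ge0.
- by apply: integrableZlR; [exact: measurable_itv|exact: integrable_jfun].
Qed.

Lemma integrable_gmom n : mu.-integrable H1 (EFin \o gmom n).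
Proof.
apply: (@cont_pos_integrableS _ _ (pmom n)).
- exact: measurable_itv.
- exact: H1_sub.
- by have h := @cont_pos_gmom n; apply: h.
- move=> t; rewrite /= in_itv /= andbT => t1.
  by rewrite ger0_norm ?gmom_ge0 ?gmom_le_pmom.
- exact: integrable_pmom.
Qed.

Definition Mom n : R := (\int[mu]_(t in H1) pmom n t)%R.
Definition Amom n : R := (\int[mu]_(t in H1) gmom n t)%R.

Lemma Mom_ge0 n : 0 <= Mom n.
Proof.
by apply: Rintegral_ge0 => t; rewrite /= in_itv /= andbT; exact: pmom_ge0.
Qed.

Lemma Amom_le_Mom n : Amom n <= Mom n.
Proof.
apply: le_Rintegral; first exact: measurable_itv.
- exact: integrable_gmom.
- exact: integrable_pmom.
by move=> t; rewrite /= in_itv /= andbT; exact: gmom_le_pmom.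
Qed.

Lemma Mom_le_Amom n : Mom n <= 2 * Amom n.
Proof.
rewrite /Amom -RintegralZl; [|exact: measurable_itv|exact: integrable_gmom].
apply: le_Rintegral; first exact: measurable_itv.
- exact: integrable_pmom.
- by apply: integrableZlR; [exact: measurable_itv|exact: integrable_gmom].
by move=> t; rewrite /= in_itv /= andbT; exact: pmom_le_gmom.
Qed.

Lemma Mom0_gt0 : 0 < Mom 0.
Proof.
apply: (@Rintegral_gt0 _ _ _ (expR (- (pi * 2)) * expR (- (3 / 4) * ln 2))).
- exact: measurable_itv.
- by move=> t; rewrite /= !in_itv /= andbT => /andP[].
- exact: integrable_pmom.
- by move=> t; rewrite /= in_itv /= andbT; exact: pmom_ge0.
- by rewrite mulr_gt0 ?expR_gt0.
move=> t /andP[t1 t2]; apply: le_trans (gmom_le_pmom _ t1).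
have t0 : 0 < t by lra.
rewrite /gmom expr0 mulr1 ler_pM ?expR_ge0 ?ler_expR //.
  by rewrite lerN2 ler_wpM2l // ltW // pi_gt0.
by rewrite !mulNr lerN2 ler_wpM2l // ler_ln ?posrE.
Qed.

(* Integration by parts: [F] below is nonnegative and vanishes at [1], so its
   derivative [h - p] has a nonnegative integral over every [[1, b]]. *)
Lemma AmomS n : Amom n.+1 <= n.+1%:R / 2 * Amom n.
Proof.
have mH : measurable H1 by exact: measurable_itv.
pose h t : R := n.+1%:R / 2 * gmom n t.
pose p t : R := (pi * t - 4^-1) * gmom n.+1 t.
pose F t : R := expR (- (pi * t)) * expR (4^-1 * ln t) * ell t ^+ n.+1.
have ch : cont_pos h.
  by have h1 := cont_posM (@cont_pos_cst R (n.+1%:R / 2)) (@cont_pos_gmom n); apply: h1.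
have cp : cont_pos p.
  have h1 := cont_posM (@cont_pos_cst R pi) (@cont_pos_id R).
  have h2 := cont_posD h1 (@cont_pos_cst R (- 4^-1)).
  by have h3 := cont_posM h2 (@cont_pos_gmom n.+1); apply: h3.
have cg : cont_pos (gmom n.+1) by have h1 := @cont_pos_gmom n.+1; apply: h1.
have h0 t : 1 <= t -> 0 <= h t.
  by move=> t1; rewrite mulr_ge0 ?gmom_ge0 ?divr_ge0.
have dF t : 0 < t -> is_derive t 1 F (h t - p t).
  move=> t0; have d1 := is_derive_pow 4^-1 t0.
  have d2 : is_derive t 1 (fun t => expR (- (pi * t))) (- pi * expR (- (pi * t))).
    have d0 : is_derive t 1 (fun t : R => - (pi * t)) (- pi) by apply: is_derive_eq; rewrite /GRing.scale /= mulr1.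
    have hc := @is_derive1_comp R expR _ t _ _ (is_derive_expR _) d0.
    by apply: (is_derive_eq hc); rewrite mulrC.
  have d3 : is_derive t 1 ell (t^-1 / 2).
    have dl := is_derive1_ln t0.
    by rewrite /ell; apply: is_derive_eq; rewrite /GRing.scale /=; ring.
  have d4 : is_derive t 1 (fun t => ell t ^+ n.+1) (n.+1%:R * ell t ^+ n * (t^-1 / 2)).
    by have := is_deriveX n.+1 d3; rewrite exprfctE.
  have d5 := is_deriveM (is_deriveM d2 d1) d4.
  apply: (is_derive_eq d5); rewrite /GRing.scale /= /h /p /gmom.
  have -> : expR (- (3 / 4) * ln t) = expR (4^-1 * ln t) / t.
    by rewrite (invr_expR_ln t0) -expRD; congr expR; field.
  rewrite mulrfctE exprS; field.
  by rewrite gt_eqF.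
apply: (@le_trans _ _ (\int[mu]_(t in H1) h t)%R); last first.
  rewrite /h RintegralZl //; exact: integrable_gmom.
apply: le_Rintegral_H1 => //.
- exact: gmom_ge0.
- exact: integrable_gmom.
- by apply: integrableZlR => //; exact: integrable_gmom.
move=> b b1.
have Ic f : cont_pos f -> mu.-integrable `[1, b] (EFin \o f).
  by move=> cf; apply: cont_pos_integrable => //; exact: ltr01.
apply: (@le_trans _ _ (\int[mu]_(t in `[1, b]) p t)%R).
  apply: le_Rintegral; [exact: measurable_itv|exact: Ic|exact: Ic|].
  move=> t; rewrite /= in_itv /= => /andP[t1 _].
  (* [p] dominates [gmom n.+1] since [pi t - 1/4 >= 1] for [t >= 1]. *)
  by rewrite /p ler_peMl ?gmom_ge0 //; have p2 := pi_ge2 R; nra.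
rewrite -subr_ge0 -RintegralB; [|exact: measurable_itv|exact: Ic|exact: Ic].
have cf : cont_pos (fun t => h t - p t).
  have hn := cont_posM (@cont_pos_cst R (- 1)) cp.
  have hs := cont_posD ch hn.
  suff -> : (fun t => h t - p t) = (fun t => h t + - 1 * p t) by apply: hs.
  by apply/funext => t; rewrite mulN1r.
rewrite /Rintegral (@FTC2_pos _ _ F 1 b) //=.
rewrite subr_ge0 /F /ell ln1 mul0r [X in _ * X <= _]expr0n /= mulr0.
by rewrite !mulr_ge0 ?expR_ge0 ?exprn_ge0 // ell_ge0 // ltW.
Qed.

(** The recurrence is exact enough only for the first term of [psi]: [Mom] is replaced by [Amom] at
    the cost of a factor 2, the index is lowered twice with factors [(n + 2) / 2] and [(n + 1) / 2],
    and the return to [Mom] costs nothing. *)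
Lemma Mom_SS n : Mom n.+2 <= n.+2%:R * n.+1%:R / 2 * Mom n.
Proof.
apply: le_trans (Mom_le_Amom _) _.
have h1 := AmomS n.+1; have h2 := AmomS n; have h3 := Amom_le_Mom n.
have n2 : 0 <= n.+2%:R :> R by []; have n1 : 0 <= n.+1%:R :> R by [].
apply: (@le_trans _ _ (2 * (n.+2%:R / 2 * (n.+1%:R / 2 * Mom n)))).
  rewrite ler_wpM2l //; apply: le_trans h1 _; rewrite ler_wpM2l ?divr_ge0 //.
  by apply: le_trans h2 _; rewrite ler_wpM2l ?divr_ge0.
by rewrite le_eqVlt; apply/orP; left; apply/eqP; field.
Qed.

End Moments.

(** * The power series of Xi at 1/2 *)

Section XiPowerSeries.
Variable R : realType.
Local Notation mu := (@lebesgue_measure R).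
Local Notation H1 := (`[1%R, +oo[%classic : set R).
Local Notation C := R[i].
Implicit Types (w l c : C) (a : nat -> C) (t : R) (n m : nat).

Lemma psumD a b w l l' : psum a w l -> psum b w l' ->
  psum (fun n => a n + b n) w (l + l').
Proof.
have FF := @filter_filter _ _ eventually_filter.
move=> [ha] [hb]; split; have h := @cvgcD _ _ _ FF _ _ _ _ ha hb.
rewrite (_ : series _ = fun n => series (fun n => a n * w ^+ n) n +
   series (fun n => b n * w ^+ n) n); first by apply: h.
apply/funext => n; rewrite /series /= -big_split /=.
by apply: eq_bigr => k _; rewrite mulrDl.
Qed.

Lemma psumZ c a w l : psum a w l -> psum (fun n => c * a n) w (c * l).
Proof.
have FF := @filter_filter _ _ eventually_filter.
move=> [ha]; split; have h := @cvgcM _ _ _ FF _ _ _ _ (cvg_cst c) ha.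
rewrite (_ : series _ = fun n => c * series (fun n => a n * w ^+ n) n); first by apply: h.
apply/funext => n; rewrite /series /= mulr_sumr.
by apply: eq_bigr => k _; rewrite mulrA.
Qed.

(** Multiplication of a power series by its variable. *)
Definition pshift (V : nmodType) (b : nat -> V) n : V := if n is m.+1 then b m else 0.

Lemma psum_shift a w l : psum a w l -> psum (pshift a) w (w * l).
Proof.
move=> /psumP h; apply/psumP; rewrite -cvg_shiftS.
have h2 : (fun n => normc w * normc (\sum_(k < n) a k * w ^+ k - l)) @ \oo --> (0 : R).
  by rewrite -(mulr0 (normc w)); apply: cvgMr.
suff -> : [sequence normc (\sum_(k < n.+1) pshift a k * w ^+ k - w * l)]_n =
   (fun n => normc w * normc (\sum_(k < n) a k * w ^+ k - l)) by exact: h2.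
apply/funext => n.
rewrite -[LHS]/(normc (\sum_(k < n.+1) pshift a k * w ^+ k - w * l)) -normcM mulrBr big_ord_recl mul0r add0r mulr_sumr.
congr (normc (_ - _)); apply: eq_bigr => k _.
by rewrite /= exprS mulrCA.
Qed.

Definition Mcoef n : R := Mom R n / n`!%:R.

(** The centre is absorbed into the weight, [t^(-1) t^(1/4) = t^(-3/4)]. The radius [|w| + 1] is at
    hand for every [w], as the weight is integrable against all powers of [t]. *)
Lemma psum_J1 w : psum (fun n => (Mcoef n)%:C) w (J1 (2^-1%:C + w)).
Proof.
have mH : measurable H1 by exact: measurable_itv.
pose g t : C := (jfun (- (3 / 4)) t)%:C.
pose r : R := normc w + 1.
have r0 : 0 < r by rewrite ltr_wpDl ?normc_ge0.
have wr : normc w <= r by rewrite lerDl ler01.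
have mg : cmeas H1 g.
  apply: cmeasR; apply: cont_pos_measurableS => //; last exact: H1_sub.
  by have h := @cont_pos_jfun R (- (3 / 4)); apply: h.
have gI : mu.-integrable H1 (EFin \o (fun t => normc (g t) * expR (r * `|ell t|))).
  apply: eq_integrable (@integrable_jfun R (- (3 / 4) + r / 2)) => //.
  move=> t; rewrite inE /= in_itv /= andbT => t1; congr EFin; have t0 : 0 < t by lra.
  rewrite -[RHS]/(normc (g t) * expR (r * `|ell t|)) normcR.
  rewrite ger0_norm ?jfun_ge0 // (ger0_norm (ell_ge0 t1)) /jfun -mulrA -expRD.
  by congr (_ * expR _); rewrite /ell; field.
have -> : J1 (2^-1%:C + w) = cint mu H1 (fun t => g t * cexp (w * (ell t)%:C)).
  apply: eq_cint => t; rewrite /= in_itv /= andbT => t1.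
  rewrite mulrDl cexpD mulrA; congr (_ * _).
  rewrite -realCM cexpR -realCM /jfun -mulrA -expRD.
  by congr ((_ * expR _)%:C); field.
have h := @psum_exp_moment _ (measurableTypeR R) R (@lebesgue_measure R) H1 mH g (@ell R) r mg
  (@measurable_ln1 R) gI w r0 wr.
apply: psum_eq h => n; rewrite /exp_moment cexp_coeffE /Mcoef mulrC realCM; congr (_ * _).
have e t : g t * (ell t)%:C ^+ n = (pmom n t)%:C by rewrite -realCX -realCM.
rewrite /cint; under eq_Rintegral do rewrite e.
rewrite [X in _ +i* X](_ : _ = 0) //.
rewrite (@eq_Rintegral _ _ _ mu _ (fun=> 0)) ?Rintegral_cst ?mul0r // => t _.
by rewrite e.
Qed.

(** Coefficients of [J1 (1/2 + u) + J1 (1/2 - u)]. *)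
Definition evenM n : R := (1 + (-1) ^+ n) * Mcoef n.

(** The factor [s (s - 1) = u^2 - 1/4] acts as a double shift minus a quarter. *)
Definition xcoef n : R :=
  (n == 0%N)%:R + (- 4^-1 * evenM n + pshift (pshift evenM) n).

Lemma psum_Xi w : psum (fun n => (xcoef n)%:C) w (Xi (2^-1%:C + w)).
Proof.
have h1 := psum_J1 w.
have h2 : psum (fun n => (Mcoef n)%:C * (-1) ^+ n) w (J1 (1 - (2^-1%:C + w))).
  apply/psum_scale.
  have -> : 1 - (2^-1%:C + w) = 2^-1%:C + -1 * w.
    have e : (1 : C) = 2^-1%:C + 2^-1%:C.
      by rewrite -rmorphD /= (_ : 2^-1 + 2^-1 = 1 :> R) //; field.
    by rewrite [in LHS]e; ring.
  exact: psum_J1.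
have h3 : psum (fun n => (evenM n)%:C) w (J1 (2^-1%:C + w) + J1 (1 - (2^-1%:C + w))).
  apply: psum_eq (psumD h1 h2) => n.
  rewrite /evenM; move: (Mcoef n) => x.
  by rewrite realCM rmorphD rmorph1 rmorphXn rmorphN rmorph1; ring.
have h0 : psum (fun n => (n == 0%N)%:R) w (1 : C).
  have := @psum_finite R (fun n => (n == 0%N)%:R) w 1.
  by rewrite big_ord1 expr0 mulr1; apply; case.
have h := psumD h0 (psumD (psumZ (- 4^-1)%:C h3) (psum_shift (psum_shift h3))).
have -> : Xi (2^-1%:C + w) = 1 + ((- 4^-1)%:C * (J1 (2^-1%:C + w) + J1 (1 - (2^-1%:C + w))) +
    w * (w * (J1 (2^-1%:C + w) + J1 (1 - (2^-1%:C + w))))).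
  rewrite /Xi; move: (J1 _ + J1 _) => J.
  have -> : (- 4^-1)%:C = - (2^-1%:C * 2^-1%:C) :> C.
    by rewrite -realCM -rmorphN; congr (_%:C); field.
  have e : (1 : C) = 2^-1%:C + 2^-1%:C.
    by rewrite -rmorphD /= (_ : 2^-1 + 2^-1 = 1 :> R) //; field.
  have -> : 2^-1%:C + w - 1 = w - 2^-1%:C by rewrite [in LHS]e; ring.
  by ring.
apply: psum_eq h => n; rewrite /xcoef.
have -> : pshift (pshift (fun n => (evenM n)%:C)) n = (pshift (pshift evenM) n)%:C.
  by case: n => [|[|n]].
move: (pshift _ _) (evenM n) => y x.
by rewrite !rmorphD rmorphM rmorph_nat.
Qed.

Lemma xcoef1 : xcoef 1 = 0.
Proof. by rewrite /xcoef /= /evenM expr1 subrr; ring. Qed.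

(** The moment inequality divided by factorials; it leaves [xcoef (n + 2) >= 7/8 * evenM n]. *)
Lemma evenM_SS n : 4^-1 * evenM n.+2 <= 8^-1 * evenM n.
Proof.
rewrite /evenM /Mcoef.
have -> : (-1) ^+ n.+2 = (-1) ^+ n :> R by rewrite !exprS !mulN1r opprK.
have s0 : 0 <= 1 + (-1) ^+ n :> R by rewrite -signr_odd; case: odd; rewrite ?expr1 ?expr0; lra.
rewrite mulrCA [leRHS]mulrCA ler_wpM2l // !factS !natrM.
have f0 : 0 < n`!%:R :> R by rewrite ltr0n fact_gt0.
have h := Mom_SS R n; move: h; set x := Mom R n.+2; set y := Mom R n.
move: (n.+2%:R) (n.+1%:R) (ltr0Sn R n.+1) (ltr0Sn R n) => p q p0 q0 h.
rewrite [leLHS]mulrA ler_pdivrMr ?mulr_gt0 //.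
have -> : 8^-1 * (y / n`!%:R) * (p * (q * n`!%:R)) = 4^-1 * (p * q / 2 * y) by field; rewrite gt_eqF.
by rewrite ler_wpM2l.
Qed.

Lemma evenM_ge0 n : 0 <= evenM n.
Proof.
rewrite /evenM mulr_ge0 //; last by rewrite divr_ge0 // Mom_ge0.
by rewrite -signr_odd; case: odd; rewrite ?expr1 ?expr0; lra.
Qed.

Lemma xcoef_ge0 n : 0 <= xcoef n.+1.
Proof.
case: n => [|n]; first by rewrite xcoef1.
by rewrite /xcoef /=; have := evenM_SS n; have := evenM_ge0 n; lra.
Qed.

Lemma xcoef2_gt0 : 0 < xcoef 2.
Proof.
have e0 : 0 < evenM 0 by rewrite /evenM /Mcoef expr0 divr1 mulr_gt0 // Mom0_gt0.
by rewrite /xcoef /=; have := evenM_SS 0; lra.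
Qed.

End XiPowerSeries.

(** * Derivatives of phi at -1 *)

Section TaylorIteration.
Variable R : realType.
Local Notation C := R[i].
Implicit Types (z w l h d : C) (a : nat -> R) (f g F : C -> C) (n m : nat) (r e : R).

Lemma normc_lerB z w : normc z - normc w <= normc (z - w).
Proof. by rewrite lerBlDr; apply: le_trans (le_normcD _ _); rewrite subrK. Qed.

Lemma cdiff_near f g z d e : 0 < e -> (forall u, normc (u - z) < e -> f u = g u) ->
  cdiff f z d -> cdiff g z d.
Proof.
move=> e0 fg [K [e' [K0 e'0 H]]]; exists K, (Num.min e e'); split=> //.
  by rewrite lt_min e0.
move=> h; rewrite lt_min => /andP[h1 h2].
rewrite -!fg; [exact: H| |]; first by rewrite subrr normc0.
by rewrite addrC addKr.
Qed.

Definition uinv z : C := 1 / (1 - z) - 2^-1%:C.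

Lemma half_uinv z : 2^-1%:C + uinv z = 1 / (1 - z).
Proof. by rewrite addrC subrK. Qed.

(** The remainder is exactly [h^2 / ((1 - z - h) (1 - z)^2)], and [|1 - z - h| >= q / 2] when
    [|h| < q / 2]. *)
Lemma cdiff_uinv z : z != 1 -> cdiff uinv z ((2^-1%:C + uinv z) ^+ 2).
Proof.
move=> z1; have n0 : 1 - z != 0 by rewrite subr_eq0 eq_sym.
pose q := normc (1 - z); have q0 : 0 < q by rewrite normc_gt0.
exists (2 / q ^+ 3), (q / 2); split; rewrite ?divr_ge0 ?exprn_ge0 ?divr_gt0 //.
  exact: ltW.
move=> h hq; have h1 : q / 2 <= normc (1 - z - h).
  apply: le_trans (normc_lerB (1 - z) h); rewrite -/q.
  by move: hq; move: (normc h) => x; lra.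
have q20 : 0 < q / 2 by rewrite divr_gt0.
have n1 : 1 - z - h != 0 by rewrite -normc_gt0; apply: lt_le_trans h1.
have -> : uinv (z + h) - uinv z - (2^-1%:C + uinv z) ^+ 2 * h =
    h ^+ 2 * ((1 - z - h)^-1 * (1 - z) ^- 2).
  rewrite half_uinv /uinv opprD addrA; field.
  by rewrite n0 n1.
rewrite !normcM !(normcV, normcX) -/q mulrC ler_wpM2r //.
  by rewrite mulr_ge0 ?normc_ge0.
have -> : 2 / q ^+ 3 = (q / 2)^-1 * (q ^+ 2)^-1 by field; rewrite gt_eqF.
rewrite ler_wpM2r ?invr_ge0 ?exprn_ge0 ?(ltW q0) //.
by rewrite lef_pV2 ?posrE // (lt_le_trans q20).
Qed.

Lemma near_N1_neq1 z : normc (z + 1) < 1 -> z != 1.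
Proof.
move=> h; apply/eqP => z1; move: h.
by rewrite z1 -[1 + 1]/(2%:R) natC normcR ger0_norm // ltrn1.
Qed.

(** One has [u = (z + 1) / (2 (1 - z))], and [|1 - z| >= 1] in this disc. *)
Lemma uinv_le z : normc (z + 1) < 1 -> normc (uinv z) <= normc (z + 1).
Proof.
move=> h; have n0 : 1 - z != 0 by rewrite subr_eq0 eq_sym near_N1_neq1.
have h1 : 1 <= normc (1 - z).
  have := normc_lerB 2%:R (z + 1); rewrite natC normcR ger0_norm // -natC.
  by rewrite (_ : 2%:R - (z + 1) = 1 - z); [lra|ring].
have e2 : 2^-1%:C = 2%:R^-1 :> C by rewrite realCV natC.
have -> : uinv z = (2^-1%:C) * ((z + 1) * (1 - z)^-1).
  by rewrite /uinv e2; field; rewrite n0.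
rewrite !normcM normcV normcR ger0_norm //.
have n1 := normc_ge0 (z + 1).
have v1 : (normc (1 - z))^-1 <= 1 by rewrite invf_le1 // (lt_le_trans ltr01).
have v0 : 0 <= (normc (1 - z))^-1 by rewrite invr_ge0 normc_ge0.
by nra.
Qed.

(** Near [-1], [f] is a power series in [u] with the real coefficients [a]. The condition [e <= 1]
    keeps [z] away from 1. *)
Definition urep f a : Prop := exists F r M e, [/\ 0 < r, 0 < e, e <= 1,
  (forall w, normc w < r -> psum (fun n => (a n)%:C) w (F w)) /\
  pbnd (fun n => (a n)%:C) r M &
  forall z, normc (z + 1) < e -> normc (uinv z) < r /\ f z = F (uinv z)].

Lemma urep_value f a : urep f a -> f (-1) = (a 0%N)%:C.
Proof.
move=> [F [r [M [e [r0 e0 _ [H _] fF]]]]].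
have /fF[_ ->] : normc (-1 + 1 : C) < e by rewrite addNr normc0.
have -> : uinv (-1) = 0.
  by rewrite /uinv opprK -[1 + 1]/(2%:R) mul1r realCV natC subrr.
have h0 : normc (0 : C) < r by rewrite normc0.
exact: psum_unique (H 0 h0) (psum0 (fun n => (a n)%:C)).
Qed.

Definition dcoef a n : R := n.+1%:R * a n.+1.
Definition Dop a n : R :=
  4^-1 * dcoef a n + (pshift (dcoef a) n + pshift (pshift (dcoef a)) n).

(* With [u = 1 / (1 - z) - 1 / 2] one has [u' = (1 / 2 + u) ^ 2], so [d / dz]
   acts on power series in [u] as [(1 / 4 + u + u ^ 2) d / du]. *)
Lemma urep_derive f a : urep f a -> urep f^`()%classic (Dop a).
Proof.
move=> [F [r [M [e [r0 e0 e1 [H Ma] fF]]]]].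
pose D w := F^`()%classic w.
have HD w : normc w < r -> psum (fun n => (dcoef a n)%:C) w (D w) /\ cdiff F w (D w).
  move=> wr; have [l hl cl] := psum_cdiff r0 Ma H wr.
  have -> : D w = l by exact: cdiff_derive1.
  split=> //; apply: psum_eq hl => n.
  by rewrite /pderiv /dcoef realCM natC.
pose G w := (2^-1%:C + w) ^+ 2 * D w.
have HG w : normc w < r -> psum (fun n => (Dop a n)%:C) w (G w).
  move=> /HD[h _].
  have h' := psumD (psumZ (4^-1)%:C h) (psumD (psum_shift h) (psum_shift (psum_shift h))).
  have -> : G w = (4^-1)%:C * D w + (w * D w + w * (w * D w)).
    rewrite /G; have -> : (4^-1)%:C = 2^-1%:C * 2^-1%:C :> C.
      by rewrite -realCM; congr (_%:C); field.
    have e2 : (1 : C) = 2^-1%:C + 2^-1%:C.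
      by rewrite -rmorphD /= (_ : 2^-1 + 2^-1 = 1 :> R) //; field.
    rewrite -[X in _ + (X + _)]mul1r [in RHS]e2; ring.
  apply: psum_eq h' => n; rewrite /Dop.
  have -> : pshift (fun n => (dcoef a n)%:C) n = (pshift (dcoef a) n)%:C by case: n.
  have -> : pshift (pshift (fun n => (dcoef a n)%:C)) n = (pshift (pshift (dcoef a)) n)%:C.
    by case: n => [|[|n]].
  move: (pshift (pshift (dcoef a)) n) (pshift (dcoef a) n) (dcoef a n) => u v x.
  by rewrite !rmorphD rmorphM.
have r20 : 0 < r / 2 by rewrite divr_gt0.
have r2r : r / 2 < r by lra.
(* The new coefficient bound is read off from convergence at the interior point [r / 2], at the
   price of half the radius. *)
have [M' _ HM'] : exists2 M', 0 <= M' & pbnd (fun n => (Dop a n)%:C) (r / 2) M'.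
  have := @HG (r / 2)%:C; rewrite normcR ger0_norm ?(ltW r20) // => /(_ r2r) /psum_bound.
  by rewrite normcR ger0_norm ?(ltW r20).
exists G, (r / 2), M', (Num.min e (r / 2)); split=> //.
- by rewrite lt_min e0.
- by rewrite ge_min e1.
- by split=> // w wr; apply: HG; apply: lt_trans wr _.
move=> z; rewrite lt_min => /andP[ze zr].
have z1 : normc (z + 1) < 1 by apply: lt_le_trans ze e1.
split; first by apply: le_lt_trans zr; exact: uinv_le.
have [ur _] := fF _ ze; have [_ cD] := HD _ ur.
have c1 := cdiff_comp (cdiff_uinv (near_N1_neq1 z1)) cD.
rewrite /G mulrC; apply: cdiff_derive1.
apply: (@cdiff_near _ _ _ _ (e - normc (z + 1)) _ _ c1); first by rewrite subr_gt0.
move=> u; rewrite ltrBrDr => hu; have [|_ ->//] := fF u.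
apply: le_lt_trans hu; apply: le_trans (le_normcD _ _).
by rewrite addrA subrK.
Qed.

Lemma urep_phi : urep (@phi R) (@xcoef R).
Proof.
have [d d0 hd] := xi_Xi_near_half R.
have [M _ HM] := psum_bound (psum_Xi (1 : C)).
exists (fun w => Xi (2^-1%:C + w)), 1, M, (Num.min 1 d); split=> //.
- by rewrite lt_min ltr01.
- by rewrite ge_min lexx.
- split; first by move=> w _; exact: psum_Xi.
  by move=> n; have := HM n; rewrite normc1.
move=> z; rewrite lt_min => /andP[z1 zd]; have h := uinv_le z1.
split; first exact: le_lt_trans h z1.
by rewrite /phi -half_uinv hd // (le_lt_trans h).
Qed.

Lemma urep_phi_iter n : urep (@phi R)^`(n)%classic (iter n Dop (@xcoef R)).
Proof.
elim: n => [|n IH]; first by rewrite derive1n0; exact: urep_phi.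
by rewrite derive1nS iterS; exact: urep_derive.
Qed.

(** Stable under [Dop], as [Dop a 1 = a 2 / 2 + a 1]; it makes the next derivative positive, as
    [Dop a 0 = a 1 / 4]. *)
Definition coef_inv a := (forall n, 0 <= a n) /\ 0 < a 1%N.

Lemma Dop_ge0 a n : (forall k, 0 <= dcoef a k) -> 0 <= Dop a n.
Proof.
move=> d0; apply: addr_ge0; first by rewrite mulr_ge0 // invr_ge0.
by apply: addr_ge0; case: n => [|[|n]] /=; rewrite ?lexx ?d0.
Qed.

(** The base case: [Dop] reads only the coefficients of index at least 1, and as [xcoef 1 = 0] the
    positivity of the linear coefficient comes from [xcoef 2]. *)
Lemma Dop_xcoef_inv : coef_inv (Dop (@xcoef R)).
Proof.
have x0 n : 0 <= dcoef (@xcoef R) n by rewrite mulr_ge0 // xcoef_ge0.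
have x1 : 0 < dcoef (@xcoef R) 1 by rewrite mulr_gt0 // xcoef2_gt0.
split=> [n|]; last first.
  by rewrite /Dop /= addr0; have := x0 0%N; lra.
exact: Dop_ge0.
Qed.

Lemma Dop_inv a : coef_inv a -> coef_inv (Dop a).
Proof.
move=> [a0 a1]; have x0 n : 0 <= dcoef a n by rewrite mulr_ge0.
split=> [n|]; last first.
  by rewrite /Dop /= addr0 /dcoef; have := a0 2; lra.
exact: Dop_ge0.
Qed.

Lemma iter_Dop_inv n : coef_inv (iter n.+1 Dop (@xcoef R)).
Proof.
by elim: n => [|n IH]; [exact: Dop_xcoef_inv|rewrite iterS; exact: Dop_inv].
Qed.

End TaylorIteration.

(* On R[i], 0 < w means that w is a positive real number. *)
Theorem theorem2p3 (R : realType) :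
  (forall n : nat, (2 <= n)%N -> 0 < (@phi R)^`(n)%classic (-1)) /\
  (@phi R)^`()%classic (-1) = 0.
Proof.
split=> [[|[|n]]// _|].
  rewrite (urep_value (urep_phi_iter R n.+2)) iterS ltcR.
  have [_ a1] := iter_Dop_inv R n.
  (* The value of the derivative of order [n + 2] is a quarter of the linear coefficient of the
     derivative of order [n + 1]. *)
  by rewrite /Dop /= !addr0 /dcoef mul1r mulr_gt0 // invr_gt0.
have := urep_value (urep_phi_iter R 1); rewrite derive1n1 => ->.
by rewrite /= /Dop /dcoef xcoef1 !mulr0 !addr0.
Qed.
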